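(* Let $A,H$ be bialgebras or Hopf algebras forming a double cross product $A\bowtie H$, and let $\Omega(A),\Omega(H)$ be strongly bicovariant exterior algebras on them. Suppose that the right action $\triangleleft:H\otimes A\to H$ and the left action $\triangleright:H\otimes A\to A$ extend to degree-preserving maps $\triangleleft:\Omega(H)\underline{\otimes}\Omega(A)\to\Omega(H)$ and $\triangleright:\Omega(H)\underline{\otimes}\Omega(A)\to\Omega(A)$ making $\Omega(H)$ a super right $\Omega(A)$-module coalgebra and $\Omega(A)$ a super left $\Omega(H)$-module coalgebra, such that for all $\eta,\xi\in\Omega(H)$, $\omega,\tau\in\Omega(A)$ (of homogeneous degree) $$d_H(\eta\triangleleft\omega)=(d_H\eta)\triangleleft\omega+(-1)^{|\eta|}\eta\triangleleft d_A\omega,\qquad d_A(\eta\triangleright\omega)=(d_H\eta)\triangleright\omega+(-1)^{|\eta|}\eta\triangleright d_A\omega,$$ $$1_H\triangleleft\omega=1_H\epsilon(\omega),\qquad \eta\triangleright 1_A=1_A\epsilon(\eta),$$ $$(\eta\xi)\triangleleft\omega=(-1)^{|\omega_{(1)}||\xi_{(2)}|}(\eta\triangleleft(\xi_{(1)}\triangleright\omega_{(1)}))(\xi_{(2)}\triangleleft\omega_{(2)}),$$ $$\eta\triangleright(\omega\tau)=(-1)^{|\omega_{(1)}||\eta_{(2)}|}(\eta_{(1)}\triangleright\omega_{(1)})((\eta_{(2)}\triangleleft\omega_{(2)})\triangleright\tau),$$ $$(-1)^{|\omega_{(1)}||\eta_{(2)}|}\eta_{(1)}\triangleleft\omega_{(1)}\otimes\eta_{(2)}\triangleright\omega_{(2)}=(-1)^{|\eta_{(1)}|(|\eta_{(2)}|+|\omega_{(2)}|)+|\omega_{(1)}||\omega_{(2)}|}\eta_{(2)}\triangleleft\omega_{(2)}\otimes\eta_{(1)}\triangleright\omega_{(1)}.$$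 Then $\Omega(A\bowtie H):=\Omega(A)\bowtie\Omega(H)$ (the super double cross product) is a strongly bicovariant exterior algebra on $A\bowtie H$ with differential $$d(\omega\otimes\eta)=d_A\omega\otimes\eta+(-1)^{|\omega|}\omega\otimes d_H\eta$$ for all $\omega\in\Omega(A)$, $\eta\in\Omega(H)$.
   Context: Work over a field $k$. An exterior algebra on an algebra $A$ is a differential graded algebra $\Omega(A)=\oplus_{n\ge0}\Omega^n(A)$ with $\Omega^0=A$, generated by $A$ and $\Omega^1=\mathrm{span}\{a\,db\}$, with $d:\Omega^n\to\Omega^{n+1}$, $d^2=0$, $d(\omega\eta)=(d\omega)\eta+(-1)^{|\omega|}\omega\, d\eta$. The super tensor product $\underline\otimes$ has product $(a\otimes b)(c\otimes d)=(-1)^{|b||c|}ac\otimes bd$. If $A$ is a bialgebra (resp. Hopf algebra), $\Omega(A)$ is strongly bicovariant if it is a super-bialgebra (resp. super-Hopf algebra) with super grade the form degree mod 2, with coproduct $\Delta_*$ preserving total degree, restricting to $\Delta$ on $A$, and with $\Delta_*d\omega=(d\otimes\mathrm{id}+(-1)^{|\ |}\mathrm{id}\otimes d)\Delta_*\omega$, where $(-1)^{|\ |}\omega=(-1)^{|\omega|}\omega$. The counit vanishes in degree $\geq1$. Sweedler notation $\Delta_*\omega=\omega_{(1)}\otimes\omega_{(2)}$ is used with homogeneous components. A super right $\Omega(A)$-module coalgebra structure on $\Omega(H)$ is a super right action with $\Delta_*(\eta\triangleleft\omega)=(-1)^{|\eta_{(2)}||\omega_{(1)}|}\eta_{(1)}\triangleleft\omega_{(1)}\otimes\eta_{(2)}\triangleleft\omega_{(2)}$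 and $\epsilon(\eta\triangleleft\omega)=\epsilon(\eta)\epsilon(\omega)$; similarly for left module coalgebras. A double cross product $A\bowtie H$ is given by bialgebras/Hopf algebras $A,H$ with $H$ a right $A$-module coalgebra by $\triangleleft$ and $A$ a left $H$-module coalgebra by $\triangleright$, obeying the last four displayed lines of conditions of the claim restricted to degree 0 (no signs); it is $A\otimes H$ with tensor product coalgebra and product $(a\otimes h)(b\otimes g)=a(h_{(1)}\triangleright b_{(1)})\otimes(h_{(2)}\triangleleft b_{(2)})g$. The super double cross product $\Omega(A)\bowtie\Omega(H)$ is $\Omega(A)\otimes\Omega(H)$ with super tensor product coalgebra ($\Delta_*(\omega\otimes\eta)=(-1)^{|\omega_{(2)}||\eta_{(1)}|}\omega_{(1)}\otimes\eta_{(1)}\otimes\omega_{(2)}\otimes\eta_{(2)}$) and product $(\omega\otimes\eta)(\tau\otimes\xi)=(-1)^{|\eta_{(2)}||\tau_{(1)}|}\omega(\eta_{(1)}\triangleright\tau_{(1)})\otimes(\eta_{(2)}\triangleleft\tau_{(2)})\xi$. *)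

(* Defs.v *)
From HB Require Import structures.
From mathcomp Require Import all_boot all_order all_algebra.
From mathcomp Require Import generic_quotient sesquilinear.
From mathcomp Require Import boolp classical_sets fsbigop.

Set Implicit Arguments.
Unset Strict Implicit.
Unset Printing Implicit Defensive.

Import GRing.Theory.
Local Open Scope quotient_scope.
Local Open Scope ring_scope.

Notation bilin f := (bilinear_for *:%R *:%R f).

(* An element is a finite sum of pure tensors, represented by a list of pairs.
   Two such sums are equal iff every bilinear map to every vector space
   identifies them; [tliftE] and [tensor_ext] are the universal property. *)

Definition tsum {k : fieldType} {V W U : lmodType k} (f : V -> W -> U)
    (s : seq (V * W)) : U := \sum_(x <- s) f x.1 x.2.

Definition teq {k : fieldType} (V W : lmodType k) : rel (seq (V * W)) :=
  fun s t => `[< forall (U : lmodType k) (f : V -> W -> U),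
                   bilin f -> tsum f s = tsum f t >].

Lemma teq_equiv {k : fieldType} (V W : lmodType k) : equiv_class_of (@teq k V W).
Proof.
split=> [s|s t|t s u].
- exact/asboolP.
- by apply/asboolP/asboolP => h U f /h ->.
- by move=> /asboolP h1 /asboolP h2; apply/asboolP => U f bf; rewrite h1 ?h2.
Qed.

Canonical teq_equivRel {k : fieldType} (V W : lmodType k) :=
  EquivRelPack (@teq_equiv k V W).

Definition tensor {k : fieldType} (V W : lmodType k) := {eq_quot (@teq k V W)}.

HB.instance Definition _ {k : fieldType} (V W : lmodType k) :=
  EqQuotient.on (@tensor k V W).
HB.instance Definition _ {k : fieldType} (V W : lmodType k) :=
  Choice.on (@tensor k V W).

Definition tpure {k : fieldType} {V W : lmodType k} (v : V) (w : W) :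
  tensor V W := \pi_(tensor V W)%qT [:: (v, w)].

Notation "v ⊗ w" := (tpure v w) (at level 40, left associativity) : ring_scope.

(* The linear map induced by a bilinear [f]; it depends on the choice of a
   representative when [f] is not bilinear. *)
Definition tlift {k : fieldType} {V W U : lmodType k} (f : V -> W -> U)
  (t : tensor V W) : U := tsum f (repr t).

Section TensorModule.
Context {k : fieldType} (V W : lmodType k).
Implicit Types (s : seq (V * W)) (t : tensor V W).

Local Notation cls := (fun s => \pi_(tensor V W)%qT s).

Lemma tcls_eq s s' :
  (forall (U : lmodType k) (f : V -> W -> U), bilin f -> tsum f s = tsum f s') ->
  cls s = cls s'.
Proof. by move=> h; apply/eqmodP/asboolP. Qed.

Lemma tlift_cls (U : lmodType k) (f : V -> W -> U) s :
  bilin f -> tlift f (cls s) = tsum f s.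
Proof.
move=> bf; rewrite /tlift.
have /eqmodP/asboolP h : cls (repr (cls s)) = cls s by rewrite reprK.
exact: h.
Qed.

Lemma tensor_ext_lift t t' :
  (forall (U : lmodType k) (f : V -> W -> U), bilin f -> tlift f t = tlift f t') ->
  t = t'.
Proof. by move=> h; rewrite -[t]reprK -[t']reprK; apply: tcls_eq. Qed.

Definition tzero : tensor V W := cls [::].
Definition tadd t t' : tensor V W := cls (repr t ++ repr t').
Definition tscale (a : k) t : tensor V W := cls [seq (a *: x.1, x.2) | x <- repr t].
Definition topp t : tensor V W := tscale (-1) t.

Lemma tlift_zero (U : lmodType k) (f : V -> W -> U) :
  bilin f -> tlift f tzero = 0.
Proof. by move=> bf; rewrite tlift_cls // /tsum big_nil. Qed.

Lemma tlift_add (U : lmodType k) (f : V -> W -> U) t t' :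
  bilin f -> tlift f (tadd t t') = tlift f t + tlift f t'.
Proof. by move=> bf; rewrite tlift_cls // /tsum big_cat. Qed.

Lemma tlift_scale (U : lmodType k) (f : V -> W -> U) a t :
  bilin f -> tlift f (tscale a t) = a *: tlift f t.
Proof.
move=> bf; rewrite tlift_cls // /tsum big_map scaler_sumr.
by apply: eq_bigr => -[v w] _ /=; have /scalable_linear := bf.1 w; apply.
Qed.

Let tliftS := (tlift_zero, tlift_add, tlift_scale).

Lemma taddA : associative tadd.
Proof. by move=> x y z; apply: tensor_ext_lift => U f bf; rewrite !tliftS // addrA. Qed.
Lemma taddC : commutative tadd.
Proof. by move=> x y; apply: tensor_ext_lift => U f bf; rewrite !tliftS // addrC. Qed.
Lemma tadd0 : left_id tzero tadd.
Proof. by move=> x; apply: tensor_ext_lift => U f bf; rewrite !tliftS // add0r. Qed.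
Lemma taddN : left_inverse tzero topp tadd.
Proof.
by move=> x; apply: tensor_ext_lift => U f bf; rewrite !tliftS // scaleN1r addNr.
Qed.

HB.instance Definition _ := GRing.isZmodule.Build (tensor V W) taddA taddC tadd0 taddN.

Lemma tscaleA a b t : tscale a (tscale b t) = tscale (a * b) t.
Proof. by apply: tensor_ext_lift => U f bf; rewrite !tliftS // scalerA. Qed.
Lemma tscale1 : left_id 1 tscale.
Proof. by move=> t; apply: tensor_ext_lift => U f bf; rewrite !tliftS // scale1r. Qed.
Lemma tscaleDr : right_distributive tscale +%R.
Proof.
by move=> a t t'; apply: tensor_ext_lift => U f bf; rewrite !tliftS // scalerDr.
Qed.
Lemma tscaleDl t : {morph tscale^~ t : a b / a + b}.
Proof.
by move=> a b; apply: tensor_ext_lift => U f bf; rewrite !tliftS // scalerDl.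
Qed.

HB.instance Definition _ :=
  GRing.Zmodule_isLmodule.Build k (tensor V W) tscaleA tscale1 tscaleDr tscaleDl.

Lemma tlift_linear (U : lmodType k) (f : V -> W -> U) : bilin f -> linear (tlift f).
Proof. by move=> bf a x y; rewrite tlift_add // tlift_scale. Qed.

Lemma tliftE (U : lmodType k) (f : V -> W -> U) v w :
  bilin f -> tlift f (v ⊗ w) = f v w.
Proof. by move=> bf; rewrite tlift_cls // /tsum big_seq1. Qed.

Lemma tpure_bilin : bilin (@tpure k V W).
Proof.
split=> [w a v v'|v a w w'] /=; apply: tensor_ext_lift => U f bf;
  rewrite tlift_linear // !tliftE //; [exact: bf.1|exact: bf.2].
Qed.

Lemma tensor_sum t : t = \sum_(x <- repr t) x.1 ⊗ x.2.
Proof.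
apply: tensor_ext_lift => U f bf; rewrite {1}/tlift /tsum.
elim: (repr t) => [|x s ih]; first by rewrite !big_nil tlift_zero.
by rewrite !big_cons tlift_add // tliftE // ih.
Qed.

Lemma tensor_ext (U : lmodType k) (f g : tensor V W -> U) :
  linear f -> linear g -> (forall v w, f (v ⊗ w) = g (v ⊗ w)) -> f =1 g.
Proof.
move=> lf lg fg t; rewrite (tensor_sum t).
have f0 : f 0 = 0 by have := lf (-1) 0 0; rewrite scaler0 addr0 scaleN1r addNr.
have g0 : g 0 = 0 by have := lg (-1) 0 0; rewrite scaler0 addr0 scaleN1r addNr.
elim: (repr t) => [|x s ih]; first by rewrite !big_nil f0 g0.
by rewrite !big_cons -[x.1 ⊗ x.2]scale1r lf lg fg ih.
Qed.

End TensorModule.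

Definition tmap {k : fieldType} {V W V' W' : lmodType k}
    (f : V -> V') (g : W -> W') (t : tensor V W) : tensor V' W' :=
  tlift (fun v w => f v ⊗ g w) t.

Definition tassoc {k : fieldType} {U V W : lmodType k}
    (t : tensor (tensor U V) W) : tensor U (tensor V W) :=
  tlift (fun x w => tlift (fun u v => u ⊗ (v ⊗ w)) x) t.

(* A decomposition V = (+)_n V_n, given by the projections [pr n] onto V_n. *)
Record is_grading {k : fieldType} (V : lmodType k) (pr : nat -> V -> V) : Prop := {
  grading_linear : forall n, linear (pr n);
  grading_proj : forall m n x, pr m (pr n x) = if m == n then pr n x else 0;
  grading_sum : forall x, exists N, x = \sum_(n < N) pr n x
}.

Definition homog {k : fieldType} {V : lmodType k} (pr : nat -> V -> V)
  (n : nat) (x : V) : Prop := pr n x = x.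

Definition tensor_pr {k : fieldType} {V W : lmodType k} (prV : nat -> V -> V)
    (prW : nat -> W -> W) (n : nat) : tensor V W -> tensor V W :=
  fun t => \sum_(i < n.+1) tmap (prV i) (prW (n - i)%N) t.

(* A super vector space V = V_0 (+) V_1, given by the projection [p false] onto
   the even part and [p true] onto the odd part. *)
Record is_super {k : fieldType} (V : lmodType k) (p : bool -> V -> V) : Prop := {
  super_linear : forall b, linear (p b);
  super_proj : forall b c x, p b (p c x) = if b == c then p c x else 0;
  super_sum : forall x, p false x + p true x = x
}.

(* The parity is the degree mod 2; the sum has finite support by
   [grading_sum]. *)
Definition parity {k : fieldType} {V : lmodType k} (pr : nat -> V -> V)
    (b : bool) (x : V) : V :=
  \sum_(n \in [set n : nat | odd n = b]%classic) pr n x.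

Definition tensor_parity {k : fieldType} {V W : lmodType k}
    (pV : bool -> V -> V) (pW : bool -> W -> W) (b : bool) :
    tensor V W -> tensor V W :=
  fun t => \sum_(c : bool) tmap (pV c) (pW (b (+) c)) t.

(* The operator (-1)^{|x|}. *)
Definition gsign {k : fieldType} {V : lmodType k} (p : bool -> V -> V) (x : V) : V :=
  p false x - p true x.

(* Sweedler sums over homogeneous components: if t = t_(1) ⊗ t_(2), this is
   the sum of F |t_(1)| |t_(2)| t_(1) t_(2), with the parities in bool. *)
Definition sweedler {k : fieldType} {V W U : lmodType k}
    (pV : bool -> V -> V) (pW : bool -> W -> W) (t : tensor V W)
    (F : bool -> bool -> V -> W -> U) : U :=
  \sum_(b : bool) \sum_(c : bool) tlift (fun v w => F b c (pV b v) (pW c w)) t.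

(* Structure maps without axioms: the axioms are separate predicates because
   for (super) double cross products they are to be proved. *)
Record bialg (k : fieldType) := Bialg {
  car :> lmodType k;
  mul : car -> car -> car;
  one : car;
  cop : car -> tensor car car;
  eps : car -> k
}.
Arguments Bialg {k car}.
Arguments mul {k b}.
Arguments one {k}.
Arguments cop {k b}.
Arguments eps {k b}.

Record is_algebra {k : fieldType} (A : bialg k) : Prop := {
  mul_bilin : bilin (@mul k A);
  mul_assoc : forall x y z : A, mul x (mul y z) = mul (mul x y) z;
  mul_onel : forall x : A, mul (one A) x = x;
  mul_oner : forall x : A, mul x (one A) = x
}.

Record is_coalgebra {k : fieldType} (A : bialg k) : Prop := {
  cop_linear : linear (@cop k A);
  eps_linear : scalar (@eps k A);
  cop_assoc : forall x : A, tassoc (tmap cop id (cop x)) = tmap id cop (cop x);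
  cop_counitl : forall x : A, tlift (fun y z => eps y *: z) (cop x) = x;
  cop_counitr : forall x : A, tlift (fun y z => eps z *: y) (cop x) = x
}.

Definition tensor_mul {k : fieldType} (A : bialg k) (s t : tensor A A) :
    tensor A A :=
  tlift (fun a b => tlift (fun c d => mul a c ⊗ mul b d) t) s.

Record is_bialgebra {k : fieldType} (A : bialg k) : Prop := {
  bialgebra_alg : is_algebra A;
  bialgebra_coalg : is_coalgebra A;
  bialgebra_cop_mul : forall x y : A, cop (mul x y) = tensor_mul (cop x) (cop y);
  bialgebra_cop_one : cop (one A) = one A ⊗ one A;
  bialgebra_eps_mul : forall x y : A, eps (mul x y) = eps x * eps y;
  bialgebra_eps_one : eps (one A) = 1
}.

Record is_antipode {k : fieldType} (A : bialg k) (S : A -> A) : Prop := {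
  antipode_linear : linear S;
  antipode_left : forall x : A,
    tlift (fun y z => mul (S y) z) (cop x) = eps x *: one A;
  antipode_right : forall x : A,
    tlift (fun y z => mul y (S z)) (cop x) = eps x *: one A
}.

Definition is_hopf {k : fieldType} (A : bialg k) : Prop :=
  is_bialgebra A /\ exists S : A -> A, is_antipode S.

(* The product (a ⊗ b)(c ⊗ d) = (-1)^{|b||c|} ac ⊗ bd. *)
Definition super_tensor_mul {k : fieldType} (A : bialg k) (p : bool -> A -> A)
    (s t : tensor A A) : tensor A A :=
  tlift (fun a b => tlift (fun c d =>
    sweedler p p (b ⊗ c) (fun q r b c =>
      (-1) ^+ (q * r) *: (mul a c ⊗ mul b d))) t) s.

Record is_super_bialgebra {k : fieldType} (A : bialg k) (p : bool -> A -> A) :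
    Prop := {
  sbialgebra_super : is_super p;
  sbialgebra_alg : is_algebra A;
  sbialgebra_coalg : is_coalgebra A;
  sbialgebra_mul_even : forall b c (x y : A), p b x = x -> p c y = y ->
    p (b (+) c) (mul x y) = mul x y;
  sbialgebra_one_even : p false (one A) = one A;
  sbialgebra_cop_even : forall b (x : A), p b x = x ->
    tensor_parity p p b (cop x) = cop x;
  sbialgebra_eps_even : forall x : A, eps (p true x) = 0;
  sbialgebra_cop_mul : forall x y : A,
    cop (mul x y) = super_tensor_mul p (cop x) (cop y);
  sbialgebra_cop_one : cop (one A) = one A ⊗ one A;
  sbialgebra_eps_mul : forall x y : A, eps (mul x y) = eps x * eps y;
  sbialgebra_eps_one : eps (one A) = 1
}.

Definition is_super_hopf {k : fieldType} (A : bialg k) (p : bool -> A -> A) : Prop :=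
  is_super_bialgebra p /\
  exists S : A -> A, is_antipode S /\ forall b x, S (p b x) = p b (S x).

Record dgbialg (k : fieldType) := DGBialg {
  dgcar :> bialg k;
  pr : nat -> dgcar -> dgcar;
  diff : dgcar -> dgcar
}.
Arguments DGBialg {k dgcar}.
Arguments pr {k}.
Arguments diff {k d}.

Notation par O := (parity (pr O)).

Inductive generated {k : fieldType} (A : bialg k) (S : A -> Prop) : A -> Prop :=
| generated_base x : S x -> generated S x
| generated_zero : generated S 0
| generated_one : generated S (one A)
| generated_add x y : generated S x -> generated S y -> generated S (x + y)
| generated_scale (a : k) x : generated S x -> generated S (a *: x)
| generated_mul x y : generated S x -> generated S y -> generated S (mul x y).

(* [iota] is the identification of A with the degree 0 part of Omega(A). *)
Record is_exterior_algebra {k : fieldType} (A : bialg k) (O : dgbialg k)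
    (iota : A -> O) : Prop := {
  ext_grading : is_grading (pr O);
  ext_alg : is_algebra O;
  ext_homog_one : homog (pr O) 0 (one O);
  ext_homog_mul : forall m n (x y : O), homog (pr O) m x -> homog (pr O) n y ->
    homog (pr O) (m + n) (mul x y);
  ext_iota_linear : linear iota;
  ext_iota_inj : injective iota;
  ext_iota_deg0 : forall x : O, homog (pr O) 0 x <-> exists a, x = iota a;
  ext_iota_one : iota (one A) = one O;
  ext_iota_mul : forall a b, iota (mul a b) = mul (iota a) (iota b);
  ext_diff_linear : linear (@diff k O);
  ext_diff_homog : forall n (x : O), homog (pr O) n x -> homog (pr O) n.+1 (diff x);
  ext_diff_diff : forall x : O, diff (diff x) = 0;
  ext_leibniz : forall n (x y : O), homog (pr O) n x ->
    diff (mul x y) = mul (diff x) y + (-1) ^+ n *: mul x (diff y);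
  ext_deg1 : forall x : O, homog (pr O) 1 x <->
    exists s : seq (A * A), x = \sum_(y <- s) mul (iota y.1) (diff (iota y.2));
  ext_generated : forall x : O,
    generated (fun y => homog (pr O) 0 y \/ homog (pr O) 1 y) x
}.

Record is_bicovariant_coproduct {k : fieldType} (A : bialg k) (O : dgbialg k)
    (iota : A -> O) : Prop := {
  bicov_homog : forall n (x : O), homog (pr O) n x ->
    homog (tensor_pr (pr O) (pr O)) n (cop x);
  bicov_cop_iota : forall a, cop (iota a) = tmap iota iota (cop a);
  bicov_eps_iota : forall a, eps (iota a) = eps a;
  bicov_eps_homog : forall n (x : O), homog (pr O) n.+1 x -> eps x = 0;
  bicov_cop_diff : forall x : O,
    cop (diff x) = tmap diff id (cop x) + tmap (gsign (par O)) diff (cop x)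
}.

Definition strongly_bicovariant {k : fieldType} (A : bialg k) (O : dgbialg k)
    (iota : A -> O) : Prop :=
  [/\ is_bialgebra A, is_exterior_algebra iota,
      is_super_bialgebra (par O) & is_bicovariant_coproduct iota].

Definition strongly_bicovariant_hopf {k : fieldType} (A : bialg k) (O : dgbialg k)
    (iota : A -> O) : Prop :=
  [/\ is_hopf A, is_exterior_algebra iota,
      is_super_hopf (par O) & is_bicovariant_coproduct iota].

Record is_right_module_coalgebra {k : fieldType} (A H : bialg k)
    (ra : H -> A -> H) : Prop := {
  rmc_bilin : bilin ra;
  rmc_one : forall h, ra h (one A) = h;
  rmc_mul : forall h a b, ra h (mul a b) = ra (ra h a) b;
  rmc_cop : forall h a, cop (ra h a) =
    tlift (fun h1 h2 => tlift (fun a1 a2 => ra h1 a1 ⊗ ra h2 a2) (cop a)) (cop h);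
  rmc_eps : forall h a, eps (ra h a) = eps h * eps a
}.

Record is_left_module_coalgebra {k : fieldType} (A H : bialg k)
    (la : H -> A -> A) : Prop := {
  lmc_bilin : bilin la;
  lmc_one : forall a, la (one H) a = a;
  lmc_mul : forall h g a, la (mul h g) a = la h (la g a);
  lmc_cop : forall h a, cop (la h a) =
    tlift (fun h1 h2 => tlift (fun a1 a2 => la h1 a1 ⊗ la h2 a2) (cop a)) (cop h);
  lmc_eps : forall h a, eps (la h a) = eps h * eps a
}.

Record is_matched_pair {k : fieldType} (A H : bialg k)
    (ra : H -> A -> H) (la : H -> A -> A) : Prop := {
  mp_right : is_right_module_coalgebra ra;
  mp_left : is_left_module_coalgebra la;
  mp_ra_one : forall a, ra (one H) a = eps a *: one H;
  mp_la_one : forall h, la h (one A) = eps h *: one A;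
  mp_ra_mul : forall h g a, ra (mul h g) a =
    tlift (fun g1 g2 => tlift (fun a1 a2 =>
      mul (ra h (la g1 a1)) (ra g2 a2)) (cop a)) (cop g);
  mp_la_mul : forall h a b, la h (mul a b) =
    tlift (fun h1 h2 => tlift (fun a1 a2 =>
      mul (la h1 a1) (la (ra h2 a2) b)) (cop a)) (cop h);
  mp_compat : forall h a,
    tlift (fun h1 h2 => tlift (fun a1 a2 => ra h1 a1 ⊗ la h2 a2) (cop a)) (cop h) =
    tlift (fun h1 h2 => tlift (fun a1 a2 => ra h2 a2 ⊗ la h1 a1) (cop a)) (cop h)
}.

Definition double_cross {k : fieldType} (A H : bialg k)
    (ra : H -> A -> H) (la : H -> A -> A) : bialg k :=
  @Bialg k (tensor A H)
    (fun s t => tlift (fun a h => tlift (fun b g =>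
       tlift (fun h1 h2 => tlift (fun b1 b2 =>
         mul a (la h1 b1) ⊗ mul (ra h2 b2) g) (cop b)) (cop h)) t) s)
    (one A ⊗ one H)
    (fun t => tlift (fun a h =>
       tlift (fun a1 a2 => tlift (fun h1 h2 =>
         (a1 ⊗ h1) ⊗ (a2 ⊗ h2)) (cop h)) (cop a)) t)
    (fun t => tlift (U := k^o) (fun a h => eps a * eps h) t).

Record is_super_right_module_coalgebra {k : fieldType} (OA OH : dgbialg k)
    (ra : OH -> OA -> OH) : Prop := {
  srmc_bilin : bilin ra;
  srmc_homog : forall m n (x : OH) (w : OA),
    homog (pr OH) m x -> homog (pr OA) n w -> homog (pr OH) (m + n) (ra x w);
  srmc_one : forall x, ra x (one OA) = x;
  srmc_mul : forall x w z, ra x (mul w z) = ra (ra x w) z;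
  srmc_cop : forall x w, cop (ra x w) =
    sweedler (par OH) (par OH) (cop x) (fun p1 p2 x1 x2 =>
    sweedler (par OA) (par OA) (cop w) (fun q1 q2 w1 w2 =>
      (-1) ^+ (p2 * q1) *: (ra x1 w1 ⊗ ra x2 w2)));
  srmc_eps : forall x w, eps (ra x w) = eps x * eps w
}.

Record is_super_left_module_coalgebra {k : fieldType} (OA OH : dgbialg k)
    (la : OH -> OA -> OA) : Prop := {
  slmc_bilin : bilin la;
  slmc_homog : forall m n (x : OH) (w : OA),
    homog (pr OH) m x -> homog (pr OA) n w -> homog (pr OA) (m + n) (la x w);
  slmc_one : forall w, la (one OH) w = w;
  slmc_mul : forall x y w, la (mul x y) w = la x (la y w);
  slmc_cop : forall x w, cop (la x w) =
    sweedler (par OH) (par OH) (cop x) (fun p1 p2 x1 x2 =>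
    sweedler (par OA) (par OA) (cop w) (fun q1 q2 w1 w2 =>
      (-1) ^+ (p2 * q1) *: (la x1 w1 ⊗ la x2 w2)));
  slmc_eps : forall x w, eps (la x w) = eps x * eps w
}.

Record is_super_matched_pair {k : fieldType} (OA OH : dgbialg k)
    (ra : OH -> OA -> OH) (la : OH -> OA -> OA) : Prop := {
  smp_right : is_super_right_module_coalgebra ra;
  smp_left : is_super_left_module_coalgebra la;
  smp_ra_diff : forall n (x : OH) (w : OA), homog (pr OH) n x ->
    diff (ra x w) = ra (diff x) w + (-1) ^+ n *: ra x (diff w);
  smp_la_diff : forall n (x : OH) (w : OA), homog (pr OH) n x ->
    diff (la x w) = la (diff x) w + (-1) ^+ n *: la x (diff w);
  smp_ra_one : forall w, ra (one OH) w = eps w *: one OH;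
  smp_la_one : forall x, la x (one OA) = eps x *: one OA;
  smp_ra_mul : forall x y w, ra (mul x y) w =
    sweedler (par OH) (par OH) (cop y) (fun p1 p2 y1 y2 =>
    sweedler (par OA) (par OA) (cop w) (fun q1 q2 w1 w2 =>
      (-1) ^+ (q1 * p2) *: mul (ra x (la y1 w1)) (ra y2 w2)));
  smp_la_mul : forall x w z, la x (mul w z) =
    sweedler (par OH) (par OH) (cop x) (fun p1 p2 x1 x2 =>
    sweedler (par OA) (par OA) (cop w) (fun q1 q2 w1 w2 =>
      (-1) ^+ (q1 * p2) *: mul (la x1 w1) (la (ra x2 w2) z)));
  smp_compat : forall x w,
    sweedler (par OH) (par OH) (cop x) (fun p1 p2 x1 x2 =>
    sweedler (par OA) (par OA) (cop w) (fun q1 q2 w1 w2 =>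
      (-1) ^+ (q1 * p2) *: (ra x1 w1 ⊗ la x2 w2))) =
    sweedler (par OH) (par OH) (cop x) (fun p1 p2 x1 x2 =>
    sweedler (par OA) (par OA) (cop w) (fun q1 q2 w1 w2 =>
      (-1) ^+ (p1 * (p2 + q2) + q1 * q2) *: (ra x2 w2 ⊗ la x1 w1)))
}.

Definition super_double_cross_bialg {k : fieldType} (OA OH : dgbialg k)
    (ra : OH -> OA -> OH) (la : OH -> OA -> OA) : bialg k :=
  @Bialg k (tensor OA OH)
    (fun s t => tlift (fun w x => tlift (fun z y =>
       sweedler (par OH) (par OH) (cop x) (fun p1 p2 x1 x2 =>
       sweedler (par OA) (par OA) (cop z) (fun q1 q2 z1 z2 =>
         (-1) ^+ (p2 * q1) *: (mul w (la x1 z1) ⊗ mul (ra x2 z2) y)))) t) s)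
    (one OA ⊗ one OH)
    (fun t => tlift (fun w x =>
       sweedler (par OA) (par OA) (cop w) (fun q1 q2 w1 w2 =>
       sweedler (par OH) (par OH) (cop x) (fun p1 p2 x1 x2 =>
         (-1) ^+ (q2 * p1) *: ((w1 ⊗ x1) ⊗ (w2 ⊗ x2))))) t)
    (fun t => tlift (U := k^o) (fun w x => eps w * eps x) t).

(* The differential is d(w ⊗ x) = dw ⊗ x + (-1)^{|w|} w ⊗ dx. *)
Definition super_double_cross {k : fieldType} (OA OH : dgbialg k)
    (ra : OH -> OA -> OH) (la : OH -> OA -> OA) : dgbialg k :=
  @DGBialg k (super_double_cross_bialg ra la)
    (tensor_pr (pr OA) (pr OH))
    (fun t => tlift (fun w x =>
       diff w ⊗ x + gsign (par OA) w ⊗ diff x) t).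

(* Main.v *)
From mathcomp Require Import all_boot all_algebra.
From mathcomp Require Import sesquilinear.
From mathcomp Require Import boolp classical_sets functions fsbigop.
Require Import Defs.

Set Implicit Arguments.
Unset Strict Implicit.
Unset Printing Implicit Defensive.

Import GRing.Theory.
Local Open Scope ring_scope.

(** Write [C = OH ⊗ OA] for the super tensor product coalgebra. The two actions
    are morphisms of super coalgebras [La : C -> OA] and [Ra : C -> OH], and the
    product of the double cross product is governed by their convolution, the
    exchange map [E = (La ⊗ Ra) ∘ Δ : OH ⊗ OA -> OA ⊗ OH], through
      [(w ⊗ x)(z ⊗ y) = w · E(x ⊗ z) · y].
    All signs of the product are those of the coproduct of [C]; written with [E],
    the conditions on the action of a product and the action on a product carry
    no sign at all.

    The product is associative because these conditions, with the module axioms,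
    say that moving a product past an element by [E] is the same as moving its
    factors one after the other: the two hexagon identities [exchange_mull] and
    [exchange_mulr].

    The coproduct is multiplicative because the last compatibility condition says
    that [La] and [Ra] cocommute, and the convolution of two cocommuting coalgebra
    maps is a coalgebra map ([convolution_cop]); hence so is [E] ([exchange_cop]).
    The algebra [OA ⊗ OH] is generated by [OA ⊗ 1] and [1 ⊗ OH], with [E] as the
    rule for commuting one past the other, so that multiplicativity on these three
    kinds of products propagates to all products ([double_cross_cop_mul]), by
    associativity of the super tensor square.

    For the differential, the tensor product of two super coalgebras with
    coderivations is again one ([tens_coderivation]); this applies to [C] and to
    [OA ⊗ OH]. As the actions commute with the differentials, so does [E]
    ([exchange_diff]), and this is the Leibniz rule for a product
    [(1 ⊗ x)(z ⊗ 1)], from which the general one follows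
    ([double_cross_leibniz]). One-forms are spanned by the [a db] because
    [db ⊗ h] is [d(b ⊗ h)] minus [b ⊗ dh] ([double_cross_deg1]).

    The double cross product of [A] and [H] embeds in degree zero, compatibly with
    all operations, and inherits its bialgebra axioms ([even_sub_bialgebra]).
    Antipodes reverse the factorisation, [S(w ⊗ x) = ± (1 ⊗ S x)(S w ⊗ 1)]; the
    same computation serves the super case and, with everything in even degree,
    the ordinary one.

    Signs are handled by proving every identity term by term in Sweedler sums over
    parity-homogeneous elements, where the exponents are compared modulo two. *)

(** * Linear maps and Sweedler sums *)

Section LinearMaps.
Context {k : fieldType}.
Implicit Types U V W X : lmodType k.

Lemma lin0 U V (f : U -> V) : linear f -> f 0 = 0.
Proof. by move=> lf; have := lf (-1) 0 0; rewrite scaler0 addr0 scaleN1r addNr. Qed.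

Lemma linD U V (f : U -> V) : linear f -> {morph f : x y / x + y}.
Proof. by move=> lf x y; have := lf 1 x y; rewrite !scale1r. Qed.

Lemma linZ U V (f : U -> V) : linear f -> forall a, {morph f : x / a *: x}.
Proof. by move=> lf a x; have := lf a x 0; rewrite (lin0 lf) !addr0. Qed.

Lemma linN U V (f : U -> V) : linear f -> {morph f : x / - x}.
Proof. by move=> lf x; rewrite -!scaleN1r (linZ lf). Qed.

Lemma lin_sum U V (f : U -> V) : linear f ->
  forall I (r : seq I) (P : pred I) (F : I -> U),
    f (\sum_(i <- r | P i) F i) = \sum_(i <- r | P i) f (F i).
Proof. by move=> lf I r P F; rewrite (big_morph f (linD lf) (lin0 lf)). Qed.

Lemma linear_id U : linear (fun x : U => x).
Proof. by []. Qed.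

Lemma linear_zero U V : linear (fun _ : U => 0 : V).
Proof. by move=> a x y; rewrite scaler0 addr0. Qed.

Lemma linear_comp U V W (f : V -> W) (g : U -> V) :
  linear f -> linear g -> linear (fun x => f (g x)).
Proof. by move=> lf lg a x y; rewrite lg lf. Qed.

Lemma linear_scale U V (c : k) (g : U -> V) : linear g -> linear (fun x => c *: g x).
Proof. by move=> lg a x y; rewrite lg scalerDr !scalerA mulrC. Qed.

Lemma linear_scalel U V W (h : W -> k) (g : U -> W) (v : V) :
  scalar h -> linear g -> linear (fun x => h (g x) *: v).
Proof. by move=> lh lg a x y; rewrite lg lh scalerDl scalerA. Qed.

Lemma linear_add U V (f g : U -> V) :
  linear f -> linear g -> linear (fun x => f x + g x).
Proof. by move=> lf lg a x y; rewrite lf lg scalerDr addrACA. Qed.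

Lemma linear_opp U V (f : U -> V) : linear f -> linear (fun x => - f x).
Proof. by move=> lf a x y; rewrite lf opprD scalerN. Qed.

Lemma linear_big U V I (r : seq I) (P : pred I) (F : I -> U -> V) :
  (forall i, linear (F i)) -> linear (fun x => \sum_(i <- r | P i) F i x).
Proof.
move=> lF a x y; rewrite scaler_sumr -big_split.
by apply: eq_bigr => i _; rewrite lF.
Qed.

Lemma bilin_l U V W (f : U -> V -> W) v : bilin f -> linear (fun u => f u v).
Proof. by case. Qed.

Lemma bilin_r U V W (f : U -> V -> W) u : bilin f -> linear (f u).
Proof. by case. Qed.

Lemma linear_bilin_l U V W X (f : U -> V -> W) (g : X -> U) v :
  bilin f -> linear g -> linear (fun x => f (g x) v).
Proof. by move=> [lf _] lg; apply: (linear_comp (lf v) lg). Qed.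

(** [tlift] sums [F x] over a representative of [t] that is chosen independently
    of [x]. *)
Lemma linear_tlift_param U V W X (F : X -> U -> V -> W) t :
  (forall u v, linear (fun x => F x u v)) -> linear (fun x => tlift (F x) t).
Proof. by move=> lF; apply: linear_big => i; apply: lF. Qed.

Lemma linear_sweedler_param U V W X (pU : bool -> U -> U) (pV : bool -> V -> V)
    (F : X -> bool -> bool -> U -> V -> W) t :
  (forall b c u v, linear (fun x => F x b c u v)) ->
  linear (fun x => sweedler pU pV t (F x)).
Proof.
move=> lF; apply: linear_big => b; apply: linear_big => c.
by apply: linear_tlift_param => u v; apply: lF.
Qed.

Lemma bilinI U V W (f : U -> V -> W) :
  (forall v, linear (fun u => f u v)) -> (forall u, linear (fun v => f u v)) ->
  bilin f.
Proof. by []. Qed.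

Lemma tlift_lin U V W (f : U -> V -> W) : bilin f -> linear (fun t => tlift f t).
Proof. exact: tlift_linear. Qed.

Lemma linear_sweedler U V W (pU : bool -> U -> U) (pV : bool -> V -> V)
    (F : bool -> bool -> U -> V -> W) :
  (forall b, linear (pU b)) -> (forall b, linear (pV b)) ->
  (forall b c, bilin (F b c)) ->
  linear (fun t => sweedler pU pV t F).
Proof.
move=> lU lV lF; apply: linear_big => b; apply: linear_big => c.
apply: tlift_lin; apply: bilinI => u.
  exact: (linear_comp (bilin_l _ (lF b c)) (lU b)).
exact: (linear_comp (bilin_r _ (lF b c)) (lV c)).
Qed.

End LinearMaps.

Create HintDb lin discriminated.
Create HintDb bil discriminated.
Hint Extern 1 (scalar _) => match goal with h : _ |- _ => exact: h end : lin.
Hint Extern 1 (linear _) => match goal with h : _ |- _ => exact: h end : lin.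
Hint Extern 1 (bilinear_for _ _ _) => match goal with h : _ |- _ => exact: h end : bil.
Hint Resolve tpure_bilin : bil.

(* Every manipulation of a Sweedler sum requires that its summand be multilinear;
   [lin] proves this by following the syntax of the summand down to the
   (bi)linear maps in the context. *)
Ltac lin_hint := solve [auto with lin nocore | eauto with lin bil nocore].
Ltac bil_hint := solve [auto with bil nocore].
Ltac lin :=
  intros; cbv beta;
  lazymatch goal with
  | |- bilinear_for _ _ _ => first [bil_hint | apply: bilinI; intros; lin]
  | |- forall _, _ => intros; lin
  | |- _ =>
  lazymatch goal with
  | |- GRing.linear_for _ (fun x => _) => idtac
  | |- GRing.linear_for ?s ?f =>
      try (change (GRing.linear_for s (fun x => f x)))
  end;
  first
  [ exact: linear_id | exact: linear_zero
  | match goal with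
    | |- GRing.linear_for _ (fun x => tlift ?f (@?g x)) =>
        apply: (linear_comp (f := fun t => tlift f t) (g := g));
          [apply: tlift_lin; lin | lin]
    | |- GRing.linear_for _ (fun x => tlift (@?f x) ?t) =>
        apply: linear_tlift_param; intros; lin
    | |- GRing.linear_for _ (fun x => sweedler ?p ?q (@?g x) ?f) =>
        apply: (linear_comp (f := fun t => sweedler p q t f) (g := g));
          [apply: linear_sweedler; intros; lin | lin]
    | |- GRing.linear_for _ (fun x => sweedler ?p ?q ?t (@?f x)) =>
        apply: linear_sweedler_param; intros; lin
    | |- GRing.linear_for _ (fun x => ?c *: (@?g x)) =>
        apply: (linear_scale c (g := g)); lin
    | |- GRing.linear_for _ (fun x => (@?f x) + (@?g x)) =>
        apply: (linear_add (f := f) (g := g)); lin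
    | |- GRing.linear_for _ (fun x => - (@?f x)) =>
        apply: (linear_opp (f := f)); lin
    | |- GRing.linear_for _ (fun x => \sum_(i <- ?r | @?P i) (@?F i x)) =>
        apply: (linear_big r P (F := F)); intros; lin
    | |- GRing.linear_for _ (fun x => tmap ?f ?g (@?h x)) =>
        unfold tmap; lin
    | |- GRing.linear_for _ (fun x => tassoc (@?h x)) =>
        unfold tassoc; lin
    | |- GRing.linear_for _ (fun x => (?h (@?g x)) *: ?v) =>
        apply: (linear_scalel v (h := h) (g := g)); [lin_hint | lin]
    | |- GRing.linear_for _ (fun x => ?f (@?g x) ?v) =>
        apply: (linear_bilin_l (f := f) (g := g)); [bil_hint | lin]
    | |- GRing.linear_for _ (fun x => ?f (@?g x) ?v) =>
        apply: (linear_comp (f := fun t => f t v) (g := g)); [lin_hint | lin]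
    | |- GRing.linear_for _ (fun x => ?f (@?g x) ?v ?u) =>
        apply: (linear_comp (f := fun t => f t v u) (g := g)); [lin_hint | lin]
    | |- GRing.linear_for _ (fun x => ?f ?u (@?g x)) =>
        apply: (linear_comp (f := f u) (g := g)); [apply: bilin_r; bil_hint | lin]
    | |- GRing.linear_for _ (fun x => ?f (@?g x)) =>
        apply: (linear_comp (f := f) (g := g)); [lin_hint | lin]
    end
  | lin_hint
  ]
  end.

Section Sweedler.
Context {k : fieldType}.
Implicit Types U V W X : lmodType k.

Lemma lin_tlift U V W X (f : W -> X) (F : U -> V -> W) t :
  linear f -> f (tlift F t) = tlift (fun u v => f (F u v)) t.
Proof. by move=> lf; rewrite /tlift /tsum (lin_sum lf). Qed.

Lemma lin_sweedler U V W X pU pV (f : W -> X) (F : bool -> bool -> U -> V -> W) t :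
  linear f ->
  f (sweedler pU pV t F) = sweedler pU pV t (fun b c u v => f (F b c u v)).
Proof.
move=> lf; rewrite /sweedler (lin_sum lf); apply: eq_bigr => b _.
by rewrite (lin_sum lf); apply: eq_bigr => c _; rewrite lin_tlift.
Qed.

Lemma scaler_sweedler U V W pU pV (F : bool -> bool -> U -> V -> W) a t :
  a *: sweedler pU pV t F = sweedler pU pV t (fun b c u v => a *: F b c u v).
Proof. by apply: (lin_sweedler _ _ _ _ (linear_scale a (@linear_id _ W))). Qed.

Lemma tensor_ind U V (P : tensor U V -> Prop) :
  P 0 -> (forall x y, P x -> P y -> P (x + y)) -> (forall u v, P (u ⊗ v)) ->
  forall t, P t.
Proof.
move=> P0 PD Pp t; rewrite (tensor_sum t).
by elim: (repr t) => [|x s ih]; rewrite ?big_nil // big_cons; apply: PD.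
Qed.

Lemma eq_tlift U V W (F G : U -> V -> W) t :
  (forall u v, F u v = G u v) -> tlift F t = tlift G t.
Proof. by move=> e; apply: eq_bigr => x _. Qed.

Lemma exchange_tlift U V U' V' W (F : U -> V -> U' -> V' -> W) s t :
  tlift (fun u v => tlift (F u v) t) s =
  tlift (fun u' v' => tlift (fun u v => F u v u' v') s) t.
Proof. exact: exchange_big. Qed.

Lemma tlift_sum U V W I (r : seq I) (F : I -> U -> V -> W) t :
  \sum_(i <- r) tlift (F i) t = tlift (fun u v => \sum_(i <- r) F i u v) t.
Proof. by rewrite /tlift /tsum exchange_big. Qed.

Lemma exchange_sweedler U V U' V' W pU pV pU' pV'
    (F : bool -> bool -> U -> V -> bool -> bool -> U' -> V' -> W) s t :
  sweedler pU pV s (fun b c u v =>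
    sweedler pU' pV' t (fun b' c' u' v' => F b c u v b' c' u' v')) =
  sweedler pU' pV' t (fun b' c' u' v' =>
    sweedler pU pV s (fun b c u v => F b c u v b' c' u' v')).
Proof.
rewrite /sweedler; under eq_bigr => b _ do under eq_bigr => c _ do
  (rewrite -tlift_sum; under eq_bigr => b' _ do
     (rewrite -tlift_sum; under eq_bigr => c' _ do rewrite exchange_tlift)).
under eq_bigr => b _ do rewrite exchange_big.
rewrite exchange_big; apply: eq_bigr => b' _.
under eq_bigr => b _ do rewrite exchange_big.
rewrite exchange_big; apply: eq_bigr => c' _ /=.
rewrite -tlift_sum; apply: eq_bigr => b _.
by rewrite -tlift_sum; apply: eq_bigr => c _.
Qed.

Lemma tlift_tmap U V U' V' W (f : U -> U') (g : V -> V') (F : U' -> V' -> W) t :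
  bilin F -> tlift F (tmap f g t) = tlift (fun u v => F (f u) (g v)) t.
Proof.
move=> bF; rewrite /tmap (lin_tlift _ _ (f := tlift F)); last exact: tlift_lin.
by apply: eq_tlift => u v; rewrite tliftE.
Qed.

Lemma tmap_pure U V U' V' (f : U -> U') (g : V -> V') u v :
  linear f -> linear g -> tmap f g (u ⊗ v) = f u ⊗ g v.
Proof. by move=> lf lg; rewrite /tmap tliftE //; lin. Qed.

Lemma tassoc_pure U V W (u : U) (v : V) (w : W) : tassoc ((u ⊗ v) ⊗ w) = u ⊗ (v ⊗ w).
Proof. by rewrite /tassoc tliftE; [rewrite tliftE //; lin | lin]. Qed.

Lemma tmap_linear U V U' V' (f : U -> U') (g : V -> V') :
  linear f -> linear g -> linear (tmap f g).
Proof. by move=> lf lg; apply: tlift_lin; lin. Qed.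

Lemma tassoc_linear U V W : linear (@tassoc k U V W).
Proof. by apply: tlift_lin; lin. Qed.

End Sweedler.

(** * Super vector spaces *)

Section SuperSpaces.
Context {k : fieldType}.
Implicit Types U V W : lmodType k.

Lemma super_hom V (p : bool -> V -> V) b x : is_super p -> p b (p b x) = p b x.
Proof. by move=> sp; rewrite (super_proj sp) eqxx. Qed.

Lemma super_homE V (p : bool -> V -> V) b c x :
  is_super p -> p c x = x -> p b x = if b == c then x else 0.
Proof. by move=> sp e; rewrite -e (super_proj sp). Qed.

Lemma super_sum_bool V (p : bool -> V -> V) x : is_super p -> \sum_(b : bool) p b x = x.
Proof. by move=> sp; rewrite big_bool /= addrC (super_sum sp). Qed.

Lemma super_ext V U (p : bool -> V -> V) (f g : V -> U) :
  is_super p -> linear f -> linear g ->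
  (forall b x, p b x = x -> f x = g x) -> f =1 g.
Proof.
move=> sp lf lg e x; rewrite -(super_sum_bool x sp) (lin_sum lf) (lin_sum lg).
by apply: eq_bigr => b _; apply: (e b); apply: super_hom.
Qed.

(** Linear maps are compared on homogeneous pure tensors, where signs are
    constants. *)
Lemma tensor_hext V W U pV pW (f g : tensor V W -> U) :
  is_super pV -> is_super pW -> linear f -> linear g ->
  (forall b c v w, pV b v = v -> pW c w = w -> f (v ⊗ w) = g (v ⊗ w)) -> f =1 g.
Proof.
move=> sV sW lf lg e; apply: tensor_ext => // v w.
apply: (super_ext (p := pV) (f := fun v => f (v ⊗ w)) (g := fun v => g (v ⊗ w)));
  [done | lin | lin | move=> b {}v hv].
apply: (super_ext (p := pW) (f := fun w => f (v ⊗ w)) (g := fun w => g (v ⊗ w)));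
  [done | lin | lin | move=> c {}w hw].
exact: (e b c).
Qed.

Lemma eq_sweedler V W U pV pW (F G : bool -> bool -> V -> W -> U) t :
  is_super pV -> is_super pW ->
  (forall b c v w, pV b v = v -> pW c w = w -> F b c v w = G b c v w) ->
  sweedler pV pW t F = sweedler pV pW t G.
Proof.
move=> sV sW e; apply: eq_bigr => b _; apply: eq_bigr => c _.
by apply: eq_tlift => v w; apply: e; apply: super_hom.
Qed.

Lemma sweedlerE V W U pV pW (F : bool -> bool -> V -> W -> U) t :
  sweedler pV pW t F =
  tlift (fun v w => \sum_(b : bool) \sum_(c : bool) F b c (pV b v) (pW c w)) t.
Proof.
by rewrite /sweedler; under eq_bigr => b _ do rewrite tlift_sum; rewrite tlift_sum.
Qed.

Lemma sweedler_sumr V W U pV pW (F : bool -> V -> W -> U) t :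
  is_super pV -> (forall c w, linear (fun v => F c v w)) ->
  sweedler pV pW t (fun _ c v w => F c v w) =
  tlift (fun v w => \sum_(c : bool) F c v (pW c w)) t.
Proof.
move=> sV lF; rewrite sweedlerE; apply: eq_tlift => v w.
rewrite exchange_big; apply: eq_bigr => c _ /=.
by rewrite -(lin_sum (lF _ _)) super_sum_bool.
Qed.

Lemma sweedler_suml V W U pV pW (F : bool -> V -> W -> U) t :
  is_super pW -> (forall b v, linear (F b v)) ->
  sweedler pV pW t (fun b _ v w => F b v w) =
  tlift (fun v w => \sum_(b : bool) F b (pV b v) w) t.
Proof.
move=> sW lF; rewrite sweedlerE; apply: eq_tlift => v w.
by apply: eq_bigr => b _; rewrite -(lin_sum (lF _ _)) super_sum_bool.
Qed.

Lemma sweedler_tlift V W U pV pW (f : V -> W -> U) t :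
  is_super pV -> is_super pW -> bilin f ->
  sweedler pV pW t (fun _ _ => f) = tlift f t.
Proof.
move=> sV sW bf; rewrite /sweedler.
under eq_bigr => b _ do rewrite tlift_sum.
rewrite tlift_sum; apply: eq_tlift => v w.
under eq_bigr => b _ do rewrite -(lin_sum (bilin_r _ bf)) super_sum_bool //.
by rewrite -(lin_sum (bilin_l _ bf)) super_sum_bool.
Qed.

Lemma tmap_sweedler V W V' W' pV pW (f : V -> V') (g : W -> W') t :
  is_super pV -> is_super pW -> linear f -> linear g ->
  tmap f g t = sweedler pV pW t (fun _ _ v w => f v ⊗ g w).
Proof. by move=> sV sW lf lg; rewrite /tmap sweedler_tlift //; lin. Qed.

Lemma sweedler_pure V W U pV pW (F : bool -> bool -> V -> W -> U) b c v w :
  is_super pV -> is_super pW -> (forall b c, bilin (F b c)) ->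
  pV b v = v -> pW c w = w -> sweedler pV pW (v ⊗ w) F = F b c v w.
Proof.
move=> sV sW bF hv hw; rewrite /sweedler.
have lV := super_linear sV; have lW := super_linear sW.
have bl : forall b c, bilin (fun v w => F b c (pV b v) (pW c w)).
  by move=> b' c'; have := bF b' c' => bF'; lin.
rewrite (bigD1 b) //= (bigD1 c) //= tliftE // hv hw big1 ?addr0.
  rewrite big1 ?addr0 // => b' nb; rewrite big1 // => c' _; rewrite tliftE //.
  by rewrite (super_homE b' sV hv) (negPf nb) (lin0 (bilin_l _ (bF _ _))).
move=> c' nc; rewrite tliftE //.
by rewrite (super_homE c' sW hw) (negPf nc) (lin0 (bilin_r _ (bF _ _))).
Qed.

Lemma tensor_parity_linear V W (pV : bool -> V -> V) (pW : bool -> W -> W) b :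
  (forall b, linear (pV b)) -> (forall b, linear (pW b)) ->
  linear (tensor_parity pV pW b).
Proof.
move=> lV lW; apply: linear_big => c; exact: tmap_linear.
Qed.

Lemma tensor_parity_pure V W (pV : bool -> V -> V) (pW : bool -> W -> W) a b c v w :
  is_super pV -> is_super pW -> pV b v = v -> pW c w = w ->
  tensor_parity pV pW a (v ⊗ w) = if a == b (+) c then v ⊗ w else 0.
Proof.
move=> sV sW hv hw; have lV := super_linear sV; have lW := super_linear sW.
rewrite /tensor_parity (bigD1 b) //= tmap_pure // hv (super_homE _ sW hw).
rewrite big1 ?addr0 => [|b' nb]; last first.
  by rewrite tmap_pure // (super_homE _ sV hv) (negPf nb) (lin0 (bilin_l _ (tpure_bilin _ _))).
have -> : (a (+) b == c) = (a == b (+) c) by case: a b c {hv hw} => [] [] [].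
by case: ifP => // _; rewrite (lin0 (bilin_r _ (tpure_bilin _ _))).
Qed.

Lemma tensor_super V W (pV : bool -> V -> V) (pW : bool -> W -> W) :
  is_super pV -> is_super pW -> is_super (tensor_parity pV pW).
Proof.
move=> sV sW.
have lP b : linear (tensor_parity pV pW b).
  exact: tensor_parity_linear (super_linear sV) (super_linear sW).
split=> // [b c|].
  apply: (tensor_hext sV sW).
  - exact: linear_comp.
  - by case: eqP => // _; exact: linear_zero.
  - move=> b1 c1 v w hv hw; rewrite !(tensor_parity_pure c sV sW hv hw).
    case: (c =P _) => [-> | _]; last by rewrite (lin0 (lP _)) if_same.
    by rewrite (tensor_parity_pure b sV sW hv hw).
apply: (tensor_hext sV sW).
- exact: linear_add.
- exact: linear_id.
- move=> b c v w hv hw; rewrite !(tensor_parity_pure _ sV sW hv hw).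
  by case: (b (+) c); rewrite ?addr0 ?add0r.
Qed.

Lemma sweedler_tensor_parity V W U pV pW (F : bool -> bool -> V -> W -> U) a t :
  is_super pV -> is_super pW -> (forall b c, bilin (F b c)) ->
  sweedler pV pW (tensor_parity pV pW a t) F =
  sweedler pV pW t (fun b c v w => if a == b (+) c then F b c v w else 0).
Proof.
move=> sV sW bF.
have lV := super_linear sV; have lW := super_linear sW.
have lP := tensor_parity_linear a lV lW.
move: t; apply: (tensor_hext sV sW).
- by lin.
- by apply: linear_sweedler => // b c; case: eqP => // _; lin.
- move=> b c v w hv hw; rewrite (tensor_parity_pure _ sV sW hv hw).
  rewrite (sweedler_pure sV sW (b := b) (c := c)) //; last first.
    by move=> b' c'; case: eqP => // _; lin.
  case: eqP => _; first exact: sweedler_pure.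
  exact: (lin0 (linear_sweedler lV lW bF)).
Qed.

(** When [t] has parity [a], only the terms with [b (+) c = a] occur, so the parity
    of a whole may be exchanged for those of its parts in a sign. *)
Lemma eq_sweedler_even V W U pV pW (F G : bool -> bool -> V -> W -> U) a t :
  is_super pV -> is_super pW ->
  (forall b c, bilin (F b c)) -> (forall b c, bilin (G b c)) ->
  tensor_parity pV pW a t = t ->
  (forall b c v w, a = b (+) c -> pV b v = v -> pW c w = w -> F b c v w = G b c v w) ->
  sweedler pV pW t F = sweedler pV pW t G.
Proof.
move=> sV sW bF bG <- e; rewrite !sweedler_tensor_parity //.
by apply: eq_sweedler => // b c v w hv hw; case: eqP => // ab; apply: e.
Qed.

End SuperSpaces.

Lemma sign_odd (k : fieldType) m n : odd m = odd n -> (-1) ^+ m = (-1) ^+ n :> k.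
Proof. by move=> e; rewrite -(signr_odd _ m) e signr_odd. Qed.

(* The exponents of the signs are polynomials in the parities, compared modulo
   two by trying all values. *)
Ltac signs :=
  rewrite ?scalerA -?exprD;
  congr (_ *: _); apply: sign_odd;
  rewrite ?(oddD, oddM, oddb);
  clear; repeat match goal with b : bool |- _ => destruct b end; reflexivity.

(** * Super coalgebras *)

Record is_super_coalgebra {k : fieldType} {V : lmodType k} (p : bool -> V -> V)
    (δ : V -> tensor V V) : Prop := {
  sc_super : is_super p;
  sc_linear : linear δ;
  sc_assoc : forall x, tassoc (tmap δ id (δ x)) = tmap id δ (δ x);
  sc_even : forall b x, p b x = x -> tensor_parity p p b (δ x) = δ x
}.

Section SuperCoalgebra.
Context {k : fieldType} {V : lmodType k} {p : bool -> V -> V} {δ : V -> tensor V V}.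
Hypothesis sc : is_super_coalgebra p δ.
Let sp := sc_super sc.
Let lp := super_linear sp.
Let ld := sc_linear sc.

Lemma sweedler_even (U : lmodType k) (F G : bool -> bool -> V -> V -> U) a x :
  p a x = x -> (forall b c, bilin (F b c)) -> (forall b c, bilin (G b c)) ->
  (forall b c v w, a = b (+) c -> p b v = v -> p c w = w -> F b c v w = G b c v w) ->
  sweedler p p (δ x) F = sweedler p p (δ x) G.
Proof.
move=> hx bF bG; apply: eq_sweedler_even => //; exact: (sc_even sc).
Qed.

(** The parity of an intermediate factor is left out of the summand: it is the sum
    of the parities of the two pieces, and summing over it gives back the factor. *)
Lemma sweedler_coassoc (U : lmodType k) (G : bool -> bool -> bool -> V -> V -> V -> U) x :
  (forall a b c v w, linear (fun u => G a b c u v w)) ->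
  (forall a b c u w, linear (fun v => G a b c u v w)) ->
  (forall a b c u v, linear (fun w => G a b c u v w)) ->
  sweedler p p (δ x) (fun _ c u w =>
    sweedler p p (δ u) (fun a b u v => G a b c u v w)) =
  sweedler p p (δ x) (fun a _ u w =>
    sweedler p p (δ w) (fun b c v w => G a b c u v w)).
Proof.
move=> G1 G2 G3.
pose G' u v w := \sum_(a : bool) \sum_(b : bool) \sum_(c : bool)
  G a b c (p a u) (p b v) (p c w).
have G'1 v w : linear (fun u => G' u v w).
  rewrite /G'; do 3![apply: linear_big => ?].
  by apply: (linear_comp (G1 _ _ _ _ _) (lp _)).
have G'2 u w : linear (fun v => G' u v w).
  rewrite /G'; do 3![apply: linear_big => ?].
  by apply: (linear_comp (G2 _ _ _ _ _) (lp _)).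
have G'3 u v : linear (fun w => G' u v w).
  rewrite /G'; do 3![apply: linear_big => ?].
  by apply: (linear_comp (G3 _ _ _ _ _) (lp _)).
have bl : forall u, bilin (G' u) by [].
have br : forall w, bilin (fun u v => G' u v w) by [].
pose T (t : tensor V (tensor V V)) := tlift (fun u s => tlift (fun v w => G' u v w) s) t.
have lT : bilin (fun u s => tlift (fun v w => G' u v w) s) by lin.
have ldid : linear (fun t : tensor V V => tmap δ id t) by apply: tmap_linear.
transitivity (T (tassoc (tmap δ id (δ x)))); last transitivity (T (tmap id δ (δ x))).
- transitivity (tlift (fun u w => tlift (fun u v => G' u v w) (δ u)) (δ x)).
    rewrite sweedler_sumr //; last by lin.
    apply: eq_tlift => u w; under eq_bigr => c _ do rewrite sweedlerE.
    rewrite tlift_sum; apply: eq_tlift => u1 u2.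
    by rewrite exchange_big; apply: eq_bigr => a _; rewrite exchange_big.
  have lTa : linear (fun t => T (tassoc (tmap δ id t))) by rewrite /T; lin.
  move: {1 2}(δ x); apply: tensor_ext; [lin | lin | move=> u w].
  rewrite tliftE; last by lin.
  rewrite tmap_pure //; move: (δ u); apply: tensor_ext; [lin | rewrite /T; lin | move=> u1 u2].
  rewrite tliftE // tassoc_pure /T tliftE //.
  by rewrite tliftE.
- by rewrite (sc_assoc sc).
transitivity (tlift (fun u w => tlift (fun v w => G' u v w) (δ w)) (δ x)).
  rewrite /T tlift_tmap //.
rewrite sweedler_suml //; last by lin.
apply: eq_tlift => u w; under [RHS]eq_bigr => a _ do rewrite sweedlerE.
by rewrite tlift_sum.
Qed.

End SuperCoalgebra.

Definition tens_cop {k : fieldType} {V W : lmodType k} (pV : bool -> V -> V)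
    (pW : bool -> W -> W) (δV : V -> tensor V V) (δW : W -> tensor W W) :
    tensor V W -> tensor (tensor V W) (tensor V W) :=
  fun t => tlift (fun v w =>
    sweedler pV pV (δV v) (fun b1 b2 v1 v2 =>
    sweedler pW pW (δW w) (fun c1 c2 w1 w2 =>
      (-1) ^+ (b2 * c1) *: ((v1 ⊗ w1) ⊗ (v2 ⊗ w2))))) t.

Section TensorCoalgebra.
Context {k : fieldType} {V W : lmodType k} {pV : bool -> V -> V} {pW : bool -> W -> W}
  {δV : V -> tensor V V} {δW : W -> tensor W W}.
Hypothesis scV : is_super_coalgebra pV δV.
Hypothesis scW : is_super_coalgebra pW δW.
Let sV := sc_super scV.
Let sW := sc_super scW.
Let lV := super_linear sV.
Let lW := super_linear sW.
Let ldV := sc_linear scV.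
Let ldW := sc_linear scW.
Let p := tensor_parity pV pW.
Let δ := tens_cop pV pW δV δW.
Let sp : is_super p := tensor_super sV sW.
Let lp := super_linear sp.

Lemma tens_cop_linear : linear δ.
Proof. by rewrite /δ /tens_cop; lin. Qed.

Lemma tens_cop_pure v w : δ (v ⊗ w) =
  sweedler pV pV (δV v) (fun b1 b2 v1 v2 =>
  sweedler pW pW (δW w) (fun c1 c2 w1 w2 =>
    (-1) ^+ (b2 * c1) *: ((v1 ⊗ w1) ⊗ (v2 ⊗ w2)))).
Proof. by rewrite /δ /tens_cop tliftE //; lin. Qed.

Lemma tensor_hom b c v w : pV b v = v -> pW c w = w -> p (b (+) c) (v ⊗ w) = v ⊗ w.
Proof. by move=> hv hw; rewrite /p (tensor_parity_pure _ sV sW hv hw) eqxx. Qed.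

Lemma sweedler_tens_cop (U : lmodType k)
    (F : bool -> bool -> tensor V W -> tensor V W -> U) v w :
  (forall b c, bilin (F b c)) ->
  sweedler p p (δ (v ⊗ w)) F =
  sweedler pV pV (δV v) (fun b1 b2 v1 v2 =>
  sweedler pW pW (δW w) (fun c1 c2 w1 w2 =>
    (-1) ^+ (b2 * c1) *: F (b1 (+) c1) (b2 (+) c2) (v1 ⊗ w1) (v2 ⊗ w2))).
Proof.
move=> bF; rewrite tens_cop_pure.
have lF := linear_sweedler lp lp bF.
rewrite (lin_sweedler _ _ _ _ lF); apply: eq_sweedler => // b1 b2 v1 v2 h1 h2.
rewrite (lin_sweedler _ _ _ _ lF); apply: eq_sweedler => // c1 c2 w1 w2 g1 g2.
by rewrite (linZ lF) (sweedler_pure sp sp bF (b := b1 (+) c1) (c := b2 (+) c2)) //;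
  apply: tensor_hom.
Qed.

(** Both iterated coproducts of [v ⊗ w] are the sum of the terms
    [(v1 ⊗ w1) ⊗ (v2 ⊗ w2) ⊗ (v3 ⊗ w3)] with the sign that sorts
    [v1 v2 v3 w1 w2 w3] into this order, so coassociativity holds separately in
    [v] and in [w]. *)
Lemma tens_super_coalgebra : is_super_coalgebra p δ.
Proof.
have lδ : linear δ := tens_cop_linear.
split=> //.
- have ldid : linear (fun t : tensor (tensor V W) (tensor V W) => tmap δ id t).
    by apply: tmap_linear.
  have ldid' : linear (fun t : tensor (tensor V W) (tensor V W) => tmap id δ t).
    by apply: tmap_linear.
  have lta : linear (fun t : tensor (tensor V W) (tensor V W) => tassoc (tmap δ id t)).
    by lin.
  apply: tensor_ext; [lin | lin | move=> v w].
  pose T (b1 b2 b3 c1 c2 c3 : bool) (v1 v2 v3 : V) (w1 w2 w3 : W) :=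
    (-1) ^+ (b3 * (c1 + c2) + b2 * c1)%N *: ((v1 ⊗ w1) ⊗ ((v2 ⊗ w2) ⊗ (v3 ⊗ w3))).
  transitivity (sweedler pV pV (δV v) (fun _ b3 v' v3 =>
                sweedler pV pV (δV v') (fun b1 b2 v1 v2 =>
                sweedler pW pW (δW w) (fun _ c3 w' w3 =>
                sweedler pW pW (δW w') (fun c1 c2 w1 w2 =>
                  T b1 b2 b3 c1 c2 c3 v1 v2 v3 w1 w2 w3))))).
    rewrite tens_cop_pure (lin_sweedler _ _ _ _ lta).
    apply: eq_sweedler => // b b3 v' v3 _ _.
    rewrite (lin_sweedler _ _ _ _ lta) [RHS]exchange_sweedler.
    apply: eq_sweedler => // c c3 w' w3 hw' _.
    rewrite (linZ lta) tmap_pure // tens_cop_pure.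
    have lt : linear (fun t : tensor (tensor V W) (tensor V W) => tassoc (t ⊗ (v3 ⊗ w3))).
      by apply: (linear_comp (@tassoc_linear _ _ _ _)); lin.
    rewrite (lin_sweedler _ _ _ _ lt) scaler_sweedler.
    apply: eq_sweedler => // b1 b2 v1 v2 _ _.
    rewrite (lin_sweedler _ _ _ _ lt) scaler_sweedler.
    apply: (sweedler_even scW hw') => [||c1 c2 w1 w2 -> _ _]; rewrite /T; [lin | lin |].
    by rewrite (linZ lt) tassoc_pure; signs.
  transitivity (sweedler pV pV (δV v) (fun b1 _ v1 v' =>
                sweedler pV pV (δV v') (fun b2 b3 v2 v3 =>
                sweedler pW pW (δW w) (fun c1 _ w1 w' =>
                sweedler pW pW (δW w') (fun c2 c3 w2 w3 =>
                  T b1 b2 b3 c1 c2 c3 v1 v2 v3 w1 w2 w3))))).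
    rewrite (sweedler_coassoc scV); rewrite /T; [|lin..].
    apply: eq_sweedler => // b1 b v1 v' _ _; apply: eq_sweedler => // b2 b3 v2 v3 _ _.
    by rewrite (sweedler_coassoc scW) //; rewrite /T; lin.
  rewrite tens_cop_pure (lin_sweedler _ _ _ _ ldid').
  apply: eq_sweedler => // b1 b v1 v' _ hv'.
  rewrite (lin_sweedler _ _ _ _ ldid') [LHS]exchange_sweedler.
  apply: eq_sweedler => // c1 c w1 w' _ _.
  rewrite (linZ ldid') tmap_pure // tens_cop_pure.
  have lt : linear (fun t : tensor (tensor V W) (tensor V W) => (v1 ⊗ w1) ⊗ t) by lin.
  rewrite (lin_sweedler _ _ _ _ lt) scaler_sweedler.
  apply: (sweedler_even scV hv') => [||b2 b3 v2 v3 -> _ _]; rewrite /T; [lin | lin |].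
  rewrite (lin_sweedler _ _ _ _ lt) scaler_sweedler.
  apply: eq_sweedler => // c2 c3 w2 w3 _ _.
  by rewrite (linZ lt); signs.
move=> a; have lP := tensor_parity_linear a lp lp.
suff e x : tensor_parity p p a (δ (p a x)) = δ (p a x) by move=> x <-.
move: x; apply: (tensor_hext sV sW); [lin | lin | move=> b c v w hv hw].
rewrite /p (tensor_parity_pure _ sV sW hv hw) -/p; case: eqP => [e|_]; last first.
  by rewrite (lin0 lδ) (lin0 lP).
rewrite tens_cop_pure (lin_sweedler _ _ _ _ lP).
apply: (sweedler_even scV hv) => [||b1 b2 v1 v2 eb h1 h2]; [lin | lin |].
rewrite (lin_sweedler _ _ _ _ lP).
apply: (sweedler_even scW hw) => [||c1 c2 w1 w2 ec g1 g2]; [lin | lin |].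
rewrite (linZ lP) (tensor_parity_pure _ sp sp (b := b1 (+) c1) (c := b2 (+) c2)).
- by rewrite e eb ec addbACA eqxx.
- exact: tensor_hom.
- exact: tensor_hom.
Qed.

Section Counit.
Context {eV : V -> k} {eW : W -> k}.
Hypothesis leV : scalar eV.
Hypothesis leW : scalar eW.

Definition tens_eps (t : tensor V W) : k :=
  tlift (U := k^o) (fun v w => eV v * eW w) t.

Lemma tens_eps_bilin : bilinear_for *:%R *:%R (fun v w => eV v * eW w : k^o).
Proof.
split=> [w|v] a x y /=; first by rewrite leV mulrDl /GRing.scale /= mulrA.
by rewrite leW mulrDr /GRing.scale /= mulrCA.
Qed.

Lemma tens_eps_scalar : scalar tens_eps.
Proof. exact: (tlift_lin tens_eps_bilin). Qed.

Lemma tens_epsE v w : tens_eps (v ⊗ w) = eV v * eW w.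
Proof. exact: (tliftE _ _ tens_eps_bilin). Qed.

(** The counit of [W] forces [w1] to be even, so the sign disappears. *)
Lemma tens_counitl :
  (forall w, eW (pW true w) = 0) ->
  (forall v, tlift (fun y z => eV y *: z) (δV v) = v) ->
  (forall w, tlift (fun y z => eW y *: z) (δW w) = w) ->
  forall t, tlift (fun y z => tens_eps y *: z) (δ t) = t.
Proof.
move=> eW0 cV cW; have les := tens_eps_scalar; have lδ := tens_cop_linear.
have lF : linear (fun t => tlift (fun y z => tens_eps y *: z) (δ t)) by lin.
apply: tensor_ext => // v w; rewrite tens_cop_pure.
have lG : linear (tlift (fun y z => tens_eps y *: z : tensor V W)) by lin.
have lv : linear (fun v : V => v ⊗ w) by lin.
rewrite -[in RHS](cV v) (lin_tlift _ _ lv) (lin_sweedler _ _ _ _ lG).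
rewrite -(sweedler_tlift _ sV sV); last by lin.
apply: eq_sweedler => // b1 b2 v1 v2 _ _; rewrite (linZ lv).
have lw : linear (fun w : W => eV v1 *: (v2 ⊗ w)) by lin.
rewrite -[in RHS](cW w) (lin_tlift _ _ lw) (lin_sweedler _ _ _ _ lG).
rewrite -(sweedler_tlift _ sW sW); last by lin.
apply: eq_sweedler => // c1 c2 w1 w2 h1 _; rewrite (linZ lw) (linZ lG) tliftE; last by lin.
rewrite tens_epsE; case: c1 h1 => [<-|_]; last by rewrite muln0 expr0 scale1r scalerA mulrC.
by rewrite eW0 mulr0 !scale0r !scaler0.
Qed.

Lemma tens_counitr :
  (forall v, eV (pV true v) = 0) ->
  (forall v, tlift (fun y z => eV z *: y) (δV v) = v) ->
  (forall w, tlift (fun y z => eW z *: y) (δW w) = w) ->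
  forall t, tlift (fun y z => tens_eps z *: y) (δ t) = t.
Proof.
move=> eV0 cV cW; have les := tens_eps_scalar; have lδ := tens_cop_linear.
have lF : linear (fun t => tlift (fun y z => tens_eps z *: y) (δ t)) by lin.
apply: tensor_ext => // v w; rewrite tens_cop_pure.
have lG : linear (tlift (fun y z => tens_eps z *: y : tensor V W)) by lin.
have lv : linear (fun v : V => v ⊗ w) by lin.
rewrite -[in RHS](cV v) (lin_tlift _ _ lv) (lin_sweedler _ _ _ _ lG).
rewrite -(sweedler_tlift _ sV sV); last by lin.
apply: eq_sweedler => // b1 b2 v1 v2 _ h2; rewrite (linZ lv).
have lw : linear (fun w : W => eV v2 *: (v1 ⊗ w)) by lin.
rewrite -[in RHS](cW w) (lin_tlift _ _ lw) (lin_sweedler _ _ _ _ lG).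
rewrite -(sweedler_tlift _ sW sW); last by lin.
apply: eq_sweedler => // c1 c2 w1 w2 _ _; rewrite (linZ lw) (linZ lG) tliftE; last by lin.
rewrite tens_epsE; case: b2 h2 => [<-|_]; last by rewrite mul0n expr0 scale1r scalerA mulrC.
by rewrite eV0 mul0r !scale0r !scaler0.
Qed.

End Counit.

End TensorCoalgebra.
Arguments tens_eps {k V W} eV eW t.

(** * Gradings and parities *)

Section Gradings.
Context {k : fieldType}.
Implicit Types U V W : lmodType k.

Lemma gradingE V (pr : nat -> V -> V) m n x :
  is_grading pr -> homog pr n x -> pr m x = if m == n then x else 0.
Proof. by move=> g hx; rewrite -hx (grading_proj g). Qed.

Lemma grading_ext V U (pr : nat -> V -> V) (f g : V -> U) :
  is_grading pr -> linear f -> linear g ->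
  (forall n x, homog pr n x -> f x = g x) -> f =1 g.
Proof.
move=> gr lf lg e x; have [N ->] := grading_sum gr x.
rewrite (lin_sum lf) (lin_sum lg); apply: eq_bigr => n _.
by apply: (e n); rewrite /homog (grading_proj gr) eqxx.
Qed.

(** The parity projection is a sum over all degrees; it is finite because each
    element has finitely many components. *)
Lemma parity_sum V (pr : nat -> V -> V) b x N :
  (forall n, (N <= n)%N -> pr n x = 0) ->
  parity pr b x = \sum_(n < N | odd n == b) pr n x.
Proof.
move=> h; rewrite /parity fsbig_mkcond /= -(fsbig_widen `I_N setT) //; last first.
  move=> n [_ /= /negP]; rewrite -leqNgt => /h.
  by rewrite /patch => ->; case: ifP.
rewrite -fsbig_ord [RHS]big_mkcond; apply: eq_bigr => n _ /=.
by rewrite /patch; congr (if _ then _ else _); apply/idP/eqP; rewrite in_setE.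
Qed.

Lemma grading_bound V (pr : nat -> V -> V) x : is_grading pr ->
  exists N, forall n, (N <= n)%N -> pr n x = 0.
Proof.
move=> gr; have [N e] := grading_sum gr x; exists N => n Nn.
rewrite e (lin_sum (grading_linear gr n)) big1 // => i _.
by rewrite (grading_proj gr) gtn_eqF // (leq_trans (ltn_ord i)).
Qed.

Lemma parity_homog V (pr : nat -> V -> V) b n x :
  is_grading pr -> homog pr n x -> parity pr b x = if odd n == b then x else 0.
Proof.
move=> gr hx; rewrite (@parity_sum _ _ _ _ n.+1); last first.
  by move=> m nm; rewrite (gradingE _ gr hx) gtn_eqF.
rewrite big_mkcond (bigD1 ord_max) //= (gradingE _ gr hx) eqxx big1 ?addr0 // => i.
rewrite -val_eqE /= => ni; rewrite (gradingE _ gr hx) (negPf ni).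
by rewrite if_same.
Qed.

Lemma parity_super V (pr : nat -> V -> V) : is_grading pr -> is_super (parity pr).
Proof.
move=> gr.
have lP b : linear (parity pr b).
  move=> a x y; have [N hN] := grading_bound x gr; have [M hM] := grading_bound y gr.
  rewrite !(@parity_sum _ _ _ _ (maxn N M)).
  - rewrite scaler_sumr -big_split; apply: eq_bigr => i _.
    exact: (grading_linear gr).
  - by move=> n; rewrite geq_max => /andP[_ /hM].
  - by move=> n; rewrite geq_max => /andP[/hN].
  - move=> n; rewrite geq_max => /andP[h1 h2].
    by rewrite (grading_linear gr) hN // hM // scaler0 addr0.
split=> // [b c|].
  apply: (grading_ext gr).
  - by lin.
  - by case: eqP => // _; exact: linear_zero.
  - move=> n x hx; rewrite !(parity_homog c gr hx).
    case: (odd n =P c) => [e|_]; last by rewrite (lin0 (lP _)) if_same.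
    by rewrite (parity_homog b gr hx) e eq_sym.
apply: (grading_ext gr).
- by lin.
- by lin.
- move=> n x hx; rewrite !(parity_homog _ gr hx).
  by case: (odd n); rewrite ?addr0 ?add0r.
Qed.

Lemma homog_parity V (pr : nat -> V -> V) n x :
  is_grading pr -> homog pr n x -> parity pr (odd n) x = x.
Proof. by move=> gr hx; rewrite (parity_homog _ gr hx) eqxx. Qed.

Lemma homogP V (pr : nat -> V -> V) n x : is_grading pr -> homog pr n (pr n x).
Proof. by move=> gr; rewrite /homog (grading_proj gr) eqxx. Qed.

Lemma homog0 V (pr : nat -> V -> V) n : is_grading pr -> homog pr n 0.
Proof. by move=> gr; rewrite /homog (lin0 (grading_linear gr n)). Qed.

Lemma homogD V (pr : nat -> V -> V) n x y :
  is_grading pr -> homog pr n x -> homog pr n y -> homog pr n (x + y).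
Proof. by move=> gr hx hy; rewrite /homog (linD (grading_linear gr n)) hx hy. Qed.

Lemma homogZ V (pr : nat -> V -> V) n a x :
  is_grading pr -> homog pr n x -> homog pr n (a *: x).
Proof. by move=> gr hx; rewrite /homog (linZ (grading_linear gr n)) hx. Qed.

Lemma homog_sum V (pr : nat -> V -> V) n I (r : seq I) (F : I -> V) :
  is_grading pr -> (forall i, homog pr n (F i)) -> homog pr n (\sum_(i <- r) F i).
Proof.
by move=> gr h; rewrite /homog (lin_sum (grading_linear gr n)); apply: eq_bigr => i _; apply: h.
Qed.

Lemma tensor_pr_homog V W (prV : nat -> V -> V) (prW : nat -> W -> W) n i j v w :
  is_grading prV -> is_grading prW -> homog prV i v -> homog prW j w ->
  tensor_pr prV prW n (v ⊗ w) = if n == (i + j)%N then v ⊗ w else 0.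
Proof.
move=> gV gW hv hw; have lV := grading_linear gV; have lW := grading_linear gW.
have tp : bilin (@tpure k V W) by exact: tpure_bilin.
rewrite /tensor_pr; have [/eqP -> | ne] := boolP (n == (i + j)%N).
  have lt : (i < (i + j).+1)%N by rewrite ltnS leq_addr.
  rewrite (bigD1 (Ordinal lt)) //= tmap_pure // hv addKn hw big1 ?addr0 // => i'.
  rewrite -val_eqE /= => ni; rewrite tmap_pure // (gradingE _ gV hv) (negPf ni).
  exact: (lin0 (bilin_l _ tp)).
rewrite big1 // => i' _; rewrite tmap_pure // (gradingE _ gV hv) (gradingE _ gW hw).
case: eqP => e; last exact: (lin0 (bilin_l _ tp)).
case: eqP => e'; last exact: (lin0 (bilin_r _ tp)).
by case/negP: ne; rewrite -e -e' subnKC // -ltnS.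
Qed.

Lemma tensor_grading_ext V W U (prV : nat -> V -> V) (prW : nat -> W -> W)
    (f g : tensor V W -> U) :
  is_grading prV -> is_grading prW -> linear f -> linear g ->
  (forall i j v w, homog prV i v -> homog prW j w -> f (v ⊗ w) = g (v ⊗ w)) ->
  f =1 g.
Proof.
move=> gV gW lf lg e; apply: tensor_ext => // v w.
apply: (grading_ext (f := fun v => f (v ⊗ w)) (g := fun v => g (v ⊗ w)) gV);
  [lin | lin | move=> i {}v hv].
apply: (grading_ext (f := fun w => f (v ⊗ w)) (g := fun w => g (v ⊗ w)) gW);
  [lin | lin | move=> j {}w hw].
exact: (e i j).
Qed.

Lemma tensor_pr_linear V W (prV : nat -> V -> V) (prW : nat -> W -> W) n :
  is_grading prV -> is_grading prW -> linear (tensor_pr prV prW n).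
Proof.
move=> gV gW; apply: linear_big => c.
by apply: tmap_linear; apply: grading_linear.
Qed.

(** The components of [t] add up to [t] beyond every sufficiently large bound,
    a form of the claim that is stable under addition. *)
Lemma tensor_pr_grading V W (prV : nat -> V -> V) (prW : nat -> W -> W) :
  is_grading prV -> is_grading prW -> is_grading (tensor_pr prV prW).
Proof.
move=> gV gW; have lP n := tensor_pr_linear n gV gW.
split=> // [m n|t].
  apply: (tensor_grading_ext gV gW); [by lin | | move=> i j v w hv hw].
    by case: eqP => // _; exact: linear_zero.
  rewrite !(tensor_pr_homog n gV gW hv hw).
  case: (n =P _) => [->|_]; last by rewrite (lin0 (lP _)) if_same.
  by rewrite (tensor_pr_homog _ gV gW hv hw).
suff: exists N, forall M, (N <= M)%N -> t = \sum_(n < M) tensor_pr prV prW n t.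
  by case=> N h; exists N; apply: h.
move: t; apply: tensor_ind => [|x y [N hN] [M hM]|v w].
- by exists 0%N => M _; rewrite big1 // => i _; rewrite (lin0 (lP _)).
- exists (maxn N M) => L; rewrite geq_max => /andP[/hN hx /hM hy].
  by rewrite {1}hx {1}hy -big_split; apply: eq_bigr => i _; rewrite /= (linD (lP _)).
have [N eN] := grading_sum gV v; have [M eM] := grading_sum gW w.
exists (N + M)%N => L NML.
have -> : v ⊗ w = \sum_(i < N) \sum_(j < M) prV i v ⊗ prW j w.
  rewrite {1}eN (lin_sum (bilin_l _ (tpure_bilin _ _))); apply: eq_bigr => i _.
  by rewrite {1}eM (lin_sum (bilin_r _ (tpure_bilin _ _))).
under [RHS]eq_bigr => n _ do (rewrite (lin_sum (lP _));
  under eq_bigr => i _ do rewrite (lin_sum (lP _))).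
rewrite [RHS]exchange_big; apply: eq_bigr => i _ /=.
rewrite [RHS]exchange_big; apply: eq_bigr => j _ /=.
have lt : (i + j < L)%N.
  by apply: leq_trans NML; rewrite -addSn leq_add // ltnW.
rewrite (bigD1 (Ordinal lt)) //= big1 ?addr0 => [|n].
  by rewrite (tensor_pr_homog _ gV gW (homogP _ _ gV) (homogP _ _ gW)) eqxx.
rewrite -val_eqE /= => /negPf ne.
by rewrite (tensor_pr_homog _ gV gW (homogP _ _ gV) (homogP _ _ gW)) ne.
Qed.

Lemma homog_tensor V W (prV : nat -> V -> V) (prW : nat -> W -> W) i j v w :
  is_grading prV -> is_grading prW -> homog prV i v -> homog prW j w ->
  homog (tensor_pr prV prW) (i + j) (v ⊗ w).
Proof. by move=> gV gW hv hw; rewrite /homog (tensor_pr_homog _ gV gW hv hw) eqxx. Qed.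

Lemma homog_tensor_ind V W (prV : nat -> V -> V) (prW : nat -> W -> W) n
    (P : tensor V W -> Prop) :
  is_grading prV -> is_grading prW ->
  P 0 -> (forall x y, P x -> P y -> P (x + y)) ->
  (forall i j v w, (i + j)%N = n -> homog prV i v -> homog prW j w -> P (v ⊗ w)) ->
  forall t, homog (tensor_pr prV prW) n t -> P t.
Proof.
move=> gV gW P0 PD Pp t <-; rewrite /tensor_pr.
apply: (big_rec P) => [|i x _ hx]; first exact: P0.
apply: (PD) hx; rewrite /tmap /tlift /tsum.
apply: (big_rec P) => [|y z _ hz]; first exact: P0.
apply: (PD) hz; apply: (Pp i (n - i)%N).
- by rewrite subnKC // -ltnS.
- exact: homogP.
- exact: homogP.
Qed.

Lemma tensor_parityE V W (prV : nat -> V -> V) (prW : nat -> W -> W) :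
  is_grading prV -> is_grading prW ->
  tensor_parity (parity prV) (parity prW) = parity (tensor_pr prV prW).
Proof.
move=> gV gW; apply: funext => b; apply: funext.
have sV := parity_super gV; have sW := parity_super gW.
have gT := tensor_pr_grading gV gW; have sT := parity_super gT.
have lT := super_linear sT b.
apply: (tensor_grading_ext gV gW) => //; first exact: (super_linear (tensor_super sV sW)).
move=> i j v w hv hw.
rewrite (tensor_parity_pure _ sV sW (homog_parity gV hv) (homog_parity gW hw)).
by rewrite (parity_homog _ gT (homog_tensor gV gW hv hw)) oddD eq_sym.
Qed.

Lemma homog_sweedler V W U (prV : nat -> V -> V) (prW : nat -> W -> W)
    (prU : nat -> U -> U) m n (F : bool -> bool -> V -> W -> U) t :
  is_grading prV -> is_grading prW -> is_grading prU ->
  (forall b c, bilin (F b c)) ->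
  (forall i j v w, (i + j)%N = n -> homog prV i v -> homog prW j w ->
     homog prU m (F (odd i) (odd j) v w)) ->
  homog (tensor_pr prV prW) n t ->
  homog prU m (sweedler (parity prV) (parity prW) t F).
Proof.
move=> gV gW gU bF hF; have sV := parity_super gV; have sW := parity_super gW.
have lF := linear_sweedler (super_linear sV) (super_linear sW) bF.
move: t; apply: homog_tensor_ind => //.
- by rewrite (lin0 lF); apply: homog0.
- by move=> x y hx hy; rewrite (linD lF); apply: homogD.
- move=> i j v w e hv hw.
  by rewrite (sweedler_pure sV sW bF (homog_parity gV hv) (homog_parity gW hw)); apply: hF.
Qed.

Lemma tens_cop_homog V W (prV : nat -> V -> V) (prW : nat -> W -> W) δV δW n t :
  is_grading prV -> is_grading prW -> linear δV -> linear δW ->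
  (forall n v, homog prV n v -> homog (tensor_pr prV prV) n (δV v)) ->
  (forall n w, homog prW n w -> homog (tensor_pr prW prW) n (δW w)) ->
  homog (tensor_pr prV prW) n t ->
  homog (tensor_pr (tensor_pr prV prW) (tensor_pr prV prW)) n
    (tens_cop (parity prV) (parity prW) δV δW t).
Proof.
move=> gV gW lV lW hV hW; have gT := tensor_pr_grading gV gW.
have gTT := tensor_pr_grading gT gT.
have sV := parity_super gV; have sW := parity_super gW.
have lpV := super_linear sV; have lpW := super_linear sW.
have lδ : linear (tens_cop (parity prV) (parity prW) δV δW) by rewrite /tens_cop; lin.
move: t; apply: homog_tensor_ind => //.
- by rewrite (lin0 lδ); apply: homog0.
- by move=> x y hx hy; rewrite (linD lδ); apply: homogD.
move=> i j v w <- hv hw; rewrite /tens_cop tliftE; last by lin.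
apply: (homog_sweedler (n := i)) => //; [by lin | | exact: hV].
move=> i1 i2 v1 v2 <- h1 h2.
apply: (homog_sweedler (n := j)) => //; [by lin | | exact: hW].
move=> j1 j2 w1 w2 <- g1 g2; apply: homogZ => //.
by rewrite addnACA; apply: homog_tensor => //; apply: homog_tensor.
Qed.

End Gradings.

(** * Convolution of cocommuting coalgebra maps *)

Section CoalgebraMaps.
Context {k : fieldType} {C V : lmodType k} {p : bool -> C -> C} {pV : bool -> V -> V}
  {δ : C -> tensor C C} {δV : V -> tensor V V} {f : C -> V}.
Hypothesis sp : is_super p.
Hypothesis sV : is_super pV.
Hypothesis lf : linear f.
Hypothesis f_even : forall b x, p b x = x -> pV b (f x) = f x.
Hypothesis f_cop : forall x, δV (f x) = tmap f f (δ x).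

Lemma sweedler_morph (U : lmodType k) (F : bool -> bool -> V -> V -> U) x :
  (forall b c, bilin (F b c)) ->
  sweedler pV pV (δV (f x)) F =
  sweedler p p (δ x) (fun b c u v => F b c (f u) (f v)).
Proof.
move=> bF; have lF := linear_sweedler (super_linear sV) (super_linear sV) bF.
rewrite f_cop /tmap -(sweedler_tlift _ sp sp); last by lin.
rewrite (lin_sweedler _ _ _ _ lF); apply: eq_sweedler => // b c u v hu hv.
by rewrite (sweedler_pure sV sV bF (f_even hu) (f_even hv)).
Qed.

End CoalgebraMaps.

Section Convolution.
Context {k : fieldType} {C V W : lmodType k} {p : bool -> C -> C}
  {pV : bool -> V -> V} {pW : bool -> W -> W}
  {δ : C -> tensor C C} {δV : V -> tensor V V} {δW : W -> tensor W W}
  {f : C -> V} {g : C -> W}.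
Hypothesis sc : is_super_coalgebra p δ.
Hypothesis scV : is_super_coalgebra pV δV.
Hypothesis scW : is_super_coalgebra pW δW.
Hypothesis lf : linear f.
Hypothesis lg : linear g.
Hypothesis f_even : forall b x, p b x = x -> pV b (f x) = f x.
Hypothesis g_even : forall b x, p b x = x -> pW b (g x) = g x.
Hypothesis f_cop : forall x, δV (f x) = tmap f f (δ x).
Hypothesis g_cop : forall x, δW (g x) = tmap g g (δ x).
Hypothesis fg_cocomm : forall x,
  sweedler p p (δ x) (fun _ _ u v => g u ⊗ f v) =
  sweedler p p (δ x) (fun b c u v => (-1) ^+ (b * c) *: (g v ⊗ f u)).

(** In [Δ(f(u) ⊗ g(v))] the second half of [u] and the first half of [v] appear in
    the wrong order and under the wrong maps; they are consecutive factors of a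
    fourfold coproduct, and cocommutativity puts them right. *)
Lemma convolution_cop x :
  tens_cop pV pW δV δW (tmap f g (δ x)) =
  tmap (fun c => tmap f g (δ c)) (fun c => tmap f g (δ c)) (δ x).
Proof.
have sp := sc_super sc; have sV := sc_super scV; have sW := sc_super scW.
have lp := super_linear sp; have lpV := super_linear sV; have lpW := super_linear sW.
have ld := sc_linear sc; have ldV := sc_linear scV; have ldW := sc_linear scW.
have lT : linear (tens_cop pV pW δV δW) by rewrite /tens_cop; lin.
have E c : tmap f g (δ c) = sweedler p p (δ c) (fun _ _ u v => f u ⊗ g v).
  by rewrite /tmap sweedler_tlift //; lin.
(* Coassociativity, in the form that isolates the two middle factors of a
   fourfold coproduct. *)
have four (U : lmodType k) (K : bool -> bool -> C -> C -> C -> C -> U) :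
  (forall b c v w x, linear (fun u => K b c u v w x)) ->
  (forall b c u w x, linear (fun v => K b c u v w x)) ->
  (forall b c u v x, linear (fun w => K b c u v w x)) ->
  (forall b c u v w, linear (fun x => K b c u v w x)) ->
  sweedler p p (δ x) (fun _ _ u v => sweedler p p (δ u) (fun _ b u1 u2 =>
    sweedler p p (δ v) (fun c _ v1 v2 => K b c u1 u2 v1 v2))) =
  sweedler p p (δ x) (fun _ _ u1 w => sweedler p p (δ w) (fun _ _ m v2 =>
    sweedler p p (δ m) (fun b c u2 v1 => K b c u1 u2 v1 v2))).
  move=> K1 K2 K3 K4.
  rewrite (sweedler_coassoc sc (G := fun _ b _ u1 u2 v =>
    sweedler p p (δ v) (fun c _ v1 v2 => K b c u1 u2 v1 v2))); [|lin..].
  apply: eq_sweedler => // _ _ u1 w _ _.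
  by rewrite (sweedler_coassoc sc (G := fun b c _ u2 v1 v2 => K b c u1 u2 v1 v2)) //; lin.
transitivity (sweedler p p (δ x) (fun _ _ u v => sweedler p p (δ u) (fun _ b u1 u2 =>
    sweedler p p (δ v) (fun c _ v1 v2 =>
      (-1) ^+ (b * c) *: ((f u1 ⊗ g v1) ⊗ (f u2 ⊗ g v2)))))).
  rewrite E (lin_sweedler _ _ _ _ lT); apply: eq_sweedler => // _ _ u v _ _.
  rewrite (tens_cop_pure scV scW).
  rewrite (sweedler_morph (δ := δ) sp sV lf f_even f_cop); last by lin.
  apply: eq_sweedler => // b1 b2 u1 u2 _ _.
  by rewrite (sweedler_morph (δ := δ) sp sW lg g_even g_cop); last by lin.
rewrite four; [|lin..].
transitivity (sweedler p p (δ x) (fun _ _ u v => sweedler p p (δ u) (fun _ b u1 u2 =>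
    sweedler p p (δ v) (fun c _ v1 v2 => (f u1 ⊗ g u2) ⊗ (f v1 ⊗ g v2))))); last first.
  rewrite (tmap_sweedler _ sp sp); [|lin..].
  apply: eq_sweedler => // _ _ u v _ _; rewrite (E u) (E v).
  have lt : linear (fun t : tensor V W => t ⊗ sweedler p p (δ v) (fun _ _ u v => f u ⊗ g v)).
    by lin.
  rewrite (lin_sweedler _ _ _ _ lt); apply: eq_sweedler => // _ _ u1 u2 _ _.
  have lt' : linear (fun t : tensor V W => (f u1 ⊗ g u2) ⊗ t) by lin.
  by rewrite (lin_sweedler _ _ _ _ lt').
rewrite (four _ (fun _ _ u1 u2 v1 v2 => (f u1 ⊗ g u2) ⊗ (f v1 ⊗ g v2))); [|lin..].
apply: eq_sweedler => // _ _ u1 w _ _; apply: eq_sweedler => // _ _ m v2 _ _.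
pose L (t : tensor W V) : tensor (tensor V W) (tensor V W) :=
  tlift (fun y x => (f u1 ⊗ y) ⊗ (x ⊗ g v2)) t.
have bL : bilin (fun (y : W) (x : V) => (f u1 ⊗ y) ⊗ (x ⊗ g v2)) by lin.
have lL : linear L by apply: tlift_lin.
have LE u v : L (g u ⊗ f v) = (f u1 ⊗ g u) ⊗ (f v ⊗ g v2) by rewrite /L tliftE.
transitivity (L (sweedler p p (δ m) (fun _ _ u v => g u ⊗ f v))); last first.
  by rewrite (lin_sweedler _ _ _ _ lL); apply: eq_sweedler.
rewrite fg_cocomm (lin_sweedler _ _ _ _ lL); apply: eq_sweedler => // b c u v _ _.
by rewrite (linZ lL) LE.
Qed.

End Convolution.

(** * The exchange map of a super matched pair *)

Lemma super_bialgebra_coalgebra {k : fieldType} {B : bialg k} {p : bool -> B -> B} :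
  is_super_bialgebra p -> is_super_coalgebra p (@cop k B).
Proof.
move=> sb; split; first exact: sbialgebra_super.
- exact: cop_linear (sbialgebra_coalg sb).
- exact: cop_assoc (sbialgebra_coalg sb).
- exact: sbialgebra_cop_even sb.
Qed.

Lemma sweedler_cop_mul {k : fieldType} {B : bialg k} {p : bool -> B -> B}
    (U : lmodType k) (F : bool -> bool -> B -> B -> U) x y :
  is_super_bialgebra p -> (forall b c, bilin (F b c)) ->
  sweedler p p (cop (mul x y)) F =
  sweedler p p (cop x) (fun b1 b2 x1 x2 => sweedler p p (cop y) (fun c1 c2 y1 y2 =>
    (-1) ^+ (b2 * c1) *: F (b1 (+) c1) (b2 (+) c2) (mul x1 y1) (mul x2 y2))).
Proof.
move=> sb bF; have sp := sbialgebra_super sb; have lp := super_linear sp.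
have bm := mul_bilin (sbialgebra_alg sb).
have lF := linear_sweedler lp lp bF.
rewrite (sbialgebra_cop_mul sb) /super_tensor_mul.
rewrite -(sweedler_tlift _ sp sp); last by lin.
rewrite (lin_sweedler _ _ _ _ lF); apply: eq_sweedler => // b1 b2 x1 x2 hx1 hx2.
rewrite -(sweedler_tlift _ sp sp); last by lin.
rewrite (lin_sweedler _ _ _ _ lF); apply: eq_sweedler => // c1 c2 y1 y2 hy1 hy2.
rewrite (sweedler_pure sp sp _ hx2 hy1); last by lin.
rewrite (linZ lF) (sweedler_pure sp sp bF (b := b1 (+) c1) (c := b2 (+) c2)) //;
  exact: (sbialgebra_mul_even sb).
Qed.

(** Degree-preserving maps preserve parity; both factors are decomposed into
    homogeneous components. *)
Lemma parity_bilin {k : fieldType} {U V W : lmodType k} {prU : nat -> U -> U}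
    {prV : nat -> V -> V} {prW : nat -> W -> W} {f : U -> V -> W} :
  is_grading prU -> is_grading prV -> is_grading prW -> bilin f ->
  (forall m n u v, homog prU m u -> homog prV n v -> homog prW (m + n) (f u v)) ->
  forall b c u v, parity prU b u = u -> parity prV c v = v ->
    parity prW (b (+) c) (f u v) = f u v.
Proof.
move=> gU gV gW bf hf b c u v.
have sU := parity_super gU; have sV := parity_super gV; have sW := parity_super gW.
have lU := super_linear sU; have lV := super_linear sV; have lW := super_linear sW.
suff e : parity prW (b (+) c) (f (parity prU b u) (parity prV c v)) =
    f (parity prU b u) (parity prV c v) by move=> hu hv; move: e; rewrite hu hv.
move: u; apply: (grading_ext gU); [lin | lin | move=> m u hu].
move: v; apply: (grading_ext gV); [lin | lin | move=> n v hv].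
rewrite (parity_homog _ gU hu) (parity_homog _ gV hv).
case: eqP => [<-|_]; last by rewrite !(lin0 (bilin_l _ bf)) (lin0 (lW _)).
case: eqP => [<-|_]; last by rewrite !(lin0 (bilin_r _ bf)) (lin0 (lW _)).
by rewrite -oddD; apply: homog_parity => //; apply: hf.
Qed.

Section Exchange.
Context {k : fieldType} {OA OH : dgbialg k} {Ra : OH -> OA -> OH} {La : OH -> OA -> OA}.
Hypothesis gA : is_grading (pr OA).
Hypothesis gH : is_grading (pr OH).
Hypothesis bA : is_super_bialgebra (par OA).
Hypothesis bH : is_super_bialgebra (par OH).
Hypothesis smp : is_super_matched_pair Ra La.

Notation pA := (par OA).
Notation pH := (par OH).
Let sA := sbialgebra_super bA.
Let sH := sbialgebra_super bH.
Let lA := super_linear sA.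
Let lH := super_linear sH.
Let cA := super_bialgebra_coalgebra bA.
Let cH := super_bialgebra_coalgebra bH.
Let ldA := sc_linear cA.
Let ldH := sc_linear cH.
Let bmA := mul_bilin (sbialgebra_alg bA).
Let bmH := mul_bilin (sbialgebra_alg bH).
Let bR := srmc_bilin (smp_right smp).
Let bL := slmc_bilin (smp_left smp).
Let leA := eps_linear (sbialgebra_coalg bA).
Let leH := eps_linear (sbialgebra_coalg bH).

Let C : lmodType k := tensor OH OA.
Let pC : bool -> C -> C := tensor_parity pH pA.
Let δC : C -> tensor C C := tens_cop pH pA (@cop k OH) (@cop k OA).
Let sC : is_super pC := tensor_super sH sA.
Let lC := super_linear sC.
Let cC : is_super_coalgebra pC δC := tens_super_coalgebra cH cA.
Let ldC := sc_linear cC.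

Let ract : C -> OH := tlift Ra.
Let lact : C -> OA := tlift La.
Let lract : linear ract := tlift_lin bR.
Let llact : linear lact := tlift_lin bL.
Let ractE x w : ract (x ⊗ w) = Ra x w := tliftE _ _ bR.
Let lactE x w : lact (x ⊗ w) = La x w := tliftE _ _ bL.

Lemma Ra_even b c x w : pH b x = x -> pA c w = w -> pH (b (+) c) (Ra x w) = Ra x w.
Proof. exact: (parity_bilin gH gA gH bR (srmc_homog (smp_right smp))). Qed.

Lemma La_even b c x w : pH b x = x -> pA c w = w -> pA (b (+) c) (La x w) = La x w.
Proof. exact: (parity_bilin gH gA gA bL (slmc_homog (smp_left smp))). Qed.

Lemma ract_even b c : pC b c = c -> pH b (ract c) = ract c.
Proof.
suff e : pH b (ract (pC b c)) = ract (pC b c) by move=> <-.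
move: c; apply: (tensor_hext sH sA); [lin | lin | move=> b1 c1 x w hx hw].
rewrite /pC (tensor_parity_pure _ sH sA hx hw).
case: eqP => [->|_]; last by rewrite (lin0 lract) (lin0 (lH _)).
by rewrite ractE Ra_even.
Qed.

Lemma lact_even b c : pC b c = c -> pA b (lact c) = lact c.
Proof.
suff e : pA b (lact (pC b c)) = lact (pC b c) by move=> <-.
move: c; apply: (tensor_hext sH sA); [lin | lin | move=> b1 c1 x w hx hw].
rewrite /pC (tensor_parity_pure _ sH sA hx hw).
case: eqP => [->|_]; last by rewrite (lin0 llact) (lin0 (lA _)).
by rewrite lactE La_even.
Qed.

Lemma ract_cop c : cop (ract c) = tmap ract ract (δC c).
Proof.
move: c; apply: (tensor_ext (V := OH) (W := OA)); [lin | lin | move=> x w].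
rewrite ractE (srmc_cop (smp_right smp)) (tmap_sweedler _ sC sC) // sweedler_tens_cop //; [|lin].
apply: eq_sweedler => // b1 b2 x1 x2 _ _; apply: eq_sweedler => // c1 c2 w1 w2 _ _.
by rewrite !ractE.
Qed.

Lemma lact_cop c : cop (lact c) = tmap lact lact (δC c).
Proof.
move: c; apply: (tensor_ext (V := OH) (W := OA)); [lin | lin | move=> x w].
rewrite lactE (slmc_cop (smp_left smp)) (tmap_sweedler _ sC sC) // sweedler_tens_cop //; [|lin].
apply: eq_sweedler => // b1 b2 x1 x2 _ _; apply: eq_sweedler => // c1 c2 w1 w2 _ _.
by rewrite !lactE.
Qed.

(** The last condition on a matched pair: its sign is that of the coproduct of [C]
    times that of the flip of two elements of [C]. *)
Lemma act_cocomm c :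
  sweedler pC pC (δC c) (fun _ _ u v => ract u ⊗ lact v) =
  sweedler pC pC (δC c) (fun b1 b2 u v => (-1) ^+ (b1 * b2) *: (ract v ⊗ lact u)).
Proof.
move: c; apply: (tensor_ext (V := OH) (W := OA)); [lin | lin | move=> x w].
rewrite !sweedler_tens_cop //; [|lin..].
transitivity (sweedler pH pH (cop x) (fun p1 p2 x1 x2 =>
    sweedler pA pA (cop w) (fun q1 q2 w1 w2 =>
      (-1) ^+ (q1 * p2) *: (Ra x1 w1 ⊗ La x2 w2)))).
  apply: eq_sweedler => // b1 b2 x1 x2 _ _; apply: eq_sweedler => // c1 c2 w1 w2 _ _.
  by rewrite ractE lactE mulnC.
rewrite (smp_compat smp).
apply: eq_sweedler => // b1 b2 x1 x2 _ _; apply: eq_sweedler => // c1 c2 w1 w2 _ _.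
by rewrite ractE lactE; signs.
Qed.

(** The map that commutes an element of [OH] past one of [OA] in the double cross
    product. *)
Definition exchange : C -> tensor OA OH := fun c => tmap lact ract (δC c).

Lemma exchange_linear : linear exchange.
Proof. by rewrite /exchange; lin. Qed.

Lemma exchangeE x w : exchange (x ⊗ w) =
  sweedler pH pH (cop x) (fun p1 p2 x1 x2 =>
  sweedler pA pA (cop w) (fun q1 q2 w1 w2 =>
    (-1) ^+ (p2 * q1) *: (La x1 w1 ⊗ Ra x2 w2))).
Proof.
rewrite /exchange (tmap_sweedler _ sC sC) // sweedler_tens_cop //; [|lin].
apply: eq_sweedler => // b1 b2 x1 x2 _ _; apply: eq_sweedler => // c1 c2 w1 w2 _ _.
by rewrite lactE ractE.
Qed.

Lemma tlift_exchange (U : lmodType k) (F : OA -> OH -> U) c : bilin F ->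
  tlift F (exchange c) =
  sweedler pC pC (δC c) (fun _ _ u v => F (lact u) (ract v)).
Proof.
by move=> bF; rewrite /exchange tlift_tmap // sweedler_tlift //; lin.
Qed.

Lemma exchange_cop c :
  tens_cop pA pH (@cop k OA) (@cop k OH) (exchange c) = tmap exchange exchange (δC c).
Proof.
exact: (convolution_cop cC cA cH llact lract lact_even ract_even lact_cop ract_cop act_cocomm).
Qed.

(** [hmul x] and [amul w] multiply the outer tensor factors of [OH ⊗ OA]; since
    multiplication is a super coalgebra map, so are they in both arguments. *)
Let hmul (x : OH) (c : C) : C := tlift (fun y w => mul x y ⊗ w) c.
Let amul (c : C) (w : OA) : C := tlift (fun y z => y ⊗ mul z w) c.
Let bhmul : bilin hmul. Proof. by rewrite /hmul; lin. Qed.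
Let bamul : bilin amul. Proof. by rewrite /amul; lin. Qed.
Let hmulE x y w : hmul x (y ⊗ w) = mul x y ⊗ w.
Proof. by rewrite /hmul tliftE //; lin. Qed.
Let amulE y z w : amul (y ⊗ z) w = y ⊗ mul z w.
Proof. by rewrite /amul tliftE //; lin. Qed.

Lemma sweedler_hmul (U : lmodType k) (F : C -> C -> U) x c : bilin F ->
  sweedler pC pC (δC (hmul x c)) (fun _ _ => F) =
  sweedler pH pH (cop x) (fun _ b2 x1 x2 => sweedler pC pC (δC c) (fun c1 _ u v =>
    (-1) ^+ (b2 * c1) *: F (hmul x1 u) (hmul x2 v))).
Proof.
move=> bF; move: c; apply: (tensor_ext (V := OH) (W := OA)); [lin | lin | move=> y w].
rewrite hmulE sweedler_tens_cop // (sweedler_cop_mul _ _ bH); last by lin.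
apply: eq_sweedler => // b1 b2 x1 x2 _ _.
rewrite sweedler_tens_cop; [|done|done|lin].
apply: eq_sweedler => // c1 c2 y1 y2 _ _.
rewrite scaler_sweedler; apply: eq_sweedler => // d1 d2 w1 w2 _ _.
by rewrite !hmulE; signs.
Qed.

Lemma sweedler_amul (U : lmodType k) (F : C -> C -> U) w c : bilin F ->
  sweedler pC pC (δC (amul c w)) (fun _ _ => F) =
  sweedler pC pC (δC c) (fun _ c2 u v => sweedler pA pA (cop w) (fun d1 _ w1 w2 =>
    (-1) ^+ (c2 * d1) *: F (amul u w1) (amul v w2))).
Proof.
move=> bF; move: c; apply: (tensor_ext (V := OH) (W := OA)); [lin | lin | move=> y z].
rewrite amulE !sweedler_tens_cop //; [|lin].
apply: eq_sweedler => // b1 b2 y1 y2 _ _.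
rewrite (sweedler_cop_mul _ _ bA); last by lin.
apply: eq_sweedler => // c1 c2 z1 z2 _ _.
rewrite scaler_sweedler; apply: eq_sweedler => // d1 d2 w1 w2 _ _.
by rewrite !amulE; signs.
Qed.

Lemma lact_hmul x c : lact (hmul x c) = La x (lact c).
Proof.
move: c; apply: (tensor_ext (V := OH) (W := OA)); [lin | lin | move=> y w].
by rewrite hmulE !lactE (slmc_mul (smp_left smp)).
Qed.

Lemma ract_amul c w : ract (amul c w) = Ra (ract c) w.
Proof.
move: c; apply: (tensor_ext (V := OH) (W := OA)); [lin | lin | move=> y z].
by rewrite amulE !ractE (srmc_mul (smp_right smp)).
Qed.

(** The condition on the action on a product; its sign is now part of the coproduct
    of [C]. *)
Lemma ract_hmul x c : ract (hmul x c) =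
  sweedler pC pC (δC c) (fun _ _ u v => mul (Ra x (lact u)) (ract v)).
Proof.
move: c; apply: (tensor_ext (V := OH) (W := OA)); [lin | lin | move=> y w].
rewrite hmulE ractE (smp_ra_mul smp) sweedler_tens_cop //; last by lin.
apply: eq_sweedler => // b1 b2 y1 y2 _ _; apply: eq_sweedler => // c1 c2 w1 w2 _ _.
by rewrite lactE ractE mulnC.
Qed.

Lemma lact_amul c w : lact (amul c w) =
  sweedler pC pC (δC c) (fun _ _ u v => mul (lact u) (La (ract v) w)).
Proof.
move: c; apply: (tensor_ext (V := OH) (W := OA)); [lin | lin | move=> y z].
rewrite amulE lactE (smp_la_mul smp) sweedler_tens_cop //; last by lin.
apply: eq_sweedler => // b1 b2 y1 y2 _ _; apply: eq_sweedler => // c1 c2 w1 w2 _ _.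
by rewrite lactE ractE mulnC.
Qed.

(* Both sides are [La(x1, u) ⊗ Ra(x2, v1) Ra(v2)], for [u ⊗ v1 ⊗ v2] the threefold
   coproduct of [c]: on the left by [ract_hmul], on the right because [La] is a
   coalgebra map. *)
Let exchange_hmul x c : exchange (hmul x c) =
  tlift (fun a h => tlift (fun a' h' => a' ⊗ mul h' h) (exchange (x ⊗ a))) (exchange c).
Proof.
have lE := exchange_linear.
transitivity (sweedler pH pH (cop x) (fun _ b2 x1 x2 =>
    sweedler pC pC (δC c) (fun c1 _ u v => sweedler pC pC (δC v) (fun _ _ v1 v2 =>
      (-1) ^+ (b2 * c1) *: (La x1 (lact u) ⊗ mul (Ra x2 (lact v1)) (ract v2)))))).
  rewrite /exchange (tmap_sweedler _ sC sC) // sweedler_hmul; last by lin.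
  apply: eq_sweedler => // b1 b2 x1 x2 _ _; apply: eq_sweedler => // c1 c2 u v _ _.
  rewrite lact_hmul ract_hmul.
  have lt : linear (fun h : OH => (-1) ^+ (b2 * c1) *: (La x1 (lact u) ⊗ h)) by lin.
  by rewrite (lin_sweedler _ _ _ _ lt).
rewrite [RHS]tlift_exchange; last by lin.
transitivity (sweedler pC pC (δC c) (fun _ _ u' v2 =>
    sweedler pC pC (δC u') (fun c1 _ u v1 => sweedler pH pH (cop x) (fun _ b2 x1 x2 =>
      (-1) ^+ (b2 * c1) *: (La x1 (lact u) ⊗ mul (Ra x2 (lact v1)) (ract v2)))))).
  rewrite exchange_sweedler (sweedler_coassoc cC (G := fun c1 _ _ u v1 v2 =>
    sweedler pH pH (cop x) (fun _ b2 x1 x2 => (-1) ^+ (b2 * c1) *: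
      (La x1 (lact u) ⊗ mul (Ra x2 (lact v1)) (ract v2))))); [|lin..].
  apply: eq_sweedler => // c1 c2 u v _ _; exact: exchange_sweedler.
apply: eq_sweedler => // _ _ u' v2 _ _; rewrite exchangeE exchange_sweedler.
have lt : linear (tlift (fun (a' : OA) (h' : OH) => a' ⊗ mul h' (ract v2))).
  by apply: tlift_lin; lin.
rewrite (lin_sweedler _ _ _ _ lt); apply: eq_sweedler => // b1 b2 x1 x2 _ _.
rewrite (lin_sweedler _ _ _ _ lt).
rewrite (sweedler_morph (δ := δC) sC sA llact lact_even lact_cop); last by lin.
apply: eq_sweedler => // c1 c2 u v1 _ _.
by rewrite (linZ lt) tliftE //; lin.
Qed.

(* The mirror image: both sides are [La(u1) La(Ra u2, w1) ⊗ Ra(v, w2)]. *)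
Let exchange_amul c w : exchange (amul c w) =
  tlift (fun a h => tlift (fun a' h' => mul a a' ⊗ h') (exchange (h ⊗ w))) (exchange c).
Proof.
have lE := exchange_linear.
transitivity (sweedler pC pC (δC c) (fun _ c2 u v => sweedler pA pA (cop w) (fun d1 _ w1 w2 =>
    sweedler pC pC (δC u) (fun _ _ u1 u2 =>
      (-1) ^+ (c2 * d1) *: (mul (lact u1) (La (ract u2) w1) ⊗ Ra (ract v) w2))))).
  rewrite /exchange (tmap_sweedler _ sC sC) // sweedler_amul; last by lin.
  apply: eq_sweedler => // c1 c2 u v _ _; apply: eq_sweedler => // d1 d2 w1 w2 _ _.
  rewrite ract_amul lact_amul.
  have lt : linear (fun a : OA => (-1) ^+ (c2 * d1) *: (a ⊗ Ra (ract v) w2)) by lin.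
  by rewrite (lin_sweedler _ _ _ _ lt).
rewrite [RHS]tlift_exchange; last by lin.
transitivity (sweedler pC pC (δC c) (fun _ _ u1 v' =>
    sweedler pC pC (δC v') (fun _ c2 u2 v => sweedler pA pA (cop w) (fun d1 _ w1 w2 =>
      (-1) ^+ (c2 * d1) *: (mul (lact u1) (La (ract u2) w1) ⊗ Ra (ract v) w2))))).
  rewrite -(sweedler_coassoc cC (G := fun _ _ c2 u1 u2 v =>
    sweedler pA pA (cop w) (fun d1 _ w1 w2 => (-1) ^+ (c2 * d1) *:
      (mul (lact u1) (La (ract u2) w1) ⊗ Ra (ract v) w2)))); [|lin..].
  apply: eq_sweedler => // c1 c2 u v _ _; exact: exchange_sweedler.
apply: eq_sweedler => // _ _ u1 v' _ _; rewrite exchangeE.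
have lt : linear (tlift (fun (a' : OA) (h' : OH) => mul (lact u1) a' ⊗ h')).
  by apply: tlift_lin; lin.
rewrite (lin_sweedler _ _ _ _ lt).
rewrite (sweedler_morph (δ := δC) sC sH lract ract_even ract_cop); last by lin.
apply: eq_sweedler => // c1 c2 u2 v _ _.
rewrite (lin_sweedler _ _ _ _ lt); apply: eq_sweedler => // d1 d2 w1 w2 _ _.
by rewrite (linZ lt) tliftE //; lin.
Qed.

(** The first hexagon identity. *)
Lemma exchange_mull x y w : exchange (mul x y ⊗ w) =
  tlift (fun a h => tlift (fun a' h' => a' ⊗ mul h' h) (exchange (x ⊗ a)))
    (exchange (y ⊗ w)).
Proof. by rewrite -hmulE exchange_hmul. Qed.

(** The second hexagon identity. *)
Lemma exchange_mulr x w z : exchange (x ⊗ mul w z) =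
  tlift (fun a h => tlift (fun a' h' => mul a a' ⊗ h') (exchange (h ⊗ z)))
    (exchange (x ⊗ w)).
Proof. by rewrite -amulE exchange_amul. Qed.

Lemma exchange_onel w : exchange (one OH ⊗ w) = w ⊗ one OH.
Proof.
have e1 := sbialgebra_one_even bH; have ca := cop_counitr (sbialgebra_coalg bA).
rewrite exchangeE (sbialgebra_cop_one bH) (sweedler_pure sH sH _ e1 e1); last by lin.
have lt : linear (fun a : OA => a ⊗ one OH) by lin.
rewrite -[in RHS](ca w) (lin_tlift _ _ lt) -(sweedler_tlift _ sA sA); last by lin.
apply: eq_sweedler => // c1 c2 w1 w2 _ _.
rewrite mul0n expr0 scale1r (slmc_one (smp_left smp)) (smp_ra_one smp).
by rewrite (linZ (bilin_r _ (tpure_bilin _ _))) (linZ lt).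
Qed.

Lemma exchange_oner x : exchange (x ⊗ one OA) = one OA ⊗ x.
Proof.
have e1 := sbialgebra_one_even bA; have ca := cop_counitl (sbialgebra_coalg bH).
rewrite exchangeE.
have lt : linear (fun h : OH => one OA ⊗ h) by lin.
rewrite -[in RHS](ca x) (lin_tlift _ _ lt) -(sweedler_tlift _ sH sH); last by lin.
apply: eq_sweedler => // c1 c2 x1 x2 _ _.
rewrite (sbialgebra_cop_one bA) (sweedler_pure sA sA _ e1 e1); last by lin.
rewrite muln0 expr0 scale1r (srmc_one (smp_right smp)) (smp_la_one smp).
by rewrite (linZ (bilin_l _ (tpure_bilin _ _))) (linZ lt).
Qed.

(** The counits of both actions are those of [C], so this is the counit axiom
    of [C]. *)
Lemma exchange_eps c : tens_eps (@eps k OA) (@eps k OH) (exchange c) =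
  tens_eps (@eps k OH) (@eps k OA) c.
Proof.
have bAH := tens_eps_bilin leA leH; have bHA := tens_eps_bilin leH leA.
have leC := tens_eps_scalar leH leA.
have el u : eps (lact u) = tens_eps (@eps k OH) (@eps k OA) u.
  move: u; apply: (tensor_ext (U := k^o)); [exact: (linear_comp (V := OA) (W := k^o)) | exact: leC |].
  by move=> x w; rewrite lactE (tens_epsE leH leA) (slmc_eps (smp_left smp)).
have er u : eps (ract u) = tens_eps (@eps k OH) (@eps k OA) u.
  move: u; apply: (tensor_ext (U := k^o)); [exact: (linear_comp (V := OH) (W := k^o)) | exact: leC |].
  by move=> x w; rewrite ractE (tens_epsE leH leA) (srmc_eps (smp_right smp)).
rewrite /tens_eps (tlift_exchange _ bAH).
have ct := tens_counitl cH cA leH leA (sbialgebra_eps_even bA)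
  (cop_counitl (sbialgebra_coalg bH)) (cop_counitl (sbialgebra_coalg bA)) c.
rewrite -[in RHS]ct -/(tens_eps _ _ _).
rewrite (lin_tlift (X := k^o) _ _ (f := tens_eps (@eps k OH) (@eps k OA))) //.
rewrite -(sweedler_tlift _ sC sC); last first.
  by apply: bilinI => u; apply: (linear_comp (W := k^o) (f := tens_eps eps eps)) => //; lin.
apply: (@eq_sweedler k C C k^o pC pC) => // _ _ u v _ _.
by rewrite el er; exact: (esym (@linZ k C k^o _ leC _ _)).
Qed.

End Exchange.
Arguments exchange {k OA OH} Ra La.

(** * The algebra of a super double cross product *)

Section DoubleCrossAlgebra.
Context {k : fieldType} {OA OH : dgbialg k} {Ra : OH -> OA -> OH} {La : OH -> OA -> OA}.
Hypothesis gA : is_grading (pr OA).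
Hypothesis gH : is_grading (pr OH).
Hypothesis bA : is_super_bialgebra (par OA).
Hypothesis bH : is_super_bialgebra (par OH).
Hypothesis smp : is_super_matched_pair Ra La.

Notation pA := (par OA).
Notation pH := (par OH).
Let sA := sbialgebra_super bA.
Let sH := sbialgebra_super bH.
Let lA := super_linear sA.
Let lH := super_linear sH.
Let cA := super_bialgebra_coalgebra bA.
Let cH := super_bialgebra_coalgebra bH.
Let ldA := sc_linear cA.
Let ldH := sc_linear cH.
Let aA := sbialgebra_alg bA.
Let aH := sbialgebra_alg bH.
Let bmA := mul_bilin aA.
Let bmH := mul_bilin aH.
Let bR := srmc_bilin (smp_right smp).
Let bL := slmc_bilin (smp_left smp).
Let E := exchange Ra La.

Let T : lmodType k := tensor OA OH.
Let m : T -> T -> T := @mul k (super_double_cross_bialg Ra La).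

(** The left [OA]- and right [OH]-module structure of [OA ⊗ OH]. *)
Definition sandwich (w : OA) (t : tensor OA OH) (y : OH) : tensor OA OH :=
  tlift (fun a h => mul w a ⊗ mul h y) t.

Lemma sandwich_linear2 w y : linear (fun t => sandwich w t y).
Proof. by rewrite /sandwich; lin. Qed.

Lemma sandwich_pure w a h y : sandwich w (a ⊗ h) y = mul w a ⊗ mul h y.
Proof. by rewrite /sandwich tliftE //; lin. Qed.

Let sl2 := sandwich_linear2.

Lemma double_cross_mul_bilin : bilin m.
Proof. by rewrite /m /=; lin. Qed.
Let bm := double_cross_mul_bilin.

Lemma double_cross_mulE w x z y : m (w ⊗ x) (z ⊗ y) = sandwich w (E (x ⊗ z)) y.
Proof.
rewrite /m /= tliftE; last by lin.
rewrite tliftE; last by lin.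
rewrite /E (exchangeE bA bH smp) (lin_sweedler _ _ _ _ (sl2 w y)).
apply: eq_sweedler => // p1 p2 x1 x2 _ _; rewrite (lin_sweedler _ _ _ _ (sl2 w y)).
apply: eq_sweedler => // q1 q2 z1 z2 _ _.
by rewrite (linZ (sl2 w y)) sandwich_pure.
Qed.

Lemma sandwich_sandwich w w' t y' y :
  sandwich w (sandwich w' t y') y = sandwich (mul w w') t (mul y' y).
Proof.
move: t; apply: tensor_ext; [lin | lin | move=> a h].
by rewrite !sandwich_pure (mul_assoc aA) (mul_assoc aH).
Qed.

(** Both products are [w a · E(h ⊗ a') · h' v] summed over [a ⊗ h = E(x ⊗ z)] and
    [a' ⊗ h' = E(y ⊗ u)]: each hexagon produces one of the two inner exchanges. *)
Lemma double_cross_mul_assoc s t u : m s (m t u) = m (m s t) u.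
Proof.
move: s; apply: tensor_ext; [lin | lin | move=> w x].
move: t; apply: tensor_ext; [lin | lin | move=> z y].
move: u; apply: tensor_ext; [lin | lin | move=> u v].
have lx1 w' h : linear (fun t => m (w' ⊗ h) t) by lin.
have lx2 t : linear (fun s => m s t) by lin.
transitivity (tlift (fun a h => tlift (fun a' h' =>
    sandwich (mul w a) (E (h ⊗ a')) (mul h' v)) (E (y ⊗ u))) (E (x ⊗ z))).
  rewrite double_cross_mulE {1}/sandwich exchange_tlift (lin_tlift _ _ (lx1 _ _)).
  apply: eq_tlift => a' h'; rewrite double_cross_mulE /E (exchange_mulr gA gH bA bH smp) -/E.
  rewrite (lin_tlift _ _ (sl2 w (mul h' v))); apply: eq_tlift => a h.
  have -> : tlift (fun a' h' => mul a a' ⊗ h') (E (h ⊗ a')) = sandwich a (E (h ⊗ a')) (one OH).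
    by apply: eq_tlift => b g; rewrite (mul_oner aH).
  by rewrite sandwich_sandwich (mul_onel aH).
rewrite double_cross_mulE {2}/sandwich (lin_tlift _ _ (lx2 _)).
apply: eq_tlift => a h; rewrite double_cross_mulE /E (exchange_mull gA gH bA bH smp) -/E.
rewrite (lin_tlift _ _ (sl2 (mul w a) v)); apply: eq_tlift => a' h'.
have -> : tlift (fun b g => b ⊗ mul g h') (E (h ⊗ a')) = sandwich (one OA) (E (h ⊗ a')) h'.
  by apply: eq_tlift => b g; rewrite (mul_onel aA).
by rewrite sandwich_sandwich (mul_oner aA).
Qed.

Lemma double_cross_mul_onel s : m (one OA ⊗ one OH) s = s.
Proof.
move: s; apply: tensor_ext; [lin | lin | move=> w x].
rewrite double_cross_mulE /E (exchange_onel bA bH smp) sandwich_pure.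
by rewrite (mul_onel aA) (mul_onel aH).
Qed.

Lemma double_cross_mul_oner s : m s (one OA ⊗ one OH) = s.
Proof.
move: s; apply: tensor_ext; [lin | lin | move=> w x].
rewrite double_cross_mulE /E (exchange_oner bA bH smp) sandwich_pure.
by rewrite (mul_oner aA) (mul_oner aH).
Qed.

Lemma double_cross_algebra : is_algebra (super_double_cross_bialg Ra La).
Proof.
split.
- exact: bm.
- exact: double_cross_mul_assoc.
- exact: double_cross_mul_onel.
- exact: double_cross_mul_oner.
Qed.

(** [OA ⊗ OH] is generated by the subalgebras [OA ⊗ 1] and [1 ⊗ OH], with [exchange]
    as the commutation rule between them. *)
Lemma double_cross_mul_ii w z : m (w ⊗ one OH) (z ⊗ one OH) = mul w z ⊗ one OH.
Proof.
by rewrite double_cross_mulE /E (exchange_onel bA bH smp) sandwich_pure (mul_onel aH).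
Qed.

Lemma double_cross_mul_jj x y : m (one OA ⊗ x) (one OA ⊗ y) = one OA ⊗ mul x y.
Proof.
by rewrite double_cross_mulE /E (exchange_oner bA bH smp) sandwich_pure (mul_onel aA).
Qed.

Lemma double_cross_mul_ij w x : m (w ⊗ one OH) (one OA ⊗ x) = w ⊗ x.
Proof.
rewrite double_cross_mulE /E (exchange_onel bA bH smp) sandwich_pure.
by rewrite (mul_oner aA) (mul_onel aH).
Qed.

Lemma double_cross_mul_ji x z : m (one OA ⊗ x) (z ⊗ one OH) = E (x ⊗ z).
Proof.
rewrite double_cross_mulE; move: (E _); apply: tensor_ext; [lin | lin | move=> a h].
by rewrite sandwich_pure (mul_onel aA) (mul_oner aH).
Qed.

End DoubleCrossAlgebra.

(** * The super tensor square of an algebra *)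

Section SuperTensorSquare.
Context {k : fieldType} {B : bialg k} {p : bool -> B -> B}.
Hypothesis sp : is_super p.
Hypothesis aB : is_algebra B.
Hypothesis mul_even : forall b c (x y : B), p b x = x -> p c y = y ->
  p (b (+) c) (mul x y) = mul x y.
Let lp := super_linear sp.
Let bm := mul_bilin aB.
Notation M := (super_tensor_mul p).

Lemma super_tensor_mul_bilin : bilin M.
Proof. by rewrite /super_tensor_mul; lin. Qed.
Let bM := super_tensor_mul_bilin.

Lemma super_tensor_mulE q r (a b c d : B) : p q b = b -> p r c = c ->
  M (a ⊗ b) (c ⊗ d) = (-1) ^+ (q * r) *: (mul a c ⊗ mul b d).
Proof.
move=> hb hc; rewrite /super_tensor_mul tliftE; last by lin.
rewrite tliftE; last by lin.
by rewrite (sweedler_pure sp sp _ hb hc); last by lin.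
Qed.

Lemma super_tensor_mulA s t u : M s (M t u) = M (M s t) u.
Proof.
move: s; apply: (tensor_hext sp sp); [lin | lin | move=> q1 q2 a1 a2 h1 h2].
move: t; apply: (tensor_hext sp sp); [lin | lin | move=> r1 r2 b1 b2 g1 g2].
move: u; apply: (tensor_hext sp sp); [lin | lin | move=> s1 s2 c1 c2 f1 f2].
rewrite (super_tensor_mulE _ _ g2 f1) (super_tensor_mulE _ _ h2 g1).
rewrite (linZ (bilin_r _ bM)) (linZ (bilin_l _ bM)).
rewrite (super_tensor_mulE _ _ h2 (mul_even g1 f1)).
rewrite (super_tensor_mulE _ _ (mul_even h2 g2) f1).
by rewrite !(mul_assoc aB); signs.
Qed.

End SuperTensorSquare.

(** * The super bialgebra structure of a double cross product *)

Section DoubleCrossBialgebra.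
Context {k : fieldType} {OA OH : dgbialg k} {Ra : OH -> OA -> OH} {La : OH -> OA -> OA}.
Hypothesis gA : is_grading (pr OA).
Hypothesis gH : is_grading (pr OH).
Hypothesis hmA : forall m n (x y : OA), homog (pr OA) m x -> homog (pr OA) n y ->
  homog (pr OA) (m + n) (mul x y).
Hypothesis hmH : forall m n (x y : OH), homog (pr OH) m x -> homog (pr OH) n y ->
  homog (pr OH) (m + n) (mul x y).
Hypothesis hcA : forall n (x : OA), homog (pr OA) n x ->
  homog (tensor_pr (pr OA) (pr OA)) n (cop x).
Hypothesis hcH : forall n (x : OH), homog (pr OH) n x ->
  homog (tensor_pr (pr OH) (pr OH)) n (cop x).
Hypothesis h1A : homog (pr OA) 0 (one OA).
Hypothesis h1H : homog (pr OH) 0 (one OH).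
Hypothesis bA : is_super_bialgebra (par OA).
Hypothesis bH : is_super_bialgebra (par OH).
Hypothesis smp : is_super_matched_pair Ra La.

Notation pA := (par OA).
Notation pH := (par OH).
Let sA := sbialgebra_super bA.
Let sH := sbialgebra_super bH.
Let cA := super_bialgebra_coalgebra bA.
Let cH := super_bialgebra_coalgebra bH.
Let ldA := sc_linear cA.
Let ldH := sc_linear cH.
Let aA := sbialgebra_alg bA.
Let aH := sbialgebra_alg bH.
Let bR := srmc_bilin (smp_right smp).
Let bL := slmc_bilin (smp_left smp).
Let leA := eps_linear (sbialgebra_coalg bA).
Let leH := eps_linear (sbialgebra_coalg bH).
Notation E := (exchange Ra La).
Let lE : linear E := exchange_linear bA bH smp.
Let sl2 := sandwich_linear2 bA bH.

Notation B := (super_double_cross_bialg Ra La).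
Let T : lmodType k := tensor OA OH.
Notation m := (@mul k B : T -> T -> T).
Let bm : bilin m := double_cross_mul_bilin bA bH smp.
Let aB : is_algebra B := double_cross_algebra gA gH bA bH smp.
Let pB : bool -> B -> B := tensor_parity pA pH.
Let sB : is_super pB := tensor_super sA sH.
Let lB := super_linear sB.
Notation Δ := (tens_cop pA pH (@cop k OA) (@cop k OH)).
Let lΔ : linear Δ := tens_cop_linear cA cH.
Let gT := tensor_pr_grading gA gH.

(** The coproduct of [C] and both actions preserve the degree. *)
Lemma exchange_homog n c : homog (tensor_pr (pr OH) (pr OA)) n c ->
  homog (tensor_pr (pr OA) (pr OH)) n (E c).
Proof.
move=> hc; rewrite /exchange.
have gC := tensor_pr_grading gH gA; have lC := tensor_pr_linear _ gH gA.
have hd := tens_cop_homog gH gA ldH ldA hcH hcA hc.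
have lf : linear (tmap (tlift La) (tlift Ra)) by apply: tmap_linear; apply: tlift_lin.
move: hd; rewrite -/(tens_cop _ _ _ _ _); move: (tens_cop _ _ _ _ _).
apply: homog_tensor_ind => //.
- by rewrite (lin0 lf); exact: homog0.
- by move=> x y hx hy; rewrite (linD lf); exact: homogD.
move=> i j u v <- hu hv; rewrite tmap_pure; [|exact: tlift_lin..].
apply: homog_tensor => //.
- have lf' := tlift_lin bL; move: u hu; apply: homog_tensor_ind => //.
  + by rewrite (lin0 lf'); exact: homog0.
  + by move=> x y hx hy; rewrite (linD lf'); exact: homogD.
  + by move=> i1 i2 x w <- hx hw; rewrite tliftE //; exact: (slmc_homog (smp_left smp)).
- have lf' := tlift_lin bR; move: v hv; apply: homog_tensor_ind => //.
  + by rewrite (lin0 lf'); exact: homog0.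
  + by move=> x y hx hy; rewrite (linD lf'); exact: homogD.
  + by move=> i1 i2 x w <- hx hw; rewrite tliftE //; exact: (srmc_homog (smp_right smp)).
Qed.

Lemma sandwich_homog i n j w t y :
  homog (pr OA) i w -> homog (tensor_pr (pr OA) (pr OH)) n t -> homog (pr OH) j y ->
  homog (tensor_pr (pr OA) (pr OH)) (i + n + j) (sandwich w t y).
Proof.
move=> hw ht hy; have ls := sl2 w y; move: t ht; apply: homog_tensor_ind => //.
- by rewrite (lin0 ls); exact: homog0.
- by move=> u v hu hv; rewrite (linD ls); exact: homogD.
move=> a b u v <- hu hv; rewrite (sandwich_pure bA bH) addnA -(addnA (i + a)%N).
by apply: homog_tensor => //; [exact: hmA | exact: hmH].
Qed.

Lemma double_cross_mul_homog i j (s t : T) :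
  homog (tensor_pr (pr OA) (pr OH)) i s -> homog (tensor_pr (pr OA) (pr OH)) j t ->
  homog (tensor_pr (pr OA) (pr OH)) (i + j) (m s t).
Proof.
move=> hs ht; have lm1 := bilin_l _ bm; have lm2 := bilin_r _ bm.
move: s hs; apply: homog_tensor_ind => //.
- by rewrite (lin0 (lm1 _)); exact: homog0.
- by move=> u v hu hv; rewrite (linD (lm1 _)); exact: homogD.
move=> a b w x <- hw hx; move: t ht; apply: homog_tensor_ind => //.
- by rewrite (lin0 (lm2 _)); exact: homog0.
- by move=> u v hu hv; rewrite (linD (lm2 _)); exact: homogD.
move=> c d z y <- hz hy; rewrite (double_cross_mulE bA bH smp).
have -> : (a + b + (c + d))%N = (a + (b + c) + d)%N by rewrite !addnA.
by apply: sandwich_homog => //; apply: exchange_homog; apply: homog_tensor.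
Qed.

Let mul_even b c (x y : B) : pB b x = x -> pB c y = y -> pB (b (+) c) (mul x y) = mul x y.
Proof.
rewrite /pB (tensor_parityE gA gH).
exact: (parity_bilin gT gT gT bm double_cross_mul_homog).
Qed.

Notation M := (super_tensor_mul pB).
Let bM : bilin M := super_tensor_mul_bilin sB aB.
Let MA := super_tensor_mulA sB aB mul_even.

Let i (w : OA) : T := w ⊗ one OH.
Let j (x : OH) : T := one OA ⊗ x.
Let li : linear i. Proof. by rewrite /i; lin. Qed.
Let lj : linear j. Proof. by rewrite /j; lin. Qed.

Let i_even b w : pA b w = w -> pB b (i w) = i w.
Proof.
move=> hw; rewrite -{1}(addbF b).
exact: (tensor_hom cA cH hw (sbialgebra_one_even bH)).
Qed.

Let j_even b x : pH b x = x -> pB b (j x) = j x.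
Proof. exact: (tensor_hom cA cH (sbialgebra_one_even bA)). Qed.

Lemma double_cross_cop_i w : Δ (w ⊗ one OH) = tmap i i (cop w).
Proof.
rewrite (tens_cop_pure cA cH) (tmap_sweedler _ sA sA) //.
apply: eq_sweedler => // b1 b2 w1 w2 _ _; have e1 := sbialgebra_one_even bH.
rewrite (sbialgebra_cop_one bH) (sweedler_pure sH sH _ e1 e1); last by lin.
by rewrite muln0 scale1r.
Qed.

Lemma double_cross_cop_j x : Δ (one OA ⊗ x) = tmap j j (cop x).
Proof.
rewrite (tens_cop_pure cA cH) (tmap_sweedler _ sH sH) //.
have e1 := sbialgebra_one_even bA.
rewrite (sbialgebra_cop_one bA) (sweedler_pure sA sA _ e1 e1); last by lin.
by apply: eq_sweedler => // b1 b2 x1 x2 _ _; rewrite scale1r.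
Qed.

Let cop_ij w x : Δ (w ⊗ x) = M (Δ (i w)) (Δ (j x)).
Proof.
rewrite (tens_cop_pure cA cH) double_cross_cop_i double_cross_cop_j.
rewrite (tmap_sweedler _ sA sA) // (lin_sweedler _ _ _ _ (bilin_l _ bM)).
apply: eq_sweedler => // b1 b2 w1 w2 _ hw; rewrite (tmap_sweedler _ sH sH) //.
rewrite (lin_sweedler _ _ _ _ (bilin_r _ bM)).
apply: eq_sweedler => // c1 c2 x1 x2 hx _.
rewrite (super_tensor_mulE sB aB _ _ (i_even hw) (j_even hx)).
by rewrite !(double_cross_mul_ij bA bH smp).
Qed.

Let cop_ii w z : Δ (i (mul w z)) = M (Δ (i w)) (Δ (i z)).
Proof.
rewrite !double_cross_cop_i (tmap_sweedler _ sA sA) // (sweedler_cop_mul _ _ bA); last by lin.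
rewrite !(tmap_sweedler _ sA sA) // (lin_sweedler _ _ _ _ (bilin_l _ bM)).
apply: eq_sweedler => // b1 b2 w1 w2 _ hw; rewrite (lin_sweedler _ _ _ _ (bilin_r _ bM)).
apply: eq_sweedler => // c1 c2 z1 z2 hz _.
rewrite (super_tensor_mulE sB aB _ _ (i_even hw) (i_even hz)).
by rewrite !(double_cross_mul_ii bA bH smp).
Qed.

Let cop_jj x y : Δ (j (mul x y)) = M (Δ (j x)) (Δ (j y)).
Proof.
rewrite !double_cross_cop_j (tmap_sweedler _ sH sH) // (sweedler_cop_mul _ _ bH); last by lin.
rewrite !(tmap_sweedler _ sH sH) // (lin_sweedler _ _ _ _ (bilin_l _ bM)).
apply: eq_sweedler => // b1 b2 x1 x2 _ hx; rewrite (lin_sweedler _ _ _ _ (bilin_r _ bM)).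
apply: eq_sweedler => // c1 c2 y1 y2 hy _.
rewrite (super_tensor_mulE sB aB _ _ (j_even hx) (j_even hy)).
by rewrite !(double_cross_mul_jj bA bH smp).
Qed.

(* This is where [E] has to be a coalgebra map. *)
Let cop_ji x z : Δ (E (x ⊗ z)) = M (Δ (j x)) (Δ (i z)).
Proof.
rewrite double_cross_cop_i double_cross_cop_j (exchange_cop gA gH bA bH smp).
have sC := tensor_super sH sA.
rewrite (tmap_sweedler _ sC sC) // (sweedler_tens_cop cH cA); last by lin.
rewrite (tmap_sweedler _ sH sH) // (lin_sweedler _ _ _ _ (bilin_l _ bM)).
apply: eq_sweedler => // b1 b2 x1 x2 _ hx; rewrite (tmap_sweedler _ sA sA) //.
rewrite (lin_sweedler _ _ _ _ (bilin_r _ bM)).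
apply: eq_sweedler => // c1 c2 z1 z2 hz _.
rewrite (super_tensor_mulE sB aB _ _ (j_even hx) (i_even hz)).
by rewrite !(double_cross_mul_ji bA bH smp).
Qed.

(* [w · t · y] is the product of [w ⊗ 1], [t] and [1 ⊗ y]. *)
Let cop_sandwich w t y : Δ (sandwich w t y) = M (M (Δ (i w)) (Δ t)) (Δ (j y)).
Proof.
have sl := sl2 w y.
move: t; apply: tensor_ext; [lin | lin | move=> a h].
by rewrite (sandwich_pure bA bH) cop_ij cop_ii cop_jj (cop_ij a h) !MA.
Qed.

(** [(w ⊗ x)(z ⊗ y)] is the product of [w ⊗ 1], [(1 ⊗ x)(z ⊗ 1)] and [1 ⊗ y], and
    [Δ] is multiplicative on each of these products. *)
Lemma double_cross_cop_mul s t : Δ (m s t) = M (Δ s) (Δ t).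
Proof.
move: s; apply: tensor_ext; [lin | lin | move=> w x].
move: t; apply: tensor_ext; [lin | lin | move=> z y].
by rewrite (double_cross_mulE bA bH smp) cop_sandwich cop_ji (cop_ij w x) (cop_ij z y) !MA.
Qed.

Notation εB := (tens_eps (@eps k OA) (@eps k OH)).

Lemma double_cross_eps_mul s t : εB (m s t) = εB s * εB t.
Proof.
have lε := tens_eps_scalar leA leH.
have εE w x : εB (w ⊗ x) = eps w * eps x by exact: tens_epsE.
have ls w y u : εB (sandwich w u y) = eps w * εB u * eps y.
  have sl := sl2 w y.
  move: u; apply: (tensor_ext (U := k^o)).
  - exact: (linear_comp (W := k^o) lε sl).
  - by move=> a u v; rewrite lε mulrDr mulrDl /GRing.scale /= !mulrA (mulrC _ a).
  move=> a h; rewrite (sandwich_pure bA bH) !εE.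
  by rewrite (sbialgebra_eps_mul bA) (sbialgebra_eps_mul bH) !mulrA.
move: s; apply: (tensor_ext (U := k^o)).
- by apply: (linear_comp (W := k^o) lε); lin.
- by move=> a u v; rewrite lε mulrDl /GRing.scale /= mulrA.
move=> w x; move: t; apply: (tensor_ext (U := k^o)).
- by apply: (linear_comp (W := k^o) lε); lin.
- by move=> a u v; rewrite lε mulrDr /GRing.scale /= mulrCA.
move=> z y; rewrite (double_cross_mulE bA bH smp) ls.
rewrite (exchange_eps bA bH smp) (tens_epsE leH leA) !εE.
by rewrite !mulrA.
Qed.

Lemma double_cross_super_bialgebra : is_super_bialgebra (A := B) pB.
Proof.
have cB := tens_super_coalgebra cA cH.
have ccA := sbialgebra_coalg bA; have ccH := sbialgebra_coalg bH.
split.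
- exact: sB.
- exact: aB.
- split.
  + exact: lΔ.
  + exact: (tens_eps_scalar leA leH).
  + exact: sc_assoc cB.
  + exact: (tens_counitl cA cH leA leH (sbialgebra_eps_even bH)
      (cop_counitl ccA) (cop_counitl ccH)).
  + exact: (tens_counitr cA cH leA leH (sbialgebra_eps_even bA)
      (cop_counitr ccA) (cop_counitr ccH)).
- exact: mul_even.
- exact: (tensor_hom cA cH (sbialgebra_one_even bA) (sbialgebra_one_even bH)).
- exact: sc_even cB.
- have lε := tens_eps_scalar leA leH.
  apply: (tensor_hext (U := k^o) sA sH).
  + exact: (linear_comp (W := k^o) lε (lB true)).
  + exact: (@linear_zero k T k^o).
  move=> b c v w hv hw; rewrite /pB (tensor_parity_pure _ sA sH hv hw).
  case: eqP => [e|_]; last exact: (lin0 (V := k^o) lε).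
  rewrite [LHS](tens_epsE leA leH); case: b c e hv hw => [] [] // _.
  + by move=> <- _; rewrite (sbialgebra_eps_even bA) mul0r.
  + by move=> _ <-; rewrite (sbialgebra_eps_even bH) mulr0.
- exact: double_cross_cop_mul.
- have := double_cross_cop_i (one OA).
  rewrite (sbialgebra_cop_one bA) tmap_pure //.
- exact: double_cross_eps_mul.
- rewrite [LHS](tens_epsE leA leH) (sbialgebra_eps_one bA) (sbialgebra_eps_one bH).
  exact: mulr1.
Qed.

End DoubleCrossBialgebra.

(** * Differentials *)

Section SignOperator.
Context {k : fieldType}.
Implicit Types U V W : lmodType k.

Lemma gsign_linear V (p : bool -> V -> V) : is_super p -> linear (gsign p).
Proof.
by move=> sp; have lp := super_linear sp; rewrite /gsign; lin.
Qed.

Lemma gsign_hom V (p : bool -> V -> V) b x :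
  is_super p -> p b x = x -> gsign p x = (-1) ^+ b *: x.
Proof.
move=> sp hx; rewrite /gsign !(super_homE _ sp hx).
by case: b hx => _; rewrite ?sub0r ?subr0 ?expr1 ?scaleN1r ?scale1r.
Qed.

Lemma gsign_homog V (pr : nat -> V -> V) n x :
  is_grading pr -> homog pr n x -> gsign (parity pr) x = (-1) ^+ n *: x.
Proof.
move=> gr hx; rewrite (gsign_hom (parity_super gr) (homog_parity gr hx)).
by rewrite signr_odd.
Qed.

Lemma gsign_tensor V W (pV : bool -> V -> V) (pW : bool -> W -> W) v w :
  is_super pV -> is_super pW ->
  gsign (tensor_parity pV pW) (v ⊗ w) = gsign pV v ⊗ gsign pW w.
Proof.
move=> sV sW; have sT := tensor_super sV sW.
have lV := gsign_linear sV; have lW := gsign_linear sW; have lT := gsign_linear sT.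
have := @tensor_hext k V W _ pV pW (gsign (tensor_parity pV pW))
  (tmap (gsign pV) (gsign pW)) sV sW lT (tmap_linear lV lW).
move=> /(_ _ (v ⊗ w)); rewrite tmap_pure //; apply=> b c {}v {}w hv hw.
rewrite tmap_pure // (gsign_hom (b := b (+) c) sT); last first.
  by rewrite (tensor_parity_pure _ sV sW hv hw) eqxx.
rewrite (gsign_hom sV hv) (gsign_hom sW hw) (linZ (bilin_l _ (tpure_bilin _ _))).
by rewrite (linZ (bilin_r _ (tpure_bilin _ _))); signs.
Qed.

Lemma gsign_bilin U V W (pU : bool -> U -> U) (pV : bool -> V -> V)
    (pW : bool -> W -> W) (f : U -> V -> W) u v :
  is_super pU -> is_super pV -> is_super pW -> bilin f ->
  (forall b c u v, pU b u = u -> pV c v = v -> pW (b (+) c) (f u v) = f u v) ->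
  gsign pW (f u v) = f (gsign pU u) (gsign pV v).
Proof.
move=> sU sV sW bf hf.
have lU := gsign_linear sU; have lV := gsign_linear sV; have lW := gsign_linear sW.
move: u; apply: (super_ext sU); [lin | lin | move=> b u hu].
move: v; apply: (super_ext sV); [lin | lin | move=> c v hv].
rewrite (gsign_hom sU hu) (gsign_hom sV hv) (gsign_hom sW (hf _ _ _ _ hu hv)).
by rewrite (linZ (bilin_l _ bf)) (linZ (bilin_r _ bf)); signs.
Qed.

Lemma gsign_odd V (p : bool -> V -> V) d x : is_super p -> linear d ->
  (forall b x, p b x = x -> p (~~ b) (d x) = d x) -> gsign p (d x) = - d (gsign p x).
Proof.
move=> sp ld hd; have lp := gsign_linear sp.
move: x; apply: (super_ext sp); [lin | lin | move=> b x hx].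
rewrite (gsign_hom sp hx) (gsign_hom sp (hd _ _ hx)) (linZ ld).
by case: b {hx}; rewrite ?expr1 ?expr0 ?scaleN1r ?scale1r ?opprK.
Qed.

Lemma parity_degree1 V (pr : nat -> V -> V) (d : V -> V) b x :
  is_grading pr -> linear d -> (forall n x, homog pr n x -> homog pr n.+1 (d x)) ->
  parity pr b x = x -> parity pr (~~ b) (d x) = d x.
Proof.
move=> gr ld hd; have lp := super_linear (parity_super gr).
suff e : parity pr (~~ b) (d (parity pr b x)) = d (parity pr b x) by move=> <-.
move: x; apply: (grading_ext gr); [lin | lin | move=> n x hx].
rewrite (parity_homog _ gr hx); case: eqP => [<-|_]; last by rewrite (lin0 ld) (lin0 (lp _)).
exact: (homog_parity gr (hd _ _ hx)).
Qed.

Lemma sweedlerD U V W pU pV (F G : bool -> bool -> U -> V -> W) t :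
  sweedler pU pV t F + sweedler pU pV t G =
  sweedler pU pV t (fun b c u v => F b c u v + G b c u v).
Proof.
rewrite /sweedler -big_split; apply: eq_bigr => b _; rewrite -big_split.
by apply: eq_bigr => c _; rewrite /tlift /tsum -big_split.
Qed.

End SignOperator.

Definition tens_diff {k : fieldType} {V W : lmodType k} (pV : bool -> V -> V)
    (dV : V -> V) (dW : W -> W) : tensor V W -> tensor V W :=
  fun t => tlift (fun v w => dV v ⊗ w + gsign pV v ⊗ dW w) t.

Record is_coderivation {k : fieldType} {V : lmodType k} (p : bool -> V -> V)
    (δ : V -> tensor V V) (d : V -> V) : Prop := {
  cd_linear : linear d;
  cd_odd : forall b x, p b x = x -> p (~~ b) (d x) = d x;
  cd_cop : forall x, δ (d x) = tmap d id (δ x) + tmap (gsign p) d (δ x)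
}.

Lemma sweedler_coderivation {k : fieldType} {V : lmodType k} {p : bool -> V -> V}
    {δ : V -> tensor V V} {d : V -> V} (U : lmodType k)
    (F : bool -> bool -> V -> V -> U) x :
  is_super p -> is_coderivation p δ d -> (forall b c, bilin (F b c)) ->
  sweedler p p (δ (d x)) F = sweedler p p (δ x) (fun b c u v =>
    F (~~ b) c (d u) v + (-1) ^+ b *: F b (~~ c) u (d v)).
Proof.
move=> sp cd bF; have lp := super_linear sp; have ld := cd_linear cd.
have lg := gsign_linear sp; have lF := linear_sweedler lp lp bF.
rewrite (cd_cop cd) (linD lF) -sweedlerD; congr (_ + _).
  rewrite (tmap_sweedler _ sp sp) // (lin_sweedler _ _ _ _ lF).
  apply: eq_sweedler => // b c u v hu hv.
  by rewrite (sweedler_pure sp sp bF (cd_odd cd hu) hv).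
rewrite (tmap_sweedler _ sp sp) // (lin_sweedler _ _ _ _ lF).
apply: eq_sweedler => // b c u v hu hv.
rewrite (gsign_hom sp hu) (linZ (bilin_l _ (tpure_bilin _ _))) (linZ lF).
by rewrite (sweedler_pure sp sp bF hu (cd_odd cd hv)).
Qed.

Section TensorDifferential.
Context {k : fieldType} {V W : lmodType k} {pV : bool -> V -> V} {pW : bool -> W -> W}.
Context {dV : V -> V} {dW : W -> W}.
Hypothesis sV : is_super pV.
Hypothesis sW : is_super pW.
Hypothesis ldV : linear dV.
Hypothesis ldW : linear dW.
Let lgV := gsign_linear sV.
Let p := tensor_parity pV pW.
Let sp : is_super p := tensor_super sV sW.
Let lp := super_linear sp.
Notation D := (tens_diff pV dV dW).

Lemma tens_diff_linear : linear D.
Proof. by rewrite /tens_diff; lin. Qed.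
Let lD := tens_diff_linear.

Lemma tens_diffE v w : D (v ⊗ w) = dV v ⊗ w + gsign pV v ⊗ dW w.
Proof. by rewrite /tens_diff tliftE //; lin. Qed.

Hypothesis dV_odd : forall b x, pV b x = x -> pV (~~ b) (dV x) = dV x.
Hypothesis dW_odd : forall b x, pW b x = x -> pW (~~ b) (dW x) = dW x.

Lemma tens_diff_odd b t : p b t = t -> p (~~ b) (D t) = D t.
Proof.
suff e : p (~~ b) (D (p b t)) = D (p b t) by move=> <-.
move: t; apply: (tensor_hext sV sW); [lin | lin | move=> b1 c1 v w hv hw].
rewrite /p (tensor_parity_pure _ sV sW hv hw) -/p.
case: eqP => [->|_]; last by rewrite (lin0 lD) (lin0 (lp _)).
rewrite tens_diffE (gsign_hom sV hv) (linZ (bilin_l _ (tpure_bilin _ _))).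
rewrite (linD (lp _)) (linZ (lp _)) /p.
rewrite (tensor_parity_pure _ sV sW (dV_odd hv) hw).
rewrite (tensor_parity_pure _ sV sW hv (dW_odd hw)).
by rewrite addNb addbN eqxx.
Qed.

Lemma tens_diff_diff : (forall v, dV (dV v) = 0) -> (forall w, dW (dW w) = 0) ->
  forall t, D (D t) = 0.
Proof.
move=> ddV ddW; apply: tensor_ext; [lin | exact: linear_zero | move=> v w].
rewrite tens_diffE (linD lD) !tens_diffE ddV ddW (gsign_odd _ sV ldV dV_odd).
rewrite (lin0 (bilin_l _ (tpure_bilin _ _))) (lin0 (bilin_r _ (tpure_bilin _ _))).
by rewrite (linN (bilin_l _ (tpure_bilin _ _))) add0r addr0 addNr.
Qed.

End TensorDifferential.

Section TensorCoderivation.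
Context {k : fieldType} {V W : lmodType k} {pV : bool -> V -> V} {pW : bool -> W -> W}
  {δV : V -> tensor V V} {δW : W -> tensor W W} {dV : V -> V} {dW : W -> W}.
Hypothesis scV : is_super_coalgebra pV δV.
Hypothesis scW : is_super_coalgebra pW δW.
Hypothesis cdV : is_coderivation pV δV dV.
Hypothesis cdW : is_coderivation pW δW dW.

(** The four terms of [Δ(d(v ⊗ w))] have [d] on [v1], [v2], [w1] or [w2]; each
    carries the sign of moving [d], an odd symbol, to its place. *)
Lemma tens_coderivation : is_coderivation (tensor_parity pV pW)
  (tens_cop pV pW δV δW) (tens_diff pV dV dW).
Proof.
have sV := sc_super scV; have sW := sc_super scW.
have lV := super_linear sV; have lW := super_linear sW.
have ldV := sc_linear scV; have ldW := sc_linear scW.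
have dlV := cd_linear cdV; have dlW := cd_linear cdW.
have sp := tensor_super sV sW.
have lD := tens_diff_linear sV dlV dlW; have lg := gsign_linear sp.
have lgV := gsign_linear sV.
have lΔ := tens_cop_linear scV scW.
have tl u : linear (fun t : tensor V W => t ⊗ u : tensor (tensor V W) (tensor V W)) by lin.
have tr u : linear (fun t : tensor V W => u ⊗ t : tensor (tensor V W) (tensor V W)) by lin.
split=> //; first by apply: (tens_diff_odd sV sW dlV dlW (cd_odd cdV) (cd_odd cdW)).
apply: (tensor_hext sV sW); [lin | lin | move=> b c v w hv hw].
rewrite (tens_diffE sV dlV dlW) (linD lΔ) (gsign_hom sV hv).
rewrite (linZ (bilin_l _ (tpure_bilin _ _))) (linZ lΔ).
rewrite (tmap_sweedler _ sp sp lD (@linear_id _ _)) (tmap_sweedler _ sp sp lg lD).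
rewrite !(sweedler_tens_cop scV scW); [|lin..].
rewrite !(tens_cop_pure scV scW) (sweedler_coderivation _ sV cdV); last by lin.
rewrite scaler_sweedler !sweedlerD.
apply: (sweedler_even scV hv) => [||b1 b2 v1 v2 eb h1 h2]; [lin | lin |].
rewrite (sweedler_coderivation _ sW cdW); last by lin.
rewrite !scaler_sweedler !sweedlerD.
apply: eq_sweedler => // c1 c2 w1 w2 g1 g2.
rewrite !(tens_diffE sV dlV dlW) (gsign_tensor _ _ sV sW).
rewrite (gsign_hom sV h1) (gsign_hom sV h2) (gsign_hom sW g1).
rewrite !(linD (tl _)) !(linD (tr _)).
rewrite !(linZ (bilin_l _ (tpure_bilin _ _))) !(linZ (bilin_r _ (tpure_bilin _ _))).
rewrite !(linZ (bilin_l _ (tpure_bilin _ _))) !scalerDr !scalerA -!exprD eb.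
rewrite [LHS]addrACA; congr (_ + _ + (_ + _)); signs.
Qed.

End TensorCoderivation.

(** With its sign carried by [gsign], the Leibniz rule is linear in [u] and need not
    be stated for homogeneous elements. *)
Lemma gsign_leibniz {k : fieldType} {U V W : lmodType k} {prU : nat -> U -> U}
    {f : U -> V -> W} {dU : U -> U} {dV : V -> V} {dW : W -> W} :
  is_grading prU -> bilin f -> linear dU -> linear dV -> linear dW ->
  (forall n u v, homog prU n u ->
     dW (f u v) = f (dU u) v + (-1) ^+ n *: f u (dV v)) ->
  forall u v, dW (f u v) = f (dU u) v + f (gsign (parity prU) u) (dV v).
Proof.
move=> gU bf lU lV lW h u v; have lg := gsign_linear (parity_super gU).
move: u; apply: (grading_ext gU); [lin | lin | move=> n u hu].
by rewrite (h n) // (gsign_homog gU hu) (linZ (bilin_l _ bf)).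
Qed.

Section DoubleCrossDifferential.
Context {k : fieldType} {A H : bialg k} {OA OH : dgbialg k} {iA : A -> OA} {iH : H -> OH}
  {Ra : OH -> OA -> OH} {La : OH -> OA -> OA}.
Hypothesis eA : is_exterior_algebra iA.
Hypothesis eH : is_exterior_algebra iH.
Hypothesis vA : is_bicovariant_coproduct iA.
Hypothesis vH : is_bicovariant_coproduct iH.
Hypothesis bA : is_super_bialgebra (par OA).
Hypothesis bH : is_super_bialgebra (par OH).
Hypothesis smp : is_super_matched_pair Ra La.

Notation pA := (par OA).
Notation pH := (par OH).
Notation E := (exchange Ra La).
Notation B := (super_double_cross_bialg Ra La).
Notation T := (tensor OA OH : lmodType k).
Notation C := (tensor OH OA : lmodType k).
Notation m := (@mul k B : T -> T -> T).
Notation DB := (tens_diff pA (@diff k OA) (@diff k OH)).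
Notation DC := (tens_diff pH (@diff k OH) (@diff k OA)).
Notation pB := (tensor_parity pA pH).
Notation pC := (tensor_parity pH pA).
Let gA := ext_grading eA.
Let gH := ext_grading eH.
Let sA := sbialgebra_super bA.
Let sH := sbialgebra_super bH.
Let cA := super_bialgebra_coalgebra bA.
Let cH := super_bialgebra_coalgebra bH.
Let aA := sbialgebra_alg bA.
Let aH := sbialgebra_alg bH.
Let bmA := mul_bilin aA.
Let bmH := mul_bilin aH.
Let bR := srmc_bilin (smp_right smp).
Let bL := slmc_bilin (smp_left smp).
Let lE : linear E := exchange_linear bA bH smp.
Let sl2 := sandwich_linear2 bA bH.
Let bm : bilin m := double_cross_mul_bilin bA bH smp.
Let sB : is_super pB := tensor_super sA sH.
Let sC : is_super pC := tensor_super sH sA.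
Let lgB := gsign_linear sB.
Let lgC := gsign_linear sC.
Let lDA := ext_diff_linear eA.
Let lDH := ext_diff_linear eH.

Let oddA b x : pA b x = x -> pA (~~ b) (diff x) = diff x.
Proof. exact: parity_degree1 gA lDA (ext_diff_homog eA). Qed.

Let oddH b x : pH b x = x -> pH (~~ b) (diff x) = diff x.
Proof. exact: parity_degree1 gH lDH (ext_diff_homog eH). Qed.

Let cdA : is_coderivation pA (@cop k OA) (@diff k OA).
Proof. by split=> //; exact: bicov_cop_diff vA. Qed.

Let cdH : is_coderivation pH (@cop k OH) (@diff k OH).
Proof. by split=> //; exact: bicov_cop_diff vH. Qed.

Let lDB : linear DB := tens_diff_linear sA lDA lDH.
Let lDC : linear DC := tens_diff_linear sH lDH lDA.
Let DBE := tens_diffE sA lDA lDH.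
Let DCE := tens_diffE sH lDH lDA.

Lemma double_cross_coderivation : is_coderivation pB (tens_cop pA pH cop cop) DB.
Proof. exact: tens_coderivation. Qed.

Lemma double_cross_diff_diff t : DB (DB t) = 0.
Proof.
by apply: (tens_diff_diff sA lDA lDH oddA); [exact: ext_diff_diff eA | exact: ext_diff_diff eH].
Qed.

Lemma double_cross_diff_homog n t : homog (tensor_pr (pr OA) (pr OH)) n t ->
  homog (tensor_pr (pr OA) (pr OH)) n.+1 (DB t).
Proof.
have gT := tensor_pr_grading gA gH; move: t; apply: homog_tensor_ind => //.
- by rewrite (lin0 lDB); exact: homog0.
- by move=> u v hu hv; rewrite (linD lDB); exact: homogD.
move=> i j v w <- hv hw; rewrite DBE; apply: homogD => //.
  by rewrite -addSn; apply: homog_tensor => //; apply: (ext_diff_homog eA).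
rewrite (gsign_homog gA hv) (linZ (bilin_l _ (tpure_bilin _ _))); apply: homogZ => //.
by rewrite -addnS; apply: homog_tensor => //; apply: (ext_diff_homog eH).
Qed.

Let lbA := gsign_leibniz gA bmA lDA lDA lDA (ext_leibniz eA).
Let lbH := gsign_leibniz gH bmH lDH lDH lDH (ext_leibniz eH).
Let lbL := gsign_leibniz gH bL lDH lDA lDA (smp_la_diff smp).
Let lbR := gsign_leibniz gH bR lDH lDA lDH (smp_ra_diff smp).

(** [E] is composed of the coproduct of [C], which commutes with the differential
    by [tens_coderivation], and of the actions, which do so by assumption. *)
Lemma exchange_diff c : E (DC c) = DB (E c).
Proof.
have cdC := tens_coderivation cH cA cdH cdA.
have llact := tlift_lin bL; have lract := tlift_lin bR.
have lld u : tlift La (DC u) = diff (tlift La u).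
  move: u; apply: tensor_ext; [lin | lin | move=> x w].
  by rewrite DCE (linD llact) !tliftE // lbL.
have lrd u : tlift Ra (DC u) = diff (tlift Ra u).
  move: u; apply: tensor_ext; [lin | lin | move=> x w].
  by rewrite DCE (linD lract) !tliftE // lbR.
rewrite /exchange (cd_cop cdC); move: (tens_cop _ _ _ _ c).
have lll := tmap_linear llact lract.
have l1 := tmap_linear lDC (@linear_id _ _).
have l2 := tmap_linear lgC lDC.
apply: (tensor_hext sC sC).
- by apply: (linear_comp lll); lin.
- by apply: (linear_comp lDB).
move=> b1 b2 u v hu hv.
rewrite !tmap_pure // DBE (linD lll) !tmap_pure // lld lrd.
congr (_ + _ ⊗ _); rewrite (gsign_hom sC hu) (linZ llact).
by rewrite (gsign_hom sA (lact_even gA gH bA bH smp hu)).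
Qed.

Lemma gsign_exchange c : gsign pB (E c) = E (gsign pC c).
Proof.
have gB := tensor_pr_grading gA gH; have gC := tensor_pr_grading gH gA.
move: c; apply: (tensor_grading_ext gH gA); [lin | lin | move=> i j x w hx hw].
have hc := homog_tensor gH gA hx hw.
have hE := exchange_homog gA gH (bicov_homog vA) (bicov_homog vH) bA bH smp hc.
by rewrite !tensor_parityE // (gsign_homog gB hE) (gsign_homog gC hc) (linZ lE).
Qed.

Lemma sandwich_diff w t y : DB (sandwich w t y) =
  sandwich (diff w) t y + sandwich (gsign pA w) (DB t) y +
  sandwich (gsign pA w) (gsign pB t) (diff y).
Proof.
move: t; apply: tensor_ext; [lin | lin | move=> a h].
rewrite (sandwich_pure bA bH) !DBE (gsign_tensor _ _ sA sH) (linD (sl2 _ _)).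
rewrite !(sandwich_pure bA bH) lbA lbH.
have -> : gsign pA (mul w a) = mul (gsign pA w) (gsign pA a).
  by apply: gsign_bilin => //; exact: (sbialgebra_mul_even bA).
rewrite (linD (bilin_l _ (tpure_bilin _ _))) (linD (bilin_r _ (tpure_bilin _ _))).
by rewrite !addrA.
Qed.

(** The three factors of [w · E(x ⊗ z) · y] obey the Leibniz rule by
    [sandwich_diff]; [exchange_diff] splits the middle term. *)
Lemma double_cross_leibniz s t : DB (m s t) = m (DB s) t + m (gsign pB s) (DB t).
Proof.
move: s; apply: tensor_ext; [lin | lin | move=> w x].
move: t; apply: tensor_ext; [lin | lin | move=> z y].
rewrite (double_cross_mulE bA bH smp) sandwich_diff -exchange_diff gsign_exchange.
rewrite DCE !DBE !(gsign_tensor _ _ sA sH) (gsign_tensor _ _ sH sA).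
rewrite (linD (bilin_l _ bm)) (linD (bilin_r _ bm)) !(double_cross_mulE bA bH smp).
by rewrite (linD lE) (linD (sl2 _ _)) !addrA.
Qed.

End DoubleCrossDifferential.

(** * The exterior algebra axioms *)

Section DegreeZero.
Context {k : fieldType} {A : bialg k} {O : dgbialg k} {iota : A -> O}.
Hypothesis eO : is_exterior_algebra iota.
Let g := ext_grading eO.

Lemma iota_homog a : homog (pr O) 0 (iota a).
Proof. by apply/(ext_iota_deg0 eO); exists a. Qed.

Lemma iota_even a : par O false (iota a) = iota a.
Proof. exact: homog_parity g (iota_homog a). Qed.

(** Projection to degree zero is a linear retraction of [iota]; it makes
    injectivity pass to tensor products. *)
Lemma iota_retraction : exists2 r : O -> A, linear r & cancel iota r.
Proof.
have ex x : {a | pr O 0 x = iota a}.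
  by apply: cid; apply/(ext_iota_deg0 eO); apply: homogP.
have inj := ext_iota_inj eO; have li := ext_iota_linear eO.
exists (fun x => sval (ex x)) => [c x y|a]; apply: inj.
  by rewrite li -!(svalP (ex _)) (grading_linear g).
by rewrite -(svalP (ex _)); apply: iota_homog.
Qed.

Lemma sweedler_iota (U : lmodType k) (F : bool -> bool -> O -> O -> U) t :
  (forall b c, bilin (F b c)) ->
  sweedler (par O) (par O) (tmap iota iota t) F =
  tlift (fun a b => F false false (iota a) (iota b)) t.
Proof.
move=> bF; have sO := parity_super g; have lO := super_linear sO.
have li := ext_iota_linear eO.
move: t; apply: tensor_ext; [lin | lin | move=> a b].
rewrite tmap_pure // (sweedler_pure sO sO bF (iota_even a) (iota_even b)).
by rewrite tliftE //; lin.
Qed.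

Lemma diff_one : diff (one O) = 0.
Proof.
have aO := ext_alg eO; have := ext_leibniz eO (one O) (ext_homog_one eO).
rewrite (mul_onel aO) (mul_oner aO) scale1r (mul_onel aO) => /eqP.
by rewrite -{1}[diff _]addr0 (inj_eq (addrI _)) eq_sym => /eqP.
Qed.

End DegreeZero.

Lemma tmap_cancel {k : fieldType} {V W V' W' : lmodType k} (f : V -> V') (g : W -> W')
    (r : V' -> V) (s : W' -> W) :
  linear f -> linear g -> linear r -> linear s -> cancel f r -> cancel g s ->
  cancel (tmap f g) (tmap r s).
Proof.
move=> lf lg lr ls fr gs.
have l1 := tmap_linear lf lg; have l2 := tmap_linear lr ls.
apply: tensor_ext; [lin | lin | move=> v w].
by rewrite !tmap_pure // fr gs.
Qed.

Section DoubleCrossExterior.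
Context {k : fieldType} {A H : bialg k} {ra : H -> A -> H} {la : H -> A -> A}
  {OA OH : dgbialg k} {iA : A -> OA} {iH : H -> OH}
  {Ra : OH -> OA -> OH} {La : OH -> OA -> OA}.
Hypothesis mp : is_matched_pair ra la.
Hypothesis Ra_extends : forall h a, Ra (iH h) (iA a) = iH (ra h a).
Hypothesis La_extends : forall h a, La (iH h) (iA a) = iA (la h a).
Hypothesis bialgA : is_bialgebra A.
Hypothesis bialgH : is_bialgebra H.
Hypothesis eA : is_exterior_algebra iA.
Hypothesis eH : is_exterior_algebra iH.
Hypothesis vA : is_bicovariant_coproduct iA.
Hypothesis vH : is_bicovariant_coproduct iH.
Hypothesis bA : is_super_bialgebra (par OA).
Hypothesis bH : is_super_bialgebra (par OH).
Hypothesis smp : is_super_matched_pair Ra La.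

Notation pA := (par OA).
Notation pH := (par OH).
Notation E := (exchange Ra La).
Notation O := (super_double_cross Ra La).
Notation T := (tensor OA OH : lmodType k).
Notation T0 := (tensor A H : lmodType k).
Notation m := (@mul k (super_double_cross_bialg Ra La) : T -> T -> T).
Notation m0 := (@mul k (double_cross ra la) : T0 -> T0 -> T0).
Notation DB := (tens_diff pA (@diff k OA) (@diff k OH)).
Notation pB := (tensor_parity pA pH).
Notation prB := (tensor_pr (pr OA) (pr OH)).
Notation ι := (tmap iA iH : T0 -> T).
Let gA := ext_grading eA.
Let gH := ext_grading eH.
Let gB : is_grading prB := tensor_pr_grading gA gH.
Let sA := sbialgebra_super bA.
Let sH := sbialgebra_super bH.
Let cA := super_bialgebra_coalgebra bA.
Let cH := super_bialgebra_coalgebra bH.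
Let ldA := sc_linear cA.
Let ldH := sc_linear cH.
Let aA := sbialgebra_alg bA.
Let aH := sbialgebra_alg bH.
Let bR := srmc_bilin (smp_right smp).
Let bL := slmc_bilin (smp_left smp).
Let sl2 := sandwich_linear2 bA bH.
Let bm : bilin m := double_cross_mul_bilin bA bH smp.
Let lDA := ext_diff_linear eA.
Let lDH := ext_diff_linear eH.
Let lDB : linear DB := tens_diff_linear sA lDA lDH.
Let DBE := tens_diffE sA lDA lDH.
Let liA := ext_iota_linear eA.
Let liH := ext_iota_linear eH.
Let lι : linear ι := tmap_linear liA liH.
Let bm0A := mul_bilin (bialgebra_alg bialgA).
Let bm0H := mul_bilin (bialgebra_alg bialgH).
Let bra := rmc_bilin (mp_right mp).
Let bla := lmc_bilin (mp_left mp).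
Let lcA := cop_linear (bialgebra_coalg bialgA).
Let lcH := cop_linear (bialgebra_coalg bialgH).

Let ιE a h : ι (a ⊗ h) = iA a ⊗ iH h.
Proof. by rewrite tmap_pure. Qed.

Lemma double_cross0_mul_bilin : bilin m0.
Proof. by rewrite /=; lin. Qed.
Let bm0 := double_cross0_mul_bilin.

(** In degree zero all parities are even, and the super product loses its signs. *)
Lemma double_cross_iota_mul s t : ι (m0 s t) = m (ι s) (ι t).
Proof.
move: s; apply: tensor_ext; [lin | lin | move=> a h].
move: t; apply: tensor_ext; [lin | lin | move=> b g].
rewrite !ιE (double_cross_mulE bA bH smp) (exchangeE bA bH smp) /=.
rewrite tliftE; last by lin.
rewrite tliftE; last by lin.
rewrite (lin_tlift _ _ lι) (lin_sweedler _ _ _ _ (sl2 _ _)) (bicov_cop_iota vH).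
rewrite (sweedler_iota eH); last by lin.
apply: eq_tlift => h1 h2; rewrite (lin_tlift _ _ lι) (lin_sweedler _ _ _ _ (sl2 _ _)).
rewrite (bicov_cop_iota vA) (sweedler_iota eA); last by lin.
apply: eq_tlift => b1 b2.
rewrite scale1r (sandwich_pure bA bH) ιE La_extends Ra_extends.
by rewrite (ext_iota_mul eA) (ext_iota_mul eH).
Qed.

Lemma double_cross_iota_cop t : tens_cop pA pH cop cop (ι t) =
  tmap ι ι (@cop k (double_cross ra la) t).
Proof.
have lΔ := tens_cop_linear cA cH.
have lιι := tmap_linear lι lι.
have lc0 : linear (@cop k (double_cross ra la) : T0 -> tensor T0 T0) by rewrite /=; lin.
move: t; apply: tensor_ext.
- by lin.
- exact: (linear_comp lιι lc0).
move=> a h; rewrite ιE (tens_cop_pure cA cH) (bicov_cop_iota vA) (sweedler_iota eA); last by lin.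
rewrite /= tliftE; last by lin.
rewrite (lin_tlift _ _ lιι); apply: eq_tlift => a1 a2.
rewrite (bicov_cop_iota vH) (sweedler_iota eH); last by lin.
rewrite (lin_tlift _ _ lιι); apply: eq_tlift => h1 h2.
by rewrite scale1r tmap_pure // !ιE.
Qed.

Lemma double_cross_iota_eps t : tens_eps (@eps k OA) (@eps k OH) (ι t) =
  @eps k (double_cross ra la) t.
Proof.
have leA := eps_linear (sbialgebra_coalg bA).
have leH := eps_linear (sbialgebra_coalg bH).
have b1 := tens_eps_bilin leA leH.
have b0 := tens_eps_bilin (eps_linear (bialgebra_coalg bialgA))
  (eps_linear (bialgebra_coalg bialgH)).
rewrite /tens_eps /= (tlift_tmap iA iH _ b1); apply: (@eq_tlift k A H k^o) => a h.
by rewrite (bicov_eps_iota vA) (bicov_eps_iota vH).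
Qed.

Lemma double_cross_iota_retraction : exists2 r : T -> T0, linear r & cancel ι r.
Proof.
have [r lr ir] := iota_retraction eA; have [s ls is_] := iota_retraction eH.
by exists (tmap r s); [exact: tmap_linear | exact: tmap_cancel].
Qed.

Lemma double_cross_iota_homog t : homog prB 0 (ι t).
Proof.
move: t; apply: tensor_ind => [|x y hx hy|a h].
- by rewrite (lin0 lι); exact: homog0.
- by rewrite (linD lι); exact: homogD.
by rewrite ιE; apply: (homog_tensor gA gH (iota_homog eA a) (iota_homog eH h)).
Qed.

Lemma double_cross_deg0 x : homog prB 0 x <-> exists t, x = ι t.
Proof.
split=> [|[t ->]]; last exact: double_cross_iota_homog.
move: x; apply: homog_tensor_ind => //.
- by exists 0; rewrite (lin0 lι).
- by move=> x y [s ->] [t ->]; exists (s + t); rewrite (linD lι).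
move=> [] // [] // v w _ /(ext_iota_deg0 eA)[a ->] /(ext_iota_deg0 eH)[h ->].
by exists (a ⊗ h); rewrite ιE.
Qed.

Lemma double_cross_mul_i w z y : m (w ⊗ one OH) (z ⊗ y) = mul w z ⊗ y.
Proof.
rewrite (double_cross_mulE bA bH smp) (exchange_onel bA bH smp) (sandwich_pure bA bH).
by rewrite (mul_onel aH).
Qed.

Lemma double_cross_mul_j w x y : m (w ⊗ x) (one OA ⊗ y) = w ⊗ mul x y.
Proof.
rewrite (double_cross_mulE bA bH smp) (exchange_oner bA bH smp) (sandwich_pure bA bH).
by rewrite (mul_oner aA).
Qed.

Let gsign_iA a : gsign pA (iA a) = iA a.
Proof. by rewrite (gsign_homog gA (iota_homog eA a)) scale1r. Qed.

Let DBι a h : DB (ι (a ⊗ h)) = diff (iA a) ⊗ iH h + iA a ⊗ diff (iH h).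
Proof. by rewrite ιE DBE gsign_iA. Qed.

Let DBι1 h : DB (ι (one A ⊗ h)) = one OA ⊗ diff (iH h).
Proof.
by rewrite DBι (ext_iota_one eA) (diff_one eA) (lin0 (bilin_l _ (tpure_bilin _ _))) add0r.
Qed.

(** A one-form is a sum of [a db ⊗ h] and [a ⊗ h dg]. The latter is
    [(a ⊗ h) d(1 ⊗ g)]; the former needs a correction by a term of the same kind. *)
Lemma double_cross_deg1 x : homog prB 1 x <->
  exists s : seq (T0 * T0), x = \sum_(y <- s) m (ι y.1) (DB (ι y.2)).
Proof.
split=> [|[s ->]]; last first.
  apply: homog_sum => // y; rewrite -[1%N]add0n.
  apply: (double_cross_mul_homog gA gH (ext_homog_mul eA) (ext_homog_mul eH)
    (bicov_homog vA) (bicov_homog vH) bA bH smp); first exact: double_cross_iota_homog.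
  by apply: (double_cross_diff_homog eA eH bA); exact: double_cross_iota_homog.
pose Q x := exists s : seq (T0 * T0), x = \sum_(y <- s) m (ι y.1) (DB (ι y.2)).
have Q0 : Q 0 by exists [::]; rewrite big_nil.
have QD u v : Q u -> Q v -> Q (u + v).
  by move=> [s ->] [t ->]; exists (s ++ t); rewrite big_cat.
have Q1 s t : Q (m (ι s) (DB (ι t))) by exists [:: (s, t)]; rewrite big_seq1.
have QN s t : Q (- m (ι s) (DB (ι t))).
  by rewrite -(linN (bilin_l _ bm)) -(linN lι); exact: Q1.
have Qsum I (r : seq I) F : (forall i, Q (F i)) -> Q (\sum_(i <- r) F i).
  by move=> QF; apply: (big_ind Q).
have QH a h g : Q (iA a ⊗ mul (iH h) (diff (iH g))).
  by rewrite -double_cross_mul_j -DBι1 -ιE.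
move: x; apply: (homog_tensor_ind gA gH Q0 QD) => -[|[|i]] [|[|j]] //= v w _.
  move=> /(ext_iota_deg0 eA)[a ->] /(ext_deg1 eH)[s ->].
  by rewrite (lin_sum (bilin_r _ (tpure_bilin _ _))); apply: Qsum.
move=> /(ext_deg1 eA)[s ->] /(ext_iota_deg0 eH)[h ->].
rewrite (lin_sum (bilin_l _ (tpure_bilin _ _))); apply: Qsum => -[a b] /=.
(* The exact form [d(b ⊗ h)] mixes both differentials; subtracting its part
   in the second factor isolates [db ⊗ h]. *)
have -> : mul (iA a) (diff (iA b)) ⊗ iH h =
    m (ι (a ⊗ one H)) (DB (ι (b ⊗ h))) - iA (mul a b) ⊗ mul (iH (one H)) (diff (iH h)).
  rewrite DBι ιE (ext_iota_one eH) (linD (bilin_r _ bm)) !double_cross_mul_i.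
  by rewrite (mul_onel aH) (ext_iota_mul eA) addrK.
apply: QD; first exact: Q1.
by rewrite -double_cross_mul_j -DBι1 -ιE.
Qed.

(** [w ⊗ x] is the product of [w ⊗ 1] and [1 ⊗ x]. *)
Lemma double_cross_generated x :
  generated (A := super_double_cross_bialg Ra La)
    (fun y => homog prB 0 y \/ homog prB 1 y) x.
Proof.
move: x; apply: tensor_ind => [|x y|w x].
- exact: generated_zero.
- exact: generated_add.
rewrite -(double_cross_mul_ij bA bH smp); apply: generated_mul.
- elim: (ext_generated eA w) => {w} [w hw|||u v _ hu _ hv|a u _ hu|u v _ hu _ hv].
  + apply: generated_base; have h1 := ext_homog_one eH.
    by case: hw => hw; [left | right]; exact: (homog_tensor gA gH hw h1).
  + by rewrite (lin0 (bilin_l _ (tpure_bilin _ _))); exact: generated_zero.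
  + exact: (@generated_one _ (super_double_cross_bialg Ra La)).
  + by rewrite (linD (bilin_l _ (tpure_bilin _ _))); apply: generated_add.
  + by rewrite (linZ (bilin_l _ (tpure_bilin _ _))); apply: generated_scale.
  + by rewrite -(double_cross_mul_ii bA bH smp); apply: generated_mul.
- elim: (ext_generated eH x) => {x} [x hx|||u v _ hu _ hv|a u _ hu|u v _ hu _ hv].
  + apply: generated_base; have h1 := ext_homog_one eA.
    by case: hx => hx; [left | right]; exact: (homog_tensor gA gH h1 hx).
  + by rewrite (lin0 (bilin_r _ (tpure_bilin _ _))); exact: generated_zero.
  + exact: (@generated_one _ (super_double_cross_bialg Ra La)).
  + by rewrite (linD (bilin_r _ (tpure_bilin _ _))); apply: generated_add.
  + by rewrite (linZ (bilin_r _ (tpure_bilin _ _))); apply: generated_scale.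
  + by rewrite -(double_cross_mul_jj bA bH smp); apply: generated_mul.
Qed.

Let parB : pB = parity prB := tensor_parityE gA gH.

Lemma double_cross_exterior : @is_exterior_algebra k (double_cross ra la) O ι.
Proof.
have [r lr ir] := double_cross_iota_retraction.
split.
- exact: gB.
- exact: (double_cross_algebra gA gH bA bH smp).
- exact: (homog_tensor gA gH (ext_homog_one eA) (ext_homog_one eH)).
- move=> i j; exact: (double_cross_mul_homog gA gH (ext_homog_mul eA) (ext_homog_mul eH)
    (bicov_homog vA) (bicov_homog vH) bA bH smp).
- exact: lι.
- exact: can_inj ir.
- exact: double_cross_deg0.
- by rewrite ιE (ext_iota_one eA) (ext_iota_one eH).
- exact: double_cross_iota_mul.
- exact: lDB.
- exact: (double_cross_diff_homog eA eH bA).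
- exact: (double_cross_diff_diff eA eH bA).
- move=> n x y hx.
  have := double_cross_leibniz eA eH vA vH bA bH smp x y.
  rewrite parB (gsign_homog gB hx) (linZ (bilin_l _ bm)).
  exact.
- exact: double_cross_deg1.
- exact: double_cross_generated.
Qed.

Lemma double_cross_bicovariant : @is_bicovariant_coproduct k (double_cross ra la) O ι.
Proof.
split.
- move=> n x; exact: (tens_cop_homog gA gH ldA ldH (bicov_homog vA) (bicov_homog vH)).
- exact: double_cross_iota_cop.
- exact: double_cross_iota_eps.
- have leA := eps_linear (sbialgebra_coalg bA).
  have leH := eps_linear (sbialgebra_coalg bH).
  have le := tens_eps_scalar leA leH.
  move=> n; apply: homog_tensor_ind => //.
  + exact: (lin0 (V := k^o) le).
  + move=> x y hx hy; rewrite -[x]scale1r [LHS]le mul1r -[RHS]addr0.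
    by congr (_ + _).
  move=> i j v w e hv hw; rewrite [LHS](tens_epsE leA leH).
  case: i hv e => [|i] hv e; last by rewrite (bicov_eps_homog vA hv) mul0r.
  by move: hw; rewrite -[j]add0n e => hw; rewrite (bicov_eps_homog vH hw) mulr0.
- move=> x; have := cd_cop (double_cross_coderivation eA eH vA vH bA bH) x.
  rewrite parB; exact.
Qed.

Lemma double_cross_par_super_bialgebra : is_super_bialgebra (par O).
Proof.
have := double_cross_super_bialgebra gA gH (ext_homog_mul eA) (ext_homog_mul eH)
  (bicov_homog vA) (bicov_homog vH) bA bH smp.
by rewrite parB.
Qed.

End DoubleCrossExterior.

(** * The double cross product in degree zero *)

(** All axioms are equations, in [A] or in its tensor powers, that hold after
    applying [i]; the retraction [r] makes the tensor powers of [i] injective as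
    well. Even elements commute without signs. *)
Lemma even_sub_bialgebra {k : fieldType} {A B : bialg k} {p : bool -> B -> B}
    {i : A -> B} {r : B -> A} :
  is_super_bialgebra p -> linear i -> linear r -> cancel i r ->
  (forall a, p false (i a) = i a) -> i (one A) = one B ->
  (forall a b, i (mul a b) = mul (i a) (i b)) ->
  (forall a, cop (i a) = tmap i i (cop a)) -> (forall a, eps (i a) = eps a) ->
  is_bialgebra A.
Proof.
move=> bB li lr ir i_even i1 iM iΔ iε.
have inj := can_inj ir; have aB := sbialgebra_alg bB; have cB := sbialgebra_coalg bB.
have sB := sbialgebra_super bB; have lB := super_linear sB.
have bmB := mul_bilin aB.
have lΔB := cop_linear cB; have lεB := eps_linear cB.
have inj2 := can_inj (tmap_cancel li li lr lr ir ir).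
have lii := tmap_linear li li; have lrr := tmap_linear lr lr.
have inj3 := can_inj (tmap_cancel li lii lr lrr ir (tmap_cancel li li lr lr ir ir)).
have bm : bilin (@mul k A).
  by split=> [u|u] a x y; apply: inj; rewrite li !iM li ?(bilin_l _ bmB) ?(bilin_r _ bmB).
have lΔ : linear (@cop k A) by move=> a x y; apply: inj2; rewrite lii -!iΔ li lΔB.
have lε : scalar (@eps k A) by move=> a x y; rewrite -!iε li lεB.
split.
- split=> //.
  + by move=> x y z; apply: inj; rewrite !iM (mul_assoc aB).
  + by move=> x; apply: inj; rewrite iM i1 (mul_onel aB).
  + by move=> x; apply: inj; rewrite iM i1 (mul_oner aB).
- split=> //.
  + move=> x; apply: inj3.
    transitivity (tassoc (tmap cop id (cop (i x)))); last first.
      rewrite (cop_assoc cB) iΔ; move: (cop x).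
      have l1 := tmap_linear (@linear_id _ A) lΔ.
      have l2 := tmap_linear (@linear_id _ B) lΔB.
      apply: tensor_ext; [lin | lin | move=> a b].
      by rewrite !tmap_pure // iΔ.
    rewrite iΔ; move: (cop x).
    have l1 := tmap_linear lΔ (@linear_id _ A).
    have l2 := tmap_linear lΔB (@linear_id _ B).
    have l3 := tmap_linear li lii.
    apply: tensor_ext; [lin | lin | move=> a b].
    rewrite !tmap_pure // iΔ; move: (cop a).
    apply: tensor_ext; [lin | lin | move=> a1 a2].
    by rewrite tassoc_pure !tmap_pure // tassoc_pure.
  + move=> x; apply: inj; rewrite -[RHS](cop_counitl cB) iΔ (lin_tlift _ _ li).
    rewrite tlift_tmap; last by lin.
    by apply: eq_tlift => a b; rewrite (linZ li) iε.
  + move=> x; apply: inj; rewrite -[RHS](cop_counitr cB) iΔ (lin_tlift _ _ li).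
    rewrite tlift_tmap; last by lin.
    by apply: eq_tlift => a b; rewrite (linZ li) iε.
- move=> x y; apply: inj2; rewrite -iΔ iM (sbialgebra_cop_mul bB) !iΔ.
  rewrite /super_tensor_mul /tensor_mul tlift_tmap; last by lin.
  rewrite (lin_tlift _ _ lii); apply: eq_tlift => a b.
  rewrite tlift_tmap; last by lin.
  rewrite (lin_tlift _ _ lii); apply: eq_tlift => c d.
  rewrite (sweedler_pure sB sB _ (i_even b) (i_even c)); last by lin.
  by rewrite scale1r tmap_pure // !iM.
- by apply: inj2; rewrite -iΔ tmap_pure // i1 (sbialgebra_cop_one bB).
- by move=> x y; rewrite -!iε iM (sbialgebra_eps_mul bB).
- by rewrite -iε i1 (sbialgebra_eps_one bB).
Qed.

(** * Antipodes *)

(** The antipode reverses the factorisation [t = i(w) j(x)]: it is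
    [S t = ± j(S x) i(S w)]. *)
Section FactorisedAntipode.
Context {k : fieldType} {A H : bialg k} {pA : bool -> A -> A} {pH : bool -> H -> H}
  {SA : A -> A} {SH : H -> H}.
Notation T := (tensor A H : lmodType k).
Context {m : T -> T -> T}.
Hypothesis cA : is_super_coalgebra pA (@cop k A).
Hypothesis cH : is_super_coalgebra pH (@cop k H).
Hypothesis eA0 : forall w : A, eps (pA true w) = 0.
Hypothesis eH0 : forall x : H, eps (pH true x) = 0.
Hypothesis bmA : bilin (@mul k A).
Hypothesis bmH : bilin (@mul k H).
Hypothesis hSA : is_antipode SA.
Hypothesis hSH : is_antipode SH.
Hypothesis bm : bilin m.
Hypothesis mA : forall s t u, m s (m t u) = m (m s t) u.
Hypothesis m1t : forall t, m (one A ⊗ one H) t = t.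
Hypothesis mt1 : forall t, m t (one A ⊗ one H) = t.
Hypothesis mij : forall w x, m (w ⊗ one H) (one A ⊗ x) = w ⊗ x.
Hypothesis mii : forall w z, m (w ⊗ one H) (z ⊗ one H) = mul w z ⊗ one H.
Hypothesis mjj : forall x y, m (one A ⊗ x) (one A ⊗ y) = one A ⊗ mul x y.
Let sA := sc_super cA.
Let sH := sc_super cH.
Let lA := super_linear sA.
Let lH := super_linear sH.
Let lSA := antipode_linear hSA.
Let lSH := antipode_linear hSH.
Let i (w : A) : T := w ⊗ one H.
Let j (x : H) : T := one A ⊗ x.
Let li : linear i. Proof. by rewrite /i; lin. Qed.
Let lj : linear j. Proof. by rewrite /j; lin. Qed.

Definition factorised_antipode (t : T) : T :=
  sweedler pA pH t (fun b c w x => (-1) ^+ (b * c) *: m (j (SH x)) (i (SA w))).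
Notation S := factorised_antipode.

Lemma factorised_antipode_linear : linear S.
Proof. by rewrite /factorised_antipode; lin. Qed.
Let lS := factorised_antipode_linear.

Lemma factorised_antipodeE b c w x : pA b w = w -> pH c x = x ->
  S (w ⊗ x) = (-1) ^+ (b * c) *: m (j (SH x)) (i (SA w)).
Proof.
by move=> hw hx; rewrite /factorised_antipode (sweedler_pure sA sH _ hw hx) //; lin.
Qed.

Notation Δ := (tens_cop pA pH (@cop k A) (@cop k H)).
Notation ε := (tens_eps (@eps k A) (@eps k H)).
Hypothesis leA : scalar (@eps k A).
Hypothesis leH : scalar (@eps k H).
Let lΔ : linear Δ := tens_cop_linear cA cH.
Let lε : scalar ε := tens_eps_scalar leA leH.

(** In [S(w1 ⊗ x1) (w2 ⊗ x2) = ± S(x1) S(w1) w2 x2] the sign depends on [w1] and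
    [w2] only through the parity of [w], so [S(w1) w2] collapses first; it vanishes
    unless [w] is even. *)
Lemma factorised_antipode_left t :
  tlift (fun y z => m (S y) z) (Δ t) = ε t *: (one A ⊗ one H).
Proof.
have bl : bilin (fun y z => m (S y) z) by lin.
have ll := tlift_lin bl.
move: t; apply: (tensor_hext sA sH); [lin | lin | move=> b c w x hw hx].
rewrite (tens_cop_pure cA cH) (lin_sweedler _ _ _ _ ll).
pose K (b c1 : bool) (w1 w2 : A) (x1 x2 : H) : T :=
  (-1) ^+ (b * c1) *: m (j (SH x1)) (m (i (mul (SA w1) w2)) (j x2)).
transitivity (sweedler pA pA (cop w) (fun b1 b2 w1 w2 =>
    sweedler pH pH (cop x) (fun c1 c2 x1 x2 => K b c1 w1 w2 x1 x2))).
  apply: (sweedler_even cA hw) => [||b1 b2 w1 w2 -> h1 h2]; rewrite /K; [lin | lin |].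
  rewrite (lin_sweedler _ _ _ _ ll); apply: eq_sweedler => // c1 c2 x1 x2 g1 g2.
  rewrite (linZ ll) tliftE // (factorised_antipodeE h1 g1) (linZ (bilin_l _ bm)).
  by rewrite -/(i w2) -mij /i -mii -!mA; signs.
rewrite exchange_sweedler.
transitivity (tlift (fun x1 x2 => eps w *: j (mul (SH x1) x2)) (cop x)).
  rewrite -(sweedler_tlift _ sH sH); last by lin.
  apply: eq_sweedler => // c1 c2 x1 x2 _ _; rewrite /K.
  pose L (u : A) : T := (-1) ^+ (b * c1) *: m (j (SH x1)) (m (i u) (j x2)).
  have lL : linear L by rewrite /L; lin.
  rewrite (sweedler_tlift (f := fun w1 w2 => L (mul (SA w1) w2)) _ sA sA); last by lin.
  rewrite -(lin_tlift _ _ lL) (antipode_left hSA) (linZ lL) {lL}/L {L}.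
  rewrite m1t mjj; case: b hw => [<-|_]; last by rewrite scale1r.
  by rewrite eA0 !scale0r.
have lK : linear (fun h => eps w *: j h) by lin.
rewrite -(lin_tlift _ _ lK) (antipode_left hSH) (linZ lj) scalerA.
by rewrite (tens_epsE leA leH).
Qed.

(** Here [x1 S(x2)], in the middle of [w1 x1 S(x2) S(w2)], collapses first. *)
Lemma factorised_antipode_right t :
  tlift (fun y z => m y (S z)) (Δ t) = ε t *: (one A ⊗ one H).
Proof.
have bl : bilin (fun y z => m y (S z)) by lin.
have ll := tlift_lin bl.
move: t; apply: (tensor_hext sA sH); [lin | lin | move=> b c w x hw hx].
rewrite (tens_cop_pure cA cH) (lin_sweedler _ _ _ _ ll).
pose K (b2 c : bool) (w1 w2 : A) (x1 x2 : H) : T :=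
  (-1) ^+ (b2 * c) *: m (m (i w1) (j (mul x1 (SH x2)))) (i (SA w2)).
transitivity (sweedler pA pA (cop w) (fun b1 b2 w1 w2 =>
    sweedler pH pH (cop x) (fun c1 c2 x1 x2 => K b2 c w1 w2 x1 x2))).
  apply: eq_sweedler => // b1 b2 w1 w2 h1 h2; rewrite (lin_sweedler _ _ _ _ ll).
  apply: (sweedler_even cH hx) => [||c1 c2 x1 x2 -> g1 g2]; rewrite /K; [lin | lin |].
  rewrite (linZ ll) tliftE // (factorised_antipodeE h2 g2) (linZ (bilin_r _ bm)).
  by rewrite -(mij w1 x1) /j -mjj -!mA; signs.
transitivity (tlift (fun w1 w2 => eps x *: i (mul w1 (SA w2))) (cop w)).
  rewrite -(sweedler_tlift _ sA sA); last by lin.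
  apply: eq_sweedler => // b1 b2 w1 w2 _ _; rewrite /K.
  pose L (u : H) : T := (-1) ^+ (b2 * c) *: m (m (i w1) (j u)) (i (SA w2)).
  have lL : linear L by rewrite /L; lin.
  rewrite (sweedler_tlift (f := fun x1 x2 => L (mul x1 (SH x2))) _ sH sH); last by lin.
  rewrite -(lin_tlift _ _ lL) (antipode_right hSH) (linZ lL) {lL}/L {L}.
  rewrite mt1 mii; case: c hx => [<-|_]; last by rewrite muln0 scale1r.
  by rewrite eH0 !scale0r.
have lK : linear (fun h => eps x *: i h) by lin.
rewrite -(lin_tlift _ _ lK) (antipode_right hSA) (linZ li) scalerA mulrC.
by rewrite (tens_epsE leA leH).
Qed.

Hypothesis SA_even : forall b w, SA (pA b w) = pA b (SA w).
Hypothesis SH_even : forall b x, SH (pH b x) = pH b (SH x).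
Notation pB := (tensor_parity pA pH).
Hypothesis i1_even : pA false (one A) = one A.
Hypothesis j1_even : pH false (one H) = one H.
Hypothesis m_even : forall b c s t, pB b s = s -> pB c t = t ->
  pB (b (+) c) (m s t) = m s t.

Lemma factorised_antipode_even b t : S (pB b t) = pB b (S t).
Proof.
have sB := tensor_super sA sH; have lB := super_linear sB.
move: t; apply: (tensor_hext sA sH); [lin | lin | move=> b1 c1 w x hw hx].
rewrite (tensor_parity_pure _ sA sH hw hx) (factorised_antipodeE hw hx) (linZ (lB _)).
have hi : pB b1 (i (SA w)) = i (SA w).
  by rewrite -{1}(addbF b1); apply: (tensor_hom cA cH) => //; rewrite -SA_even hw.
have hj : pB c1 (j (SH x)) = j (SH x).
  by apply: (tensor_hom cA cH (b := false)) => //; rewrite -SH_even hx.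
rewrite (super_homE b sB (m_even hj hi)) addbC.
by case: eqP => _; rewrite ?(factorised_antipodeE hw hx) // (lin0 lS) scaler0.
Qed.

End FactorisedAntipode.
Arguments factorised_antipode {k A H} pA pH SA SH m t.

Definition even_parity {k : fieldType} {V : lmodType k} (b : bool) (v : V) : V :=
  if b then 0 else v.

Section PurelyEven.
Context {k : fieldType}.
Implicit Types V W U : lmodType k.

Lemma even_parity_super V : is_super (@even_parity k V).
Proof.
split=> [[]|[] []|x] //=; rewrite /even_parity ?addr0 //.
exact: linear_zero.
Qed.

Lemma sweedler_even_parity V W U (F : bool -> bool -> V -> W -> U) t :
  (forall b c, bilin (F b c)) ->
  sweedler even_parity even_parity t F = tlift (F false false) t.
Proof.
move=> bF; have sV := even_parity_super V; have sW := even_parity_super W.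
have lV := super_linear sV; have lW := super_linear sW.
move: t; apply: tensor_ext; [lin | lin | move=> v w].
by rewrite (sweedler_pure sV sW bF (b := false) (c := false)) // tliftE.
Qed.

Lemma even_parity_coalgebra (A : bialg k) : is_coalgebra A ->
  is_super_coalgebra even_parity (@cop k A).
Proof.
move=> cA; have sA := even_parity_super A; have ldA := cop_linear cA.
split=> //; first exact: cop_assoc cA.
move=> [] x /= hx; first by rewrite -hx (lin0 ldA) (lin0 (super_linear (tensor_super sA sA) _)).
move: (cop x); apply: tensor_ext; [| lin |].
  exact: (super_linear (tensor_super sA sA)).
by move=> a b; rewrite (tensor_parity_pure _ sA sA (b := false) (c := false)).
Qed.

End PurelyEven.

(** * Strongly bicovariant double cross products *)

Section StronglyBicovariant.
Context {k : fieldType} {A H : bialg k} {ra : H -> A -> H} {la : H -> A -> A}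
  {OA OH : dgbialg k} {iA : A -> OA} {iH : H -> OH}
  {Ra : OH -> OA -> OH} {La : OH -> OA -> OA}.
Hypothesis mp : is_matched_pair ra la.
Hypothesis Ra_extends : forall h a, Ra (iH h) (iA a) = iH (ra h a).
Hypothesis La_extends : forall h a, La (iH h) (iA a) = iA (la h a).
Hypothesis smp : is_super_matched_pair Ra La.
Hypothesis bialgA : is_bialgebra A.
Hypothesis bialgH : is_bialgebra H.
Hypothesis eA : is_exterior_algebra iA.
Hypothesis eH : is_exterior_algebra iH.
Hypothesis vA : is_bicovariant_coproduct iA.
Hypothesis vH : is_bicovariant_coproduct iH.
Hypothesis bA : is_super_bialgebra (par OA).
Hypothesis bH : is_super_bialgebra (par OH).

Notation O := (super_double_cross Ra La).
Notation T := (tensor OA OH : lmodType k).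
Notation T0 := (tensor A H : lmodType k).
Notation m := (@mul k (super_double_cross_bialg Ra La) : T -> T -> T).
Notation m0 := (@mul k (double_cross ra la) : T0 -> T0 -> T0).
Notation ι := (tmap iA iH : T0 -> T).
Let gA := ext_grading eA.
Let gH := ext_grading eH.
Let liA := ext_iota_linear eA.
Let liH := ext_iota_linear eH.
Let bB : is_super_bialgebra (par O) :=
  double_cross_par_super_bialgebra eA eH vA vH bA bH smp.
Let eB : @is_exterior_algebra k (double_cross ra la) O ι :=
  double_cross_exterior mp Ra_extends La_extends bialgA bialgH eA eH vA vH bA bH smp.
Let vB : @is_bicovariant_coproduct k (double_cross ra la) O ι :=
  double_cross_bicovariant bialgA bialgH eA eH vA vH bA bH.

Lemma double_cross_is_bialgebra : is_bialgebra (double_cross ra la).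
Proof.
have [r lr ir] := iota_retraction eB.
apply: (even_sub_bialgebra bB (ext_iota_linear eB) lr ir (iota_even eB)).
- exact: ext_iota_one eB.
- exact: ext_iota_mul eB.
- exact: bicov_cop_iota vB.
- exact: bicov_eps_iota vB.
Qed.

(** [A] and [H] are super bialgebras concentrated in even degree. The factorisation
    rules of their double cross product are read off in [OA ⊗ OH]. *)
Lemma double_cross_antipode (SA : A -> A) (SH : H -> H) :
  is_antipode SA -> is_antipode SH ->
  exists S : double_cross ra la -> double_cross ra la, is_antipode S.
Proof.
move=> hSA hSH; have aD := bialgebra_alg double_cross_is_bialgebra.
have coA := bialgebra_coalg bialgA; have coH := bialgebra_coalg bialgH.
have cA := even_parity_coalgebra coA; have cH := even_parity_coalgebra coH.
have sH := sc_super cH; have lcA := cop_linear coA; have lcH := cop_linear coH.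
have bmA := mul_bilin (bialgebra_alg bialgA); have bmH := mul_bilin (bialgebra_alg bialgH).
have leA := eps_linear coA; have leH := eps_linear coH.
have eA0 (w : A) : eps (even_parity true w) = 0 by exact: (lin0 (V := k^o) leA).
have eH0 (x : H) : eps (even_parity true x) = 0 by exact: (lin0 (V := k^o) leH).
have inj := ext_iota_inj eB; have ιM := ext_iota_mul eB.
have iA1 := ext_iota_one eA; have iH1 := ext_iota_one eH.
have ιE a h : ι (a ⊗ h) = iA a ⊗ iH h by rewrite tmap_pure.
have mij (w : A) (x : H) : m0 (w ⊗ one H) (one A ⊗ x) = w ⊗ x.
  by apply: inj; rewrite ιM !ιE iA1 iH1 (double_cross_mul_ij bA bH smp).
have mii (w z : A) : m0 (w ⊗ one H) (z ⊗ one H) = mul w z ⊗ one H.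
  by apply: inj; rewrite ιM !ιE iH1 (double_cross_mul_ii bA bH smp) (ext_iota_mul eA).
have mjj (x y : H) : m0 (one A ⊗ x) (one A ⊗ y) = one A ⊗ mul x y.
  by apply: inj; rewrite ιM !ιE iA1 (double_cross_mul_jj bA bH smp) (ext_iota_mul eH).
have bm := mul_bilin aD.
have copE (t : T0) : @cop k (double_cross ra la) t =
    tens_cop even_parity even_parity cop cop t.
  apply: eq_tlift => a h; rewrite sweedler_even_parity; last by lin.
  by apply: eq_tlift => a1 a2; rewrite sweedler_even_parity; [apply: eq_tlift => h1 h2; rewrite scale1r | lin].
exists (factorised_antipode even_parity even_parity SA SH m0).
split.
- exact: factorised_antipode_linear.
- move=> t; rewrite copE.
  exact: (factorised_antipode_left cA cH eA0 bmA bmH hSA hSH bm (mul_assoc aD)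
    (mul_onel aD) mij mii mjj leA leH).
- move=> t; rewrite copE.
  exact: (factorised_antipode_right cA cH eH0 bmA bmH hSA hSH bm (mul_assoc aD)
    (mul_oner aD) mij mii mjj leA leH).
Qed.

Lemma double_cross_super_antipode : is_super_hopf (par OA) -> is_super_hopf (par OH) ->
  is_super_hopf (par O).
Proof.
move=> [_ [SA [hSA SAe]]] [_ [SH [hSH SHe]]]; split; first exact: bB.
have cA := super_bialgebra_coalgebra bA; have cH := super_bialgebra_coalgebra bH.
have coA := sbialgebra_coalg bA; have coH := sbialgebra_coalg bH.
have leA := eps_linear coA; have leH := eps_linear coH.
have bmA := mul_bilin (sbialgebra_alg bA); have bmH := mul_bilin (sbialgebra_alg bH).
have aB := sbialgebra_alg bB; have bm := mul_bilin aB.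
have mij := double_cross_mul_ij bA bH smp.
have mii := double_cross_mul_ii bA bH smp.
have mjj := double_cross_mul_jj bA bH smp.
have parB := tensor_parityE gA gH.
exists (factorised_antipode (par OA) (par OH) SA SH m).
split; first split.
- exact: factorised_antipode_linear.
- exact: (factorised_antipode_left cA cH (sbialgebra_eps_even bA) bmA bmH hSA hSH bm
    (mul_assoc aB) (mul_onel aB) mij mii mjj leA leH).
- exact: (factorised_antipode_right cA cH (sbialgebra_eps_even bH) bmA bmH hSA hSH bm
    (mul_assoc aB) (mul_oner aB) mij mii mjj leA leH).
rewrite /= -parB => b x; apply: (factorised_antipode_even cA cH) => //.
- exact: sbialgebra_one_even bA.
- exact: sbialgebra_one_even bH.
- by rewrite parB; exact: sbialgebra_mul_even bB.
Qed.

End StronglyBicovariant.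

Theorem theorem3p1 (k : fieldType) (A H : bialg k)
  (ra : H -> A -> H) (la : H -> A -> A)
  (OA OH : dgbialg k) (iA : A -> OA) (iH : H -> OH)
  (Ra : OH -> OA -> OH) (La : OH -> OA -> OA)
  (matched : is_matched_pair ra la)
  (Ra_extends : forall h a, Ra (iH h) (iA a) = iH (ra h a))
  (La_extends : forall h a, La (iH h) (iA a) = iA (la h a))
  (super_matched : is_super_matched_pair Ra La) :
  (strongly_bicovariant iA -> strongly_bicovariant iH ->
   @strongly_bicovariant k (double_cross ra la) (super_double_cross Ra La)
     (tmap iA iH)) /\
  (strongly_bicovariant_hopf iA -> strongly_bicovariant_hopf iH ->
   @strongly_bicovariant_hopf k (double_cross ra la) (super_double_cross Ra La)
     (tmap iA iH)).
Proof.
split=> [[bialgA eA bA vA] [bialgH eH bH vH]|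
  [[bialgA [SA hSA]] eA hA vA] [[bialgH [SH hSH]] eH hH vH]].
  split.
  - exact: (double_cross_is_bialgebra matched Ra_extends La_extends super_matched
      bialgA bialgH eA eH vA vH bA bH).
  - exact: double_cross_exterior.
  - exact: (double_cross_par_super_bialgebra eA eH vA vH bA bH super_matched).
  - exact: double_cross_bicovariant.
have [bA _] := hA; have [bH _] := hH; split.
- split; first exact: (double_cross_is_bialgebra matched Ra_extends La_extends
    super_matched bialgA bialgH eA eH vA vH bA bH).
  exact: (double_cross_antipode matched Ra_extends La_extends super_matched
    bialgA bialgH eA eH vA vH bA bH hSA hSH).
- exact: double_cross_exterior.
- exact: (double_cross_super_antipode super_matched eA eH vA vH bA bH hA hH).
- exact: double_cross_bicovariant.
Qed.
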